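(* Let $c\in\mathbb{R}$, let $(M^3(c),g)$ be a $3$-dimensional space form, i.e. a Riemannian $3$-manifold of constant sectional curvature $c$, let $(N^2,h)$ be a $2$-dimensional Riemannian manifold, and let $\varphi:(M^3(c),g)\to(N^2,h)$ be a Riemannian submersion. If $\varphi$ is triharmonic, then $\varphi$ is harmonic.
   Context: All manifolds, maps and tensor fields are smooth. For a smooth map $\varphi:(M^m,g)\to(N^n,h)$ of Riemannian manifolds, $\nabla$ and $\nabla^N$ are the Levi-Civita connections of $(M,g)$ and $(N,h)$, $\nabla^{\varphi}$ is the induced connection on $\varphi^{-1}TN$, and $\{e_i\}_{i=1}^m$ is a local orthonormal frame on $M$. The tension field is $\tau(\varphi)=\sum_{i=1}^m\big(\nabla^{\varphi}_{e_i}d\varphi(e_i)-d\varphi(\nabla_{e_i}e_i)\big)$, and $\varphi$ is harmonic if $\tau(\varphi)=0$. Curvature convention: $R^N(U,W)=\nabla^N_U\nabla^N_W-\nabla^N_W\nabla^N_U-\nabla^N_{[U,W]}$. For $V\in\Gamma(\varphi^{-1}TN)$ put $$\overline{\triangle}V=\sum_{i=1}^m\big(\nabla^{\varphi}_{e_i}\nabla^{\varphi}_{e_i}V-\nabla^{\varphi}_{\nabla_{e_i}e_i}V\big),\qquad J(V)=\overline{\triangle}V-\sum_{i=1}^mR^N(V,d\varphi(e_i))d\varphi(e_i).$$ The tritension field of $\varphi$ is $$\tau_3(\varphi)=J\big(\overline{\triangle}(\tau(\varphi))\big)-\sum_{i=1}^mR^N\big(\nabla^{\varphi}_{e_i}\tau(\varphi),\tau(\varphi)\big)d\varphi(e_i),$$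 and $\varphi$ is called triharmonic if $\tau_3(\varphi)=0$. *)

(* Defs.v *)
From mathcomp Require Import all_boot all_order all_algebra.
From mathcomp Require Import all_classical all_reals all_analysis.
From mathcomp Require Import ring.

Set Implicit Arguments.
Unset Strict Implicit.
Unset Printing Implicit Defensive.

Import Order.TTheory GRing.Theory Num.Theory.
Import numFieldNormedType.Exports.
Local Open Scope classical_set_scope.
Local Open Scope ring_scope.

Definition basis_vec (R : realType) (n : nat) (i : 'I_n) : 'rV[R]_n :=
  delta_mx 0 i.

Definition partial (R : realType) (n : nat) (W : normedModType R) (i : 'I_n)
    (f : 'rV[R]_n -> W) : 'rV[R]_n -> W :=
  fun x => 'D_(basis_vec R i) f x.

(* C^oo on U: every iterated partial derivative (along any finite list of
   coordinate directions, the empty list included) is differentiable, hence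
   continuous, at every point of U.  Only meaningful for U open; values of f
   off U play no role then. *)
Definition smooth_on (R : realType) (n : nat) (W : normedModType R)
    (U : set 'rV[R]_n) (f : 'rV[R]_n -> W) : Prop :=
  forall (s : seq 'I_n) (x : 'rV[R]_n), U x ->
    differentiable (foldr (@partial R n W) f s) x.

Record manifold (R : realType) (n : nat) := Manifold {
  carrier :> topologicalType;
  carrier_hausdorff : hausdorff_space carrier;
  carrier_second_countable : @second_countable carrier;
  chart : Type;
  chart_dom : chart -> set carrier;
  chart_map : chart -> carrier -> 'rV[R]_n;
  chart_inv : chart -> 'rV[R]_n -> carrier;
  chart_dom_open : forall a, open (chart_dom a);
  chart_img_open : forall a, open (chart_map a @` chart_dom a);
  chart_mapK : forall a p, chart_dom a p -> chart_inv a (chart_map a p) = p;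
  chart_map_continuous : forall a,
    {within chart_dom a, continuous (chart_map a)};
  chart_inv_continuous : forall a,
    {within chart_map a @` chart_dom a, continuous (chart_inv a)};
  chart_cover : forall p, exists a, chart_dom a p;
  transition_smooth : forall a b,
    smooth_on (chart_map a @` (chart_dom a `&` chart_dom b))
      (chart_map b \o chart_inv a) }.

Arguments chart_dom {R n m} a : rename.
Arguments chart_map {R n m} a p : rename.
Arguments chart_inv {R n m} a x : rename.

Definition chart_img (R : realType) (n : nat) (M : manifold R n) (a : chart M) :
  set 'rV[R]_n := chart_map a @` chart_dom a.

Section Maps.
Variables (R : realType) (m n : nat) (M : manifold R m) (N : manifold R n).

(* Expression of phi in the charts a of M and b of N, and the open set of
   coordinates on which it makes sense. *)
Definition local_dom (phi : M -> N) (a : chart M) (b : chart N) :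
  set 'rV[R]_m := chart_map a @` (chart_dom a `&` phi @^-1` chart_dom b).

Definition local_expr (phi : M -> N) (a : chart M) (b : chart N) :
  'rV[R]_m -> 'rV[R]_n := chart_map b \o phi \o chart_inv a.

Definition smooth_map (phi : M -> N) : Prop :=
  continuous phi /\
  forall a b, smooth_on (local_dom phi a b) (local_expr phi a b).

End Maps.

(* A vector field on an open subset of R^n is a map 'rV_n -> 'rV_n; a metric
   is a matrix-valued function G; a connection is given by the bilinear maps
   A x : (u, v) |-> A x u v such that nabla_X Y = D_X Y + A(X, Y). *)

Section Local.
Variables (R : realType) (n : nat).
Implicit Types (G : 'rV[R]_n -> 'M[R]_n)
  (A : 'rV[R]_n -> 'rV[R]_n -> 'rV[R]_n -> 'rV[R]_n)
  (x u v w : 'rV[R]_n) (X Y Z : 'rV[R]_n -> 'rV[R]_n).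

Definition inner G x u v : R := (u *m G x *m v^T) 0 0.

Definition entry G (i j : 'I_n) : 'rV[R]_n -> R := fun x => G x i j.

Definition christoffel_symbol G (i j k : 'I_n) x : R :=
  2^-1 * \sum_(l < n)
    (partial i (entry G j l) x + partial j (entry G i l) x
     - partial l (entry G i j) x) * invmx (G x) l k.

(* The Levi-Civita connection of G; see levi_civita_torsion_free and
   levi_civita_metric below. *)
Definition levi_civita G x u v : 'rV[R]_n :=
  \row_k \sum_(i < n) \sum_(j < n) u 0 i * v 0 j * christoffel_symbol G i j k x.

Definition nabla A X Y : 'rV[R]_n -> 'rV[R]_n :=
  fun x => 'D_(X x) Y x + A x (X x) (Y x).

Definition bracket X Y : 'rV[R]_n -> 'rV[R]_n :=
  fun x => 'D_(X x) Y x - 'D_(Y x) X x.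

Definition curvature A X Y Z : 'rV[R]_n -> 'rV[R]_n :=
  fun x => nabla A X (nabla A Y Z) x - nabla A Y (nabla A X Z) x
           - nabla A (bracket X Y) Z x.

(* The curvature is tensorial: its value on vectors at x is computed on their
   constant extensions. *)
Definition curvature_at A x u v w : 'rV[R]_n :=
  curvature A (fun=> u) (fun=> v) (fun=> w) x.

Definition sectional_curvature G x u v : R :=
  inner G x (curvature_at (levi_civita G) x u v v) u /
  (inner G x u u * inner G x v v - inner G x u v ^+ 2).

Definition orthonormal_frame G (W : set 'rV[R]_n)
    (e : 'I_n -> 'rV[R]_n -> 'rV[R]_n) : Prop :=
  (forall i, smooth_on W (e i)) /\
  (forall x, W x -> forall i j, inner G x (e i x) (e j x) = (i == j)%:R).

End Local.

Section Along.
Variables (R : realType) (m n : nat).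
Variables (G : 'rV[R]_m -> 'M[R]_m) (H : 'rV[R]_n -> 'M[R]_n).
Variables (f : 'rV[R]_m -> 'rV[R]_n) (e : 'I_m -> 'rV[R]_m -> 'rV[R]_m).
Implicit Types (X : 'rV[R]_m -> 'rV[R]_m) (V : 'rV[R]_m -> 'rV[R]_n).

Definition push X : 'rV[R]_m -> 'rV[R]_n := fun x => 'D_(X x) f x.

(* the connection induced on the pull-back bundle f^{-1} TN *)
Definition nabla_along X V : 'rV[R]_m -> 'rV[R]_n :=
  fun x => 'D_(X x) V x + levi_civita H (f x) (push X x) (V x).

Definition tension : 'rV[R]_m -> 'rV[R]_n :=
  fun x => \sum_(i < m)
    (nabla_along (e i) (push (e i)) x
     - push (nabla (levi_civita G) (e i) (e i)) x).

Definition rough_laplacian V : 'rV[R]_m -> 'rV[R]_n :=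
  fun x => \sum_(i < m)
    (nabla_along (e i) (nabla_along (e i) V) x
     - nabla_along (nabla (levi_civita G) (e i) (e i)) V x).

Definition jacobi_operator V : 'rV[R]_m -> 'rV[R]_n :=
  fun x => rough_laplacian V x
    - \sum_(i < m) curvature_at (levi_civita H) (f x)
        (V x) (push (e i) x) (push (e i) x).

Definition tritension : 'rV[R]_m -> 'rV[R]_n :=
  fun x => jacobi_operator (rough_laplacian tension) x
    - \sum_(i < m) curvature_at (levi_civita H) (f x)
        (nabla_along (e i) tension x) (tension x) (push (e i) x).

End Along.

Record riemannian_metric (R : realType) (n : nat) (M : manifold R n) := Metric {
  gmx :> chart M -> 'rV[R]_n -> 'M[R]_n;
  metric_smooth : forall a i j, smooth_on (chart_img a) (entry (gmx a) i j);
  metric_sym : forall a x, chart_img a x -> (gmx a x)^T = gmx a x;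
  metric_pos : forall a x, chart_img a x ->
    forall u, u != 0 -> 0 < inner (gmx a) x u u;
  metric_compat : forall a b p, chart_dom a p -> chart_dom b p ->
    forall u v, inner (gmx a) (chart_map a p) u v =
      inner (gmx b) (chart_map b p)
        ('D_u (chart_map b \o chart_inv a) (chart_map a p))
        ('D_v (chart_map b \o chart_inv a) (chart_map a p)) }.

Definition constant_sectional_curvature (R : realType) (n : nat)
    (M : manifold R n) (g : riemannian_metric M) (c : R) : Prop :=
  forall (a : chart M) x, chart_img a x ->
  forall u v : 'rV[R]_n, row_free (col_mx u v) ->
    sectional_curvature (g a) x u v = c.

Section RiemannianMaps.
Variables (R : realType) (m n : nat) (M : manifold R m) (N : manifold R n).
Variables (g : riemannian_metric M) (h : riemannian_metric N).

(* u is orthogonal to the kernel of the differential of f at x *)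
Definition horizontal (G : 'rV[R]_m -> 'M[R]_m) (f : 'rV[R]_m -> 'rV[R]_n)
    (x u : 'rV[R]_m) : Prop :=
  forall w, 'D_w f x = 0 -> inner G x u w = 0.

Definition riemannian_submersion (phi : M -> N) : Prop :=
  smooth_map phi /\
  forall a b x, local_dom phi a b x ->
    let f := local_expr phi a b in
    (forall v, exists u, 'D_u f x = v) /\
    (forall u w, horizontal (g a) f x u -> horizontal (g a) f x w ->
       inner (h b) (f x) ('D_u f x) ('D_w f x) = inner (g a) x u w).

(* The (tri)tension field does not depend on the charts and the orthonormal
   frame in which it is computed; we ask that it vanish in all of them. *)
Definition harmonic_map (phi : M -> N) : Prop :=
  forall a b (W : set 'rV[R]_m) (e : 'I_m -> 'rV[R]_m -> 'rV[R]_m),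
    open W -> W `<=` local_dom phi a b -> orthonormal_frame (g a) W e ->
    forall x, W x -> tension (g a) (h b) (local_expr phi a b) e x = 0.

Definition triharmonic_map (phi : M -> N) : Prop :=
  forall a b (W : set 'rV[R]_m) (e : 'I_m -> 'rV[R]_m -> 'rV[R]_m),
    open W -> W `<=` local_dom phi a b -> orthonormal_frame (g a) W e ->
    forall x, W x -> tritension (g a) (h b) (local_expr phi a b) e x = 0.

End RiemannianMaps.

(* The Christoffel symbols of G do define its Levi-Civita connection: it is
   torsion-free and compatible with G. *)
Section LeviCivita.
Variables (R : realType) (n : nat) (G : 'rV[R]_n -> 'M[R]_n).
Variables (U : set 'rV[R]_n).
Hypothesis openU : open U.
Hypothesis symG : forall x, U x -> (G x)^T = G x.
Hypothesis posG : forall x, U x -> forall u, u != 0 -> 0 < inner G x u u.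
Hypothesis smoothG : forall i j, smooth_on U (entry G i j).

Lemma partial_entry_sym x i j k : U x ->
  partial k (entry G i j) x = partial k (entry G j i) x.
Proof.
move=> Ux; apply: near_eq_derive; near=> y.
have Uy : U y by near: y; exact: open_nbhs_nbhs.
by rewrite /entry -[in LHS](symG Uy) mxE.
Unshelve. all: by end_near. Qed.

Lemma christoffel_sym x i j k : U x ->
  christoffel_symbol G i j k x = christoffel_symbol G j i k x.
Proof.
move=> Ux; rewrite /christoffel_symbol; congr (_ * _).
apply: eq_bigr => l _; congr (_ * _).
by rewrite [X in X - _]addrC [partial l _ _]partial_entry_sym.
Qed.

Lemma levi_civita_torsion_free (X Y : 'rV[R]_n -> 'rV[R]_n) x : U x ->
  nabla (levi_civita G) X Y x - nabla (levi_civita G) Y X x = bracket X Y x.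
Proof.
move=> Ux; rewrite /nabla /bracket.
have -> : levi_civita G x (X x) (Y x) = levi_civita G x (Y x) (X x).
  apply/rowP => k; rewrite !mxE exchange_big; apply: eq_bigr => i _.
  apply: eq_bigr => j _; rewrite christoffel_sym //; congr (_ * _).
  exact: mulrC.
by rewrite opprD addrACA subrr addr0.
Qed.

Lemma metric_unitmx x : U x -> G x \in unitmx.
Proof.
move=> Ux; rewrite -row_free_unit -kermx_eq0; apply/negPn/negP => /rowV0Pn[u].
move=> /sub_kermxP uG u0; have := posG Ux u0.
by rewrite /inner uG mul0mx mxE ltxx.
Qed.

Lemma innerE x u v : inner G x u v = \sum_j \sum_i u 0 i * G x i j * v 0 j.
Proof.
rewrite /inner mxE; apply: eq_bigr => j _; rewrite !mxE mulr_suml.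
by apply: eq_bigr => i _.
Qed.

Lemma inner_sym x u v : U x -> inner G x u v = inner G x v u.
Proof.
move=> Ux; rewrite !innerE exchange_big; apply: eq_bigr => i _.
by apply: eq_bigr => j _; rewrite -{1}(symG Ux) mxE; ring.
Qed.

Lemma christoffel_lower x i j k : U x ->
  \sum_l christoffel_symbol G i j l x * G x l k =
  2^-1 * (partial i (entry G j k) x + partial j (entry G i k) x
          - partial k (entry G i j) x).
Proof.
move=> Ux.
pose r : 'rV[R]_n := \row_l
  (partial i (entry G j l) x + partial j (entry G i l) x
   - partial l (entry G i j) x).
transitivity (2^-1 * (r *m invmx (G x) *m G x) 0 k); last first.
  by rewrite mulmxKV ?metric_unitmx// mxE.
rewrite mxE mulr_sumr; apply: eq_bigr => l _; rewrite mulrA; congr (_ * _).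
rewrite mxE; congr (_ * _); apply: eq_bigr => l' _; by rewrite mxE.
Qed.

Lemma inner_levi_civita x u v w : U x ->
  inner G x (levi_civita G x u v) w =
  \sum_k \sum_i \sum_j u 0 i * v 0 j * w 0 k * (2^-1 *
    (partial i (entry G j k) x + partial j (entry G i k) x
     - partial k (entry G i j) x)).
Proof.
move=> Ux; rewrite innerE; apply: eq_bigr => k _.
under eq_bigr => l _.
  rewrite mxE -mulrA mulr_suml.
  under eq_bigr do rewrite mulr_suml.
  over.
rewrite exchange_big; apply: eq_bigr => i _.
rewrite exchange_big; apply: eq_bigr => j _ /=.
rewrite -christoffel_lower// mulr_sumr; apply: eq_bigr => l _.
by ring.
Qed.

Lemma derive_entry x v i j : U x ->
  is_derive x v (entry G i j) (\sum_k v 0 k * partial k (entry G i j) x).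
Proof.
move=> Ux; have dG : differentiable (entry G i j) x by
  exact: (smoothG i j [::]).
apply: DeriveDef; first exact: diff_derivable.
rewrite deriveE// {1}(row_sum_delta v) linear_sum; apply: eq_bigr => k _.
by rewrite linearZ /partial deriveE.
Qed.

Lemma levi_civita_metric (X Y Z : 'rV[R]_n -> 'rV[R]_n) x : U x ->
  derivable Y x (X x) -> derivable Z x (X x) ->
  'D_(X x) (fun y => inner G y (Y y) (Z y)) x =
    inner G x (nabla (levi_civita G) X Y x) (Z x)
    + inner G x (Y x) (nabla (levi_civita G) X Z x).
Proof.
move=> Ux dY dZ; set v := X x.
have [/derivable_mxP dY' /derivable_mxP dZ'] := (dY, dZ).
have innerDl u u' w : inner G x (u + u') w = inner G x u w + inner G x u' w.
  by rewrite /inner !mulmxDl mxE.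
rewrite [inner G x (Y x) _]inner_sym// /nabla !innerDl !inner_levi_civita//.
rewrite [inner G x ('D_v Z x) _]inner_sym//.
rewrite !innerE (derive_mx dY) (derive_mx dZ).
have -> : (fun y => inner G y (Y y) (Z y)) =
    \sum_j \sum_i (fun y => Y y 0 i) * entry G i j * (fun y => Z y 0 j).
  apply/funext => y; rewrite innerE fct_sumE; apply: eq_bigr => j _.
  by rewrite fct_sumE; apply: eq_bigr.
have D : is_derive x v
    (\sum_j \sum_i (fun y => Y y 0 i) * entry G i j * (fun y => Z y 0 j))
    (\sum_j \sum_i
      ((Y x 0 i * entry G i j x) *: 'D_v (fun y => Z y 0 j) x
       + Z x 0 j *: (Y x 0 i *: (\sum_k v 0 k * partial k (entry G i j) x)
                     + entry G i j x *: 'D_v (fun y => Y y 0 i) x))).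
  apply: is_derive_sum => j; apply: is_derive_sum => i.
  apply: is_deriveM; last by apply: derivableP; exact: dZ'.
  apply: is_deriveM; last exact: derive_entry.
  by apply: derivableP; exact: dY'.
rewrite (@derive_val _ _ _ _ _ _ _ D).
rewrite [X in _ = _ + (_ + X)](eq_bigr _ (fun k _ => exchange_big _ _ _ _ _ _)).
rewrite [X in _ = _ + (_ + X)]exchange_big /=.
rewrite [X in _ = (_ + X) + _](eq_bigr _ (fun k _ => exchange_big _ _ _ _ _ _)).
rewrite -!big_split; apply: eq_bigr => j _.
rewrite -!big_split; apply: eq_bigr => i _ /=.
rewrite [RHS]addrACA -big_split /=.
rewrite [X in _ = _ + X](_ : _ =
    Z x 0 j * (Y x 0 i * \sum_k v 0 k * partial k (entry G i j) x)); last first.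
  rewrite !mulr_sumr; apply: eq_bigr => k _.
  by rewrite [partial k (entry G j i) x]partial_entry_sym// -/v; field.
rewrite !mxE /GRing.scale /= /entry -/v; ring.
Qed.

End LeviCivita.

(* Main.v *)
(* Near a point where the tension field does not vanish choose an orthonormal
   frame (e1, e2, e3) with e3 vertical and e1, e2 the horizontal lifts of an
   orthonormal frame of N, so that the tension field is -k with
   k = dphi (nabla_e3 e3) = k1 eps1 + k2 eps2.  Constant curvature c gives
     e_a(s) = 4 k_a s,   nabla_a k = k_a k + (c - s) eps_a,   K_N = c + 3 s,
   where s is the square of the integrability tensor.  As K_N is basic,
   e3(s) = 0, and s e3(k_a) = 0.

   With p = |k|^2 and q = p + c + s, the derivation D = k1 e1 + k2 e2 satisfies
   D q = 2 p q and D s = 4 p s.  The triharmonic equation multiplied by the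
   integrability tensor reads
     9 q^2 + c q - 201 q s - c^2 + 44 c s + 353 s^2 = 0,
   and the five weights 4, 2, 6, 0 and 8 occurring in it can be separated by
   applying D, so that 353 s^2 = 0: the horizontal distribution is integrable.

   Then the scalar product of the equation with k is a relation between c and
   X_n = <k, e3^n k> (n <= 4, X_0 = p) and the square B of the area of k and
   e3 k, on which D acts polynomially.  Applying D six times eliminates
   everything but c times a quartic form in p and c; its weights give c = 0,
   and for c = 0 one is left with 9 p^3 + 8 B = 0, which is absurd. *)
Require Import Defs.
From HB Require Import structures.
From mathcomp Require Import all_boot all_order all_algebra.
From mathcomp Require Import all_classical all_reals all_analysis.
From mathcomp Require Import ring lra.

Set Implicit Arguments.
Unset Strict Implicit.
Unset Printing Implicit Defensive.

Import Order.TTheory GRing.Theory Num.Theory.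
Import numFieldNormedType.Exports.
Local Open Scope classical_set_scope.
Local Open Scope ring_scope.

(** * Symmetry of second derivatives *)

(** The geometry becomes polynomial identities in the ring of smooth functions on an open set, with
    the coordinate derivatives as commuting derivations. This ring has zero divisors: s e3(k_a) = 0
    does not split into s = 0 or e3(k_a) = 0, so the equation is multiplied by the integrability
    tensor instead of being treated by cases. Three facts replace a field: a function with zero
    square is zero, positive integers cancel, and p is invertible. The last one is the reason for
    working where the tension field has no zero. There e3(s) = 0 because K_N is pulled back from N,
    and [e_a, e3] = k_a e3 applied to the integrability tensor then gives s e3(k_a) = 0. The
    derivatives e_a(e3^n k_b) contain the rotation coefficients of the frame; these cancel in scalar
    products, so D maps polynomials in c, p, X_n and B to such polynomials. Harmonicity must be
    shown in every orthonormal frame, while the triharmonic equation is given in all of them; hence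
    only the tension field is compared between frames. *)

Lemma near_eq_differentiable (R : numFieldType) (V W : normedModType R)
    (f g : V -> W) (x : V) :
  (\near x, f x = g x) -> differentiable f x -> differentiable g x.
Proof.
move=> fg df; have [dfc dfo] := (diff_locallyP x f).1 df.
have fgx : f x = g x by exact: nbhs_singleton fg.
have go : g \o shift x = cst (g x) + 'd f x +o_ 0 id.
  apply/eqaddoP => e e0; move/eqaddoP : dfo => /(_ e e0) dfo.
  have fg0 : \forall y \near 0, f (y + x) = g (y + x).
    by have := fg; rewrite (near_shift 0 x) subr0.
  by near=> y; rewrite -[_ y]/(_ (y + x) - (g x + 'd f x y)) -fgx -(near fg0 y)//; near: y.
apply/diff_locallyP; rewrite (diff_unique dfc go); split=> //.
Unshelve. all: by end_near. Qed.

Section DirectionalDerivative.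
Variables (R : realType) (V W : normedModType R).

Lemma is_derive_line (f : V -> W) (u y : V) (t : R) :
  differentiable f (t *: u + y) ->
  is_derive t 1 (fun s => f (s *: u + y)) ('D_u f (t *: u + y)).
Proof.
move=> df.
have fE : (fun h => h^-1 *: (((fun s => f (s *: u + y)) \o shift t) (h *: 1)
                             - f (t *: u + y)))
    = (fun h => h^-1 *: ((f \o shift (t *: u + y)) (h *: u) - f (t *: u + y))).
  apply/funext => h /=; congr (_ *: (f _ - _)).
  by rewrite [h *: 1]mulr1 scalerDl addrA.
by apply: DeriveDef; rewrite /derivable /derive fE //; exact: diff_derivable.
Qed.
End DirectionalDerivative.

Lemma dist_half (R : realFieldType) (a b r e : R) :
  `|a - r| <= e / 2 -> `|b - r| <= e / 2 -> `|b - a| <= e.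
Proof.
by rewrite !ler_distl => /andP[? ?] /andP[? ?]; apply/andP; split; lra.
Qed.

Section Schwarz.
Variables (R : realType) (V : normedModType R).

(* Two applications of the mean value theorem; the left-hand side is symmetric
   in [u] and [v]. *)
Lemma second_difference (f : V -> R) (u v x : V) (h : R) : 0 < h ->
  (forall s t, 0 <= s <= h -> 0 <= t <= h ->
    differentiable f (s *: u + (t *: v + x)) /\
    differentiable (fun y => 'D_u f y) (s *: u + (t *: v + x))) ->
  exists s t, [/\ 0 <= s <= h, 0 <= t <= h &
    f (h *: u + (h *: v + x)) - f (h *: u + x) - (f (h *: v + x) - f x)
    = 'D_v (fun y => 'D_u f y) (s *: u + (t *: v + x)) * h * h].
Proof.
move=> h0 df; pose phi s := f (s *: u + (h *: v + x)) - f (s *: u + x).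
have df' s : 0 <= s <= h -> is_derive s 1 phi
    ('D_u f (s *: u + (h *: v + x)) - 'D_u f (s *: u + x)).
  move=> sh; apply: is_deriveB; apply: is_derive_line.
    by apply: (df s h sh _).1; rewrite lexx ltW.
  by have := (df s 0 sh); rewrite scale0r add0r lexx (ltW h0) => /(_ isT)[].
have cphi : {within `[0, h], continuous phi}.
  apply: derivable_within_continuous => s; rewrite in_itv/= => sh.
  exact: (@ex_derive _ _ _ _ _ _ _ (df' _ sh)).
have [s sh sE] := MVT h0 (fun s sh => df' s (subset_itv_oo_cc sh)) cphi.
have {}sh : 0 <= s <= h by move: (subset_itv_oo_cc sh); rewrite in_itv.
pose psi t := 'D_u f (t *: v + (s *: u + x)).
have dg t : 0 <= t <= h -> is_derive t 1 psi
    ('D_v (fun y => 'D_u f y) (t *: v + (s *: u + x))).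
  move=> th; apply: (is_derive_line (f := fun y => 'D_u f y)).
  by rewrite addrCA; exact: (df s t sh th).2.
have cpsi : {within `[0, h], continuous psi}.
  apply: derivable_within_continuous => t; rewrite in_itv/= => th.
  exact: (@ex_derive _ _ _ _ _ _ _ (dg _ th)).
have [t th tE] := MVT h0 (fun s sh => dg s (subset_itv_oo_cc sh)) cpsi.
have {}th : 0 <= t <= h by move: (subset_itv_oo_cc th); rewrite in_itv.
exists s, t; split=> //; move: sE tE; rewrite /phi /psi !scale0r !add0r !subr0.
rewrite ![s *: u + (_ *: v + x)]addrCA => -> ->; by [].
Qed.

(** The second difference over a small parallelogram equals either mixed derivative at some point of
    it, times [h * h]. So the two derivatives agree at two points near [x], and continuity carries
    this to [x]. *)
Lemma schwarz (U : set V) (f : V -> R) (u v x : V) : open U -> U x ->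
  (forall y, U y -> [/\ differentiable f y,
    differentiable (fun y => 'D_u f y) y & differentiable (fun y => 'D_v f y) y]) ->
  {for x, continuous (fun y => 'D_v (fun y => 'D_u f y) y)} ->
  {for x, continuous (fun y => 'D_u (fun y => 'D_v f y) y)} ->
  'D_v (fun y => 'D_u f y) x = 'D_u (fun y => 'D_v f y) x.
Proof.
move=> oU Ux dU cvu cuv; apply/eqP; rewrite eq_sym -subr_eq0 -normr_le0.
apply/ler_addgt0Pr => e e0; rewrite add0r.
have e20 : 0 < e / 2 by rewrite divr_gt0.
have cP : \forall y \near x, [/\ U y,
   `|'D_v (fun y => 'D_u f y) x - 'D_v (fun y => 'D_u f y) y| <= e / 2 &
   `|'D_u (fun y => 'D_v f y) x - 'D_u (fun y => 'D_v f y) y| <= e / 2].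
  have U' : \near x, U x by exact: open_nbhs_nbhs.
  move/cvgrPdist_le : cvu => /(_ _ e20) H1; move/cvgrPdist_le : cuv => /(_ _ e20) H2.
  apply: filterS (filterI U' (filterI H1 H2)) => y [h1 [h2 h3]].
  by split; [exact: h1|exact: h2|exact: h3].
move/nbhs_normP : cP => [d /= d0 dP].
pose K := `|u| + `|v| + 1.
have K0 : 0 < K by rewrite ltr_wpDl// addr_ge0.
(* With this side the parallelogram has diameter below [h * K], which is [d / 2]; the summand 1 in
   [K] covers the case where [u] and [v] both vanish. *)
pose h := d / (2 * K).
have h0 : 0 < h by rewrite divr_gt0 ?mulr_gt0.
have near_x s t : 0 <= s <= h -> 0 <= t <= h ->
    ball_ Num.norm x d (s *: u + (t *: v + x)).
  move=> /andP[s0 sh] /andP[t0 th]; rewrite /ball_ /= addrA opprD addrCA subrr addr0 normrN.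
  apply: (le_lt_trans (ler_normD _ _)); rewrite !normrZ !ger0_norm//.
  apply: (@le_lt_trans _ _ (h * (`|u| + `|v|))).
    by rewrite mulrDr lerD// ler_wpM2r.
  have : h * K < d by rewrite /h invfM mulrA divfK ?gt_eqF// ltr_pdivrMr// ltr_pMr// ltr1n.
  by apply: le_lt_trans; rewrite ler_pM2l// /K lerDl.
have [s [t [sh th E1]]] : exists s t, [/\ 0 <= s <= h, 0 <= t <= h &
    f (h *: u + (h *: v + x)) - f (h *: u + x) - (f (h *: v + x) - f x)
    = 'D_v (fun y => 'D_u f y) (s *: u + (t *: v + x)) * h * h].
  apply: second_difference => // s t sh th.
  by have [/dU[]] := dP _ (near_x _ _ sh th).
have [s' [t' [sh' th' E2]]] : exists s t, [/\ 0 <= s <= h, 0 <= t <= h &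
    f (h *: v + (h *: u + x)) - f (h *: v + x) - (f (h *: u + x) - f x)
    = 'D_u (fun y => 'D_v f y) (s *: v + (t *: u + x)) * h * h].
  apply: second_difference => // s' t' sh' th'; rewrite addrCA.
  by have [/dU[]] := dP _ (near_x _ _ th' sh').
have E : 'D_v (fun y => 'D_u f y) (s *: u + (t *: v + x)) =
         'D_u (fun y => 'D_v f y) (t' *: u + (s' *: v + x)).
  apply: (mulIf (lt0r_neq0 h0)); apply: (mulIf (lt0r_neq0 h0)).
  rewrite (addrCA (s' *: v)) in E2; apply: etrans (esym E1) (etrans _ E2).
  rewrite (addrCA (h *: v)); move: (f _) (f _) (f _) (f _) => a1 a2 a3 a4; ring.
have [_ H1 _] := dP _ (near_x _ _ sh th).
have [_ _ H2] := dP _ (near_x _ _ th' sh').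
by apply: (@dist_half _ _ _ _ e) H2; rewrite -E.
Qed.
End Schwarz.

(** * Calculus of smooth functions *)

Section SmoothUpto.
Variables (R : realType) (n : nat) (W : normedModType R) (U : set 'rV[R]_n).
Hypothesis openU : open U.
Implicit Types f g : 'rV[R]_n -> W.

Lemma near_open (P : 'rV[R]_n -> Prop) x :
  U x -> (forall y, U y -> P y) -> \forall y \near x, P y.
Proof. by move=> Ux UP; apply: filterS UP _; exact: open_nbhs_nbhs. Qed.

Lemma partial_eq_on f g : (forall x, U x -> f x = g x) ->
  forall i x, U x -> partial i f x = partial i g x.
Proof. by move=> fg i x Ux; apply: near_eq_derive; exact: near_open. Qed.

(** Grading by the number of derivatives allows induction in the proofs of closure. The recursion
    peels off the innermost derivative, which is the last letter of the list in [smooth_on]; hence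
    the induction from the right in [smooth_onP]. *)
Fixpoint smooth_upto (k : nat) f : Prop :=
  (forall x, U x -> differentiable f x) /\
  (if k is k'.+1 then forall i, smooth_upto k' (partial i f) else True).

Lemma smooth_upto_diff k f x : smooth_upto k f -> U x -> differentiable f x.
Proof. by case: k => [|k] [+ _]; exact. Qed.

Lemma smooth_onP f : smooth_on U f <-> forall k, smooth_upto k f.
Proof.
split=> [sf k|sf s].
  elim: k f sf => [|k IH] f sf; split=> //; do ?[by move=> x; exact: (sf [::])].
  move=> i; apply: IH => s x Ux.
  rewrite -[foldr _ _ s]/(foldr (@partial R n W) (foldr (@partial R n W) f [:: i]) s).
  rewrite -foldr_cat.
  exact: sf.
have := sf (size s); elim/last_ind: s f {sf} => [|s i IH] f; first by case.
rewrite size_rcons foldr_rcons => -[_ /(_ i)]; exact: IH.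
Qed.

Lemma smooth_uptoW k f : smooth_upto k.+1 f -> smooth_upto k f.
Proof.
by elim: k f => [|k IH] f [df pf]; split=> // i; apply: IH; exact: pf.
Qed.

Lemma smooth_upto_eq k f g : (forall x, U x -> f x = g x) ->
  smooth_upto k f -> smooth_upto k g.
Proof.
elim: k f g => [|k IH] f g fg [df pf]; split=> //.
- by move=> x Ux; apply: near_eq_differentiable (df x Ux); exact: near_open.
- by move=> x Ux; apply: near_eq_differentiable (df x Ux); exact: near_open.
- by move=> i; apply: IH (pf i); exact: partial_eq_on.
Qed.

Lemma smooth_on_eq f g : (forall x, U x -> f x = g x) ->
  smooth_on U f -> smooth_on U g.
Proof.
by move=> fg /smooth_onP sf; apply/smooth_onP => k; exact: smooth_upto_eq (sf k).
Qed.

Lemma smooth_on_diff f x : smooth_on U f -> U x -> differentiable f x.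
Proof. by move=> sf; exact: (sf [::]). Qed.

Lemma smooth_on_partial f i : smooth_on U f -> smooth_on U (partial i f).
Proof. by move=> /smooth_onP sf; apply/smooth_onP => k; have [_ +] := sf k.+1; exact. Qed.

Lemma smooth_upto_cst k (w : W) : smooth_upto k (fun=> w).
Proof.
have h (v : W) x : differentiable (fun=> v : W) (x : 'rV[R]_n) by exact: differentiable_cst.
elim: k w => [|k IH] w; split=> // i.
apply: (@smooth_upto_eq _ (fun=> 0)); last exact: IH.
by move=> x Ux; rewrite /partial derive_cst.
Qed.

Lemma smooth_uptoD k f g : smooth_upto k f -> smooth_upto k g ->
  smooth_upto k (fun x => f x + g x).
Proof.
elim: k f g => [|k IH] f g [df pf] [dg pg]; split=> //.
- by move=> x Ux; apply: differentiableD; [exact: df|exact: dg].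
- by move=> x Ux; apply: differentiableD; [exact: df|exact: dg].
move=> i; apply: smooth_upto_eq (IH _ _ (pf i) (pg i)) => x Ux.
by rewrite /partial [RHS]deriveD//; apply: diff_derivable; [exact: df|exact: dg].
Qed.

Lemma smooth_on_cst (w : W) : smooth_on U (fun=> w).
Proof. by apply/smooth_onP => k; exact: smooth_upto_cst. Qed.

Lemma smooth_onD f g : smooth_on U f -> smooth_on U g ->
  smooth_on U (fun x => f x + g x).
Proof.
by move=> /smooth_onP sf /smooth_onP sg; apply/smooth_onP => k; exact: smooth_uptoD.
Qed.

Lemma smooth_upto_sum k (I : Type) (r : seq I) (P : pred I)
    (F : I -> 'rV[R]_n -> W) : (forall i, P i -> smooth_upto k (F i)) ->
  smooth_upto k (fun x => \sum_(i <- r | P i) F i x).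
Proof.
move=> sF; elim: r => [|i r IH].
  by apply: smooth_upto_eq (smooth_upto_cst k 0) => x _; rewrite big_nil.
case: (boolP (P i)) => Pi.
  by apply: smooth_upto_eq (smooth_uptoD (sF _ Pi) IH) => x _; rewrite big_cons Pi.
by apply: smooth_upto_eq IH => x _; rewrite big_cons (negbTE Pi).
Qed.

Lemma smooth_on_sum (I : Type) (r : seq I) (P : pred I) (F : I -> 'rV[R]_n -> W) :
  (forall i, P i -> smooth_on U (F i)) ->
  smooth_on U (fun x => \sum_(i <- r | P i) F i x).
Proof.
move=> sF; apply/smooth_onP => k; apply: smooth_upto_sum => i Pi.
by move: k; apply/smooth_onP; exact: sF.
Qed.
End SmoothUpto.

Section SmoothScalar.
Variables (R : realType) (n : nat) (U : set 'rV[R]_n).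
Hypothesis openU : open U.
Implicit Types (f g : 'rV[R]_n -> R).
Local Notation smooth_upto := (@smooth_upto R n R U).

Lemma smooth_uptoM k f g : smooth_upto k f -> smooth_upto k g ->
  smooth_upto k (fun x => f x * g x).
Proof.
elim: k f g => [|k IH] f g sf sg; have [df pf] := sf; have [dg pg] := sg; split=> //.
- by move=> x Ux; apply: differentiableM; [exact: df|exact: dg].
- by move=> x Ux; apply: differentiableM; [exact: df|exact: dg].
(* The product rule keeps one factor undifferentiated, which is therefore needed at the lower order
   as well. *)
move=> i; have [sf' sg'] := (smooth_uptoW sf, smooth_uptoW sg).
apply: smooth_upto_eq (smooth_uptoD openU (IH _ _ sf' (pg i))
  (IH _ _ sg' (pf i))) => // x Ux.
by rewrite /partial [RHS]deriveM//; apply: diff_derivable; [exact: df|exact: dg].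
Qed.

Lemma smooth_onM f g : smooth_on U f -> smooth_on U g ->
  smooth_on U (fun x => f x * g x).
Proof.
by move=> /smooth_onP sf /smooth_onP sg; apply/smooth_onP => k; exact: smooth_uptoM.
Qed.

Lemma smooth_onZ c f : smooth_on U f -> smooth_on U (fun x => c * f x).
Proof. by apply: smooth_onM; exact: smooth_on_cst. Qed.

Lemma smooth_onN f : smooth_on U f -> smooth_on U (fun x => - f x).
Proof. by move/(smooth_onZ (-1)); apply: smooth_on_eq => // x _; rewrite mulN1r. Qed.

Lemma smooth_onB f g : smooth_on U f -> smooth_on U g ->
  smooth_on U (fun x => f x - g x).
Proof. by move=> sf /smooth_onN; exact: smooth_onD. Qed.

Lemma smooth_on_prod (I : Type) (r : seq I) (P : pred I) (F : I -> 'rV[R]_n -> R) :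
  (forall i, P i -> smooth_on U (F i)) ->
  smooth_on U (fun x => \prod_(i <- r | P i) F i x).
Proof.
move=> sF; elim: r => [|i r IH].
  by apply: (smooth_on_eq openU _ (smooth_on_cst openU (1 : R))) => x _; rewrite big_nil.
case: (boolP (P i)) => Pi.
  by apply: smooth_on_eq (smooth_onM (sF _ Pi) IH) => // x _; rewrite big_cons Pi.
by apply: (smooth_on_eq openU _ IH) => x _; rewrite big_cons (negbTE Pi).
Qed.

Lemma smooth_onV f : (forall x, U x -> f x != 0) -> smooth_on U f ->
  smooth_on U (fun x => (f x)^-1).
Proof.
move=> f0 /smooth_onP sf; apply/smooth_onP => k.
have dV x : U x -> differentiable (fun x => (f x)^-1) x.
  by move=> Ux; apply: differentiableV; [exact: smooth_upto_diff (sf 0%N) Ux|exact: f0].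
elim: k => [|k IH]; split=> // i.
have [_ /(_ i) spf] := sf k.+1.
have sN := smooth_uptoM (smooth_upto_cst openU k (-1 : R)) spf.
apply: smooth_upto_eq (smooth_uptoM sN (smooth_uptoM IH IH)) => // x Ux.
rewrite /partial [RHS]deriveV ?f0//; last first.
  exact: diff_derivable (smooth_upto_diff (sf 0%N) Ux).
by rewrite /GRing.scale/= expr2 invfM; ring.
Qed.

Lemma smooth_on_sqrt f : (forall x, U x -> 0 < f x) -> smooth_on U f ->
  smooth_on U (fun x => Num.sqrt (f x)).
Proof.
move=> f0 sf; have := sf => /smooth_onP sfk.
have s0 x : U x -> Num.sqrt (f x) != 0 by move=> Ux; rewrite gt_eqF// sqrtr_gt0 f0.
have dsq x : U x -> differentiable (Num.sqrt : R -> R) (f x).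
  by move=> /f0 /is_derive1_sqrt [+ _] => /derivable1_diffP.
have dS x : U x -> differentiable (fun x => Num.sqrt (f x)) x.
  move=> Ux; apply: (@differentiable_comp _ _ _ _ f Num.sqrt); last exact: dsq.
  exact: smooth_on_diff Ux.
apply/smooth_onP; elim=> [|k IH]; split=> // i.
(* The derivative of the root is half of f' over the root, so order [k.+1] calls for the inverse
   root at order [k]. This follows from order [k] of the root itself by a second induction. *)
have sV : smooth_upto k (fun x => (Num.sqrt (f x))^-1).
  clear -openU IH dS s0; elim: k IH => [|k IH] sk.
    by split=> // x Ux; apply: differentiableV; [exact: dS|exact: s0].
  split; first by move=> x Ux; apply: differentiableV; [exact: dS|exact: s0].
  have IH' := IH (smooth_uptoW sk); have [_ sp] := sk => j.
  have sN := smooth_uptoM (smooth_upto_cst openU k (-1 : R)) (sp j).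
  apply: smooth_upto_eq (smooth_uptoM sN (smooth_uptoM IH' IH')) => // x Ux.
  rewrite /partial [RHS]deriveV ?s0//; last exact: diff_derivable (dS x Ux).
  by rewrite /GRing.scale/= expr2 invfM; ring.
have [_ /(_ i) spf] := sfk k.+1.
have sH := smooth_uptoM (smooth_upto_cst openU k (2^-1 : R)) (smooth_uptoM sV spf).
apply: smooth_upto_eq sH => // x Ux.
rewrite /partial [RHS](@deriveE _ _ _ (Num.sqrt \o f)); last exact: dS.
have df : differentiable f x by exact: smooth_on_diff Ux.
rewrite diff_comp//=; last exact: dsq.
rewrite -(deriveE _ df) -[X in 'd _ _ X]mulr1 linearZ -deriveE; last exact: dsq.
have [_ ->] := is_derive1_sqrt (f0 _ Ux).
by rewrite -[RHS]/(_ * _) invfM; ring.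
Qed.
End SmoothScalar.

Section SmoothVector.
Variables (R : realType) (n m : nat) (U : set 'rV[R]_n).
Hypothesis openU : open U.

Lemma differentiable_rVP (f : 'rV[R]_n -> 'rV[R]_m) x :
  differentiable f x <-> forall j, differentiable (fun y => f y 0 j) x.
Proof.
split=> [df j|df].
  apply: (@differentiable_comp _ _ _ _ f (fun v : 'rV[R]_m => v 0 j)) => //.
  exact: differentiable_coord.
have -> : f = \sum_j (fun y => f y 0 j *: (delta_mx 0 j : 'rV[R]_m)).
  by apply/funext => y; rewrite fct_sumE -row_sum_delta.
by apply: differentiable_sum => j; exact: differentiableZl.
Qed.

Lemma derive_rV (f : 'rV[R]_n -> 'rV[R]_m) x v j : differentiable f x ->
  ('D_v f x) 0 j = 'D_v (fun y => f y 0 j) x.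
Proof. by move=> df; rewrite derive_mx ?mxE//; exact: diff_derivable. Qed.

Lemma smooth_on_rVP (f : 'rV[R]_n -> 'rV[R]_m) :
  smooth_on U f <-> forall j, smooth_on U (fun y => f y 0 j).
Proof.
split=> [/smooth_onP sf j|sf]; apply/smooth_onP => k.
  have := sf k; elim: k f {sf} => [|k IH] f [df pf]; split.
  - by move=> x Ux; move/differentiable_rVP : (df x Ux); exact.
  - by [].
  - by move=> x Ux; move/differentiable_rVP : (df x Ux); exact.
  - move=> i; apply: smooth_upto_eq (IH _ (pf i)) => // x Ux.
    by rewrite /partial derive_rV//; exact: df.
have {}sf : forall j, smooth_upto U k (fun y => f y 0 j).
  by move=> j; move/smooth_onP : (sf j).
elim: k f sf => [|k IH] f sf.
  by split=> // x Ux; apply/differentiable_rVP => j; exact: (smooth_upto_diff (sf j)).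
have df x : U x -> differentiable f x.
  by move=> Ux; apply/differentiable_rVP => j; exact: (smooth_upto_diff (sf j)).
split=> // i; apply: IH => j; have [_ /(_ i)] := sf j.
by apply: smooth_upto_eq => // x Ux; rewrite /partial derive_rV//; exact: df.
Qed.
End SmoothVector.

Section SmoothComp.
Variables (R : realType) (n m : nat) (U : set 'rV[R]_n) (O : set 'rV[R]_m).
Hypothesis openU : open U.
Variable f : 'rV[R]_n -> 'rV[R]_m.
Hypotheses (sf : smooth_on U f) (fO : forall x, U x -> O (f x)).

Lemma derive_comp_sum (g : 'rV[R]_m -> R) x v :
  differentiable f x -> differentiable g (f x) ->
  'D_v (g \o f) x = \sum_j partial j g (f x) * 'D_v (fun y => f y 0 j) x.
Proof.
move=> df dg; rewrite deriveE; last exact: differentiable_comp.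
rewrite diff_comp//= -(deriveE _ df) (row_sum_delta ('D_v f x)) linear_sum.
apply: eq_bigr => j _; rewrite linearZ -deriveE// derive_rV//.
by rewrite mulrC.
Qed.

Lemma smooth_on_comp (g : 'rV[R]_m -> R) : smooth_on O g -> smooth_on U (g \o f).
Proof.
have sf1 := (smooth_on_rVP openU f).1 sf.
move=> /smooth_onP sg; apply/smooth_onP => k.
have dc (h : 'rV[R]_m -> R) x : U x -> differentiable h (f x) -> differentiable (h \o f) x.
  by move=> Ux; apply: differentiable_comp; exact: smooth_on_diff Ux.
elim: k g {sg}(sg k) => [|k IH] g [dg pg].
  by split=> // x Ux; apply: dc => //; apply: dg; exact: fO.
split; first by move=> x Ux; apply: dc => //; apply: dg; exact: fO.
move=> i.
have sfi j : smooth_upto U k (partial i (fun y => f y 0 j)).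
  by move: k {IH pg}; apply/smooth_onP; exact: smooth_on_partial.
have : smooth_upto U k (fun x => \sum_j partial j g (f x) * partial i (fun y => f y 0 j) x).
  by apply: smooth_upto_sum => // j _; apply: smooth_uptoM => //; exact: (IH _ (pg j)).
apply: smooth_upto_eq => // x Ux; rewrite [RHS]derive_comp_sum//.
  exact: smooth_on_diff Ux.
by apply: dg; exact: fO.
Qed.
End SmoothComp.

(** * The differential ring of smooth functions on an open set *)

Section SmoothMatrix.
Variables (R : realType) (n : nat) (U : set 'rV[R]_n).
Hypothesis openU : open U.

Lemma smooth_on_det k (M : 'rV[R]_n -> 'M[R]_k) :
  (forall i j, smooth_on U (fun x => M x i j)) -> smooth_on U (fun x => \det (M x)).
Proof.
move=> sM; apply: smooth_on_sum => // s _; apply: smooth_onZ => //.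
exact: smooth_on_prod.
Qed.

(** Cramer's formula: an entry of the inverse is a cofactor divided by the determinant. *)
Lemma smooth_on_invmx k (M : 'rV[R]_n -> 'M[R]_k) :
  (forall i j, smooth_on U (fun x => M x i j)) ->
  (forall x, U x -> M x \in unitmx) ->
  forall i j, smooth_on U (fun x => invmx (M x) i j).
Proof.
move=> sM uM i j.
have sD : smooth_on U (fun x => (\det (M x))^-1).
  apply: smooth_onV => //; last exact: smooth_on_det.
  by move=> x /uM; rewrite unitmxE unitfE.
have sC : smooth_on U (fun x => cofactor (M x) j i).
  apply: smooth_onZ => //; apply: smooth_on_det => i' j'.
  apply: (smooth_on_eq openU _ (sM (lift j i') (lift i j'))) => x _; by rewrite !mxE.
apply: (smooth_on_eq openU _ (smooth_onM openU sD sC)) => x Ux.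
by rewrite /invmx uM// !mxE.
Qed.

Variable G : 'rV[R]_n -> 'M[R]_n.
Hypothesis symG : forall x, U x -> (G x)^T = G x.
Hypothesis posG : forall x, U x -> forall u, u != 0 -> 0 < inner G x u u.
Hypothesis smoothG : forall i j, smooth_on U (entry G i j).

Lemma smooth_on_christoffel i j k : smooth_on U (christoffel_symbol G i j k).
Proof.
apply: smooth_onZ => //; apply: smooth_on_sum => // l _; apply: smooth_onM => //.
  apply: smooth_onB => //; last exact: smooth_on_partial.
  by apply: smooth_onD => //; exact: smooth_on_partial.
by apply: smooth_on_invmx => // x Ux; exact: (metric_unitmx posG Ux).
Qed.
End SmoothMatrix.

Record openset (R : realType) (n : nat) := OpenSet {
  oset :> set 'rV[R]_n;
  oset_open : open oset }.

(* The values of a smooth function off its domain are normalised to 0, so that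
   Leibniz equality is equality on the domain. *)
Record Cinf (R : realType) (n : nat) (U : openset R n) := MkCinf {
  Cinf_val :> 'rV[R]_n -> R;
  Cinf_smooth : smooth_on U Cinf_val;
  Cinf_off : forall x, ~ oset U x -> Cinf_val x = 0 }.

Section CinfRing.
Variables (R : realType) (n : nat) (U : openset R n).
Let oU := @oset_open R n U.
Implicit Types f g h : Cinf U.

Lemma CinfP f g : (forall x, oset U x -> f x = g x) -> f = g.
Proof.
move=> fg; have {fg} : Cinf_val f = Cinf_val g.
  by apply/funext => x; have [/fg//|nU] := pselect (oset U x); rewrite !Cinf_off.
case: f g => [f sf of'] [g sg og] /= fg; subst g.
by congr MkCinf; exact: Prop_irrelevance.
Qed.

Definition on_dom (F : 'rV[R]_n -> R) : 'rV[R]_n -> R :=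
  fun x => if `[< oset U x >] then F x else 0.

Lemma on_domE F x : oset U x -> on_dom F x = F x.
Proof. by rewrite /on_dom => /asboolP ->. Qed.

Lemma on_dom_smooth F : smooth_on U F -> smooth_on U (on_dom F).
Proof. by apply: smooth_on_eq => // x Ux; rewrite on_domE. Qed.

Lemma on_dom_off F x : ~ oset U x -> on_dom F x = 0.
Proof. by rewrite /on_dom; case: asboolP. Qed.

Definition mk_Cinf F (sF : smooth_on U F) : Cinf U :=
  MkCinf (on_dom_smooth sF) (@on_dom_off F).

Lemma mk_CinfE F (sF : smooth_on U F) x : oset U x -> mk_Cinf sF x = F x.
Proof. exact: on_domE. Qed.

Definition cCinf (r : R) : Cinf U := mk_Cinf (smooth_on_cst oU r).
Definition Cinf_opp f := mk_Cinf (smooth_onN oU (Cinf_smooth f)).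
Definition Cinf_add f g := mk_Cinf (smooth_onD oU (Cinf_smooth f) (Cinf_smooth g)).
Definition Cinf_mul f g := mk_Cinf (smooth_onM oU (Cinf_smooth f) (Cinf_smooth g)).

HB.instance Definition _ := gen_eqMixin (Cinf U).
HB.instance Definition _ := gen_choiceMixin (Cinf U).

Lemma Cinf_addA : associative Cinf_add.
Proof. by move=> f g h; apply: CinfP => x Ux; rewrite !mk_CinfE// addrA. Qed.
Lemma Cinf_addC : commutative Cinf_add.
Proof. by move=> f g; apply: CinfP => x Ux; rewrite !mk_CinfE// addrC. Qed.
Lemma Cinf_add0 : left_id (cCinf 0) Cinf_add.
Proof. by move=> f; apply: CinfP => x Ux; rewrite !mk_CinfE// add0r. Qed.
Lemma Cinf_addN : left_inverse (cCinf 0) Cinf_opp Cinf_add.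
Proof. by move=> f; apply: CinfP => x Ux; rewrite !mk_CinfE// addNr. Qed.
HB.instance Definition _ :=
  GRing.isZmodule.Build (Cinf U) Cinf_addA Cinf_addC Cinf_add0 Cinf_addN.

Lemma Cinf_mulA : associative Cinf_mul.
Proof. by move=> f g h; apply: CinfP => x Ux; rewrite !mk_CinfE// mulrA. Qed.
Lemma Cinf_mulC : commutative Cinf_mul.
Proof. by move=> f g; apply: CinfP => x Ux; rewrite !mk_CinfE// mulrC. Qed.
Lemma Cinf_mul1 : left_id (cCinf 1) Cinf_mul.
Proof. by move=> f; apply: CinfP => x Ux; rewrite !mk_CinfE// mul1r. Qed.
Lemma Cinf_mulD : left_distributive Cinf_mul Cinf_add.
Proof. by move=> f g h; apply: CinfP => x Ux; rewrite !mk_CinfE// mulrDl. Qed.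
HB.instance Definition _ := GRing.Zmodule_isComPzRing.Build (Cinf U)
  Cinf_mulA Cinf_mulC Cinf_mul1 Cinf_mulD.

Lemma Cinf0E x : (0 : Cinf U) x = 0.
Proof. by rewrite /= /on_dom; case: ifP. Qed.
Lemma Cinf1E x : oset U x -> (1 : Cinf U) x = 1. Proof. exact: on_domE. Qed.
Lemma cCinfE r x : oset U x -> cCinf r x = r. Proof. exact: on_domE. Qed.
Lemma CinfDE f g x : (f + g) x = f x + g x.
Proof.
have [Ux|nU] := pselect (oset U x); first exact: on_domE.
by rewrite !Cinf_off// addr0.
Qed.
Lemma CinfME f g x : (f * g) x = f x * g x.
Proof.
have [Ux|nU] := pselect (oset U x); first exact: on_domE.
by rewrite !Cinf_off// mulr0.
Qed.
Lemma CinfNE f x : (- f) x = - f x.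
Proof.
have [Ux|nU] := pselect (oset U x); first exact: on_domE.
by rewrite !Cinf_off// oppr0.
Qed.
Lemma Cinf_natE k x : oset U x -> (k%:R : Cinf U) x = k%:R.
Proof.
move=> Ux; elim: k => [|k IH]; first exact: Cinf0E.
by rewrite mulrS CinfDE IH Cinf1E// mulrS.
Qed.
Lemma Cinf_sumE (I : Type) (r : seq I) (P : pred I) (F : I -> Cinf U) x :
  (\sum_(i <- r | P i) F i) x = \sum_(i <- r | P i) F i x.
Proof.
exact: (big_morph (fun f : Cinf U => f x) (fun f g => CinfDE f g x) (Cinf0E x)).
Qed.

Definition pd (i : 'I_n) f : Cinf U :=
  mk_Cinf (smooth_on_partial i (Cinf_smooth f)).

Lemma pdE i f x : oset U x -> pd i f x = partial i f x.
Proof. exact: on_domE. Qed.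

Lemma Cinf_diff f x : oset U x -> differentiable f x.
Proof. exact: smooth_on_diff (Cinf_smooth f). Qed.

Lemma pdD i f g : pd i (f + g) = pd i f + pd i g.
Proof.
apply: CinfP => x Ux; rewrite CinfDE !pdE//.
have -> : Cinf_val (f + g) = Cinf_val f + Cinf_val g.
  by apply/funext => y; rewrite CinfDE.
by rewrite /partial deriveD//; exact/diff_derivable/Cinf_diff.
Qed.

Lemma pdM i f g : pd i (f * g) = pd i f * g + f * pd i g.
Proof.
apply: CinfP => x Ux; rewrite CinfDE !CinfME !pdE//.
have -> : Cinf_val (f * g) = Cinf_val f * Cinf_val g.
  by apply/funext => y; rewrite CinfME.
rewrite /partial deriveM; [|exact/diff_derivable/Cinf_diff..].
by rewrite addrC [X in X + _ = _]mulrC.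
Qed.

Lemma pd_cst i r : pd i (cCinf r) = 0.
Proof.
apply: CinfP => x Ux; rewrite pdE// Cinf0E.
rewrite (@partial_eq_on _ _ _ (oset U) oU _ (fun=> r)) ?/partial ?derive_cst//.
exact: cCinfE.
Qed.

(** Schwarz's theorem in the form used by the algebra: it makes the bracket of vector fields act as
    a commutator, on which tensoriality of the curvature and the Jacobi identity rest. *)
Lemma pdC i j f : pd i (pd j f) = pd j (pd i f).
Proof.
have sp := Cinf_smooth f; have spi k := smooth_on_partial k sp.
apply: CinfP => x Ux.
apply: etrans (pdE i (pd j f) Ux) (etrans _ (esym (pdE j (pd i f) Ux))).
apply: etrans (partial_eq_on oU (fun y Uy => pdE j f Uy) i Ux) _.
apply: etrans _ (esym (partial_eq_on oU (fun y Uy => pdE i f Uy) j Ux)).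
have cp k l : {for x, continuous (partial k (partial l f))}.
  exact/differentiable_continuous/(smooth_on_diff (smooth_on_partial _ (spi _)) Ux).
apply: (schwarz oU Ux) => [y Uy||]; [|exact: cp..].
by split; [exact: smooth_on_diff sp Uy|exact: smooth_on_diff (spi _) Uy..].
Qed.

End CinfRing.

(** * Triharmonic equation in a differential ring *)

Definition derivation (A : comPzRingType) (e : A -> A) : Prop :=
  (forall a b, e (a + b) = e a + e b) /\
  (forall a b, e (a * b) = e a * b + a * e b).

Section Derivation.
Variables (A : comPzRingType) (e : A -> A) (he : derivation e).

Lemma derD a b : e (a + b) = e a + e b. Proof. exact: he.1. Qed.
Lemma derM a b : e (a * b) = e a * b + a * e b. Proof. exact: he.2. Qed.
Lemma der0 : e 0 = 0.
Proof. by apply: (addrI (e 0)); rewrite -derD !addr0. Qed.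
Lemma derN a : e (- a) = - e a.
Proof. by apply: (addrI (e a)); rewrite -derD !subrr der0. Qed.
Lemma der1 : e 1 = 0.
Proof. by apply: (addrI (e 1)); rewrite -[in RHS](mulr1 1) derM !mulr1 mul1r addr0. Qed.
Lemma dern n : e n%:R = 0.
Proof. by elim: n => [|n IH]; rewrite ?der0// mulrS derD IH der1 addr0. Qed.

End Derivation.

(** * Elimination by means of the derivation [D] *)

Section Elimination.
Variables (A : comPzRingType) (D : A -> A) (p p' c : A).
Hypothesis reduced : forall a : A, a * a = 0 -> a = 0.
Hypothesis torsion_free :
  forall (n : nat) (a : A), (0 < n)%N -> n%:R * a = 0 -> a = 0.
Hypothesis dD : derivation D.
Hypothesis p_unit : p' * p = 1.

Lemma p_cancel u : p * u = 0 -> u = 0.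
Proof. by move=> h; rewrite -[u]mul1r -p_unit -mulrA h mulr0. Qed.

Definition eigen (k : nat) u := D u = k%:R * (2 * p * u).

(* Eigenvectors of [D / p] for distinct eigenvalues: a Vandermonde argument. *)
Lemma sum_eigen k x0 x1 x2 x3 x4 : eigen k x0 -> eigen k.+1 x1 ->
  eigen k.+2 x2 -> eigen k.+3 x3 -> eigen k.+4 x4 ->
  x0 + x1 + x2 + x3 + x4 = 0 -> x0 = 0 /\ x4 = 0.
Proof.
rewrite /eigen -[k.+4]addn4 -[k.+3]addn3 -[k.+2]addn2 -[k.+1]addn1 !natrD.
move=> h0 h1 h2 h3 h4.
have red u i v : u = 0 -> D u - i * (2 * p * u) = 2 * p * v -> v = 0.
  move=> -> h; apply: p_cancel; apply: (@torsion_free 2) => //.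
  by rewrite mulrA -h (der0 dD) !mulr0 subr0.
pose E := (dern dD, derN dD, derM dD, derD dD).
(* Removing four eigenvectors multiplies the remaining one by the differences of the weights, 1, 2,
   3 and 4 up to sign, whose product is 24. *)
move=> s0; split; apply: (@torsion_free 24) => //.
  have s1 : - x3 - 2 * x2 - 3 * x1 - 4 * x0 = 0.
    by apply: (red _ (k%:R + 4) _ s0); rewrite !(derD dD) h0 h1 h2 h3 h4; ring.
  have s2 : 2 * x2 + 6 * x1 + 12 * x0 = 0.
    by apply: (red _ (k%:R + 3) _ s1); rewrite !E h0 h1 h2 h3; ring.
  have s3 : - 6 * x1 - 24 * x0 = 0.
    by apply: (red _ (k%:R + 2) _ s2); rewrite !E h0 h1 h2; ring.
  by apply: (red _ (k%:R + 1) _ s3); rewrite !E h0 h1; ring.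
have s1 : x1 + 2 * x2 + 3 * x3 + 4 * x4 = 0.
  by apply: (red _ (k%:R) _ s0); rewrite !(derD dD) h0 h1 h2 h3 h4; ring.
have s2 : 2 * x2 + 6 * x3 + 12 * x4 = 0.
  by apply: (red _ (k%:R + 1) _ s1); rewrite !E h1 h2 h3 h4; ring.
have s3 : 6 * x3 + 24 * x4 = 0.
  by apply: (red _ (k%:R + 2) _ s2); rewrite !E h2 h3 h4; ring.
by apply: (red _ (k%:R + 3) _ s3); rewrite !E h3 h4; ring.
Qed.

Variables (X1 X2 X3 X4 B : A).
Hypotheses (Dc : D c = 0) (Dp : D p = 2 * (p + c) * p).
Hypotheses (DX1 : D X1 = (4 * p + c) * X1)
  (DX2 : D X2 = (5 * p + c) * X2 + 3 * X1 * X1)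
  (DX3 : D X3 = (6 * p + c) * X3 + 10 * X1 * X2)
  (DX4 : D X4 = (7 * p + c) * X4 + 15 * X1 * X3 + 10 * X2 * X2)
  (DB : D B = (6 * p + 2 * c) * B).
Hypothesis F0 : (9 * p * p + 19 * p * c + 9 * c * c) * p + 33 * X1 * X1 + 8 * B
  + (19 * p + 8 * c) * X2 + X4 = 0.
Let DE :=
  (Dc, Dp, DX1, DX2, DX3, DX4, DB, dern dD, derN dD, derM dD, derD dD).

(* [X4], [X1 * X3], [X1 * X1 * X2] and [X1^4] span the top part of the relation;
   [D - w] for the weight [w] of each of them turns it into the next one.  When
   [c] is nonzero, [X1^2], [X2] and [B] are removed together by the second order
   operator used for [F6], which leaves a relation in [p] and [c] alone. *)
Lemma elimination : 9 * p * p * p + 8 * B = 0.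
Proof.
have step w u v : u = 0 -> D u - w * u = v -> v = 0.
  by move=> u0; rewrite u0 (der0 dD) mulr0 subr0.
have F1 : 15 * X1 * X3 + 10 * X2 * X2 + 22 * c * p * X2
    + (90 * p + 57 * c) * X1 * X1 + 8 * (c - p) * B
    + p * (- 9 * p * p * p - 12 * c * p * p + 12 * c * c * p + 9 * c * c * c) = 0.
  by apply: (step (7 * p + c) _ _ F0); rewrite !DE; ring.
have F2 : 210 * X1 * X1 * X2 + 22 * c * p * (c - 3 * p) * X2
    + 132 * c * p * X1 * X1 + 16 * p * (p - 3 * c) * B
    + 6 * p * p * (3 * p * p * p - c * p * p - 20 * c * c * p - 8 * c * c * c) = 0.
  by apply: (step (10 * p + 2 * c) _ _ F1); rewrite !DE; ring.
have F3 : 105 * X1 * X1 * X1 * X1 + 44 * c * p * p * (p - c) * X2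
    + 33 * c * p * (c - 3 * p) * X1 * X1 + 8 * p * (6 * c * p - c * c - p * p) * B
    + p * p * (- 9 * p * p * p * p + 26 * c * p * p * p + 135 * c * c * p * p
               + 12 * c * c * c * p - 8 * c * c * c * c) = 0.
  apply: (@torsion_free 6) => //.
  by apply: (step (13 * p + 3 * c) _ _ F2); rewrite !DE; ring.
have F4 : - 11 * c * (5 * p * p - 10 * c * p + c * c) * X2
    + 132 * c * (p - c) * X1 * X1 + 8 * (p * p - 10 * c * p + 5 * c * c) * B
    + p * (9 * p * p * p * p - 57 * c * p * p * p - 231 * c * c * p * p
           + 105 * c * c * c * p + 30 * c * c * c * c) = 0.
  do 2 apply: p_cancel; apply: (@torsion_free 4) => //.
  by apply: (step (16 * p + 4 * c) _ _ F3); rewrite !DE; ring.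
have F5 : c * (55 * p * (p * p - 10 * c * p + 5 * c * c) * X2
    - 165 * (p * p - 6 * c * p + c * c) * X1 * X1
    + 40 * (5 * p * p - 10 * c * p + c * c) * B
    + 15 * p * (13 * p * p * p * p + 35 * c * p * p * p - 119 * c * c * p * p
                + 5 * c * c * c * p + 2 * c * c * c * c)) = 0.
  (* For [c = 0] the left side of [F4] is [p * p] times [9 * p * p * p + 8 * B], of weight [10 * p];
     removing that weight leaves a multiple of [c]. The extra [c] in the weight makes the
     coefficient of [X2] divisible by [p]. *)
  by apply: (step (10 * p + c) _ _ F4); rewrite !DE; ring.
have F6 : c * (p * p * p * p - 48 * c * p * p * p + 210 * c * c * p * p
    - 168 * c * c * c * p + 21 * c * c * c * c) = 0.
  do 2 apply: p_cancel; apply: (@torsion_free 30) => //.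
  apply: (step (11 * p + 2 * c) _ _ F5).
  (* The multiple of [F4] is fixed by the coefficient of [X2]: the coefficients of [X2] in [F4] and
     [F5] are exchanged, up to factors, by [D] with this weight. The terms in [B] and in [X1 * X1]
     vanish along with it. *)
  have h := mulr0 (25 * c * p); rewrite -{1}F4 in h.
  by rewrite -[LHS]addr0 -h !DE; ring.
have c0 : c = 0.
  (* In terms of [q] and [c] each monomial of the form is an eigenvector, its weight being the
     degree in [q]; only the fifth power of [c] has weight 0. *)
  pose q := p + c; have pq : p = q - c by rewrite /q; ring.
  have Dq : D q = 2 * p * q by rewrite /q (derD dD) Dc Dp; ring.
  have u0 : 448 * (c * c * c * c * c) + - 736 * (c * c * c * c * q)
      + 360 * (c * c * c * q * q) + - 52 * (c * c * q * q * q)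
      + c * q * q * q * q = 0.
    by rewrite -[RHS]F6 [in RHS]pq; ring.
  have c5 : c * c * c * c * c = 0.
    apply: (@torsion_free 448) => //.
    apply: (proj1 (sum_eigen (k := 0) _ _ _ _ _ u0));
      by rewrite /eigen !(Dc, Dq, dern dD, derN dD, derM dD, derD dD); ring.
  (* Three halvings need an exponent that is a power of two, so the fifth power of [c] is completed
     to the eighth. *)
  do 3 apply: reduced.
  by rewrite [LHS](_ : _ = c * c * c * (c * c * c * c * c)); [rewrite c5 mulr0|ring].
by do 2 apply: p_cancel; rewrite c0 in F4; rewrite -[RHS]F4; ring.
Qed.
End Elimination.

(** * Components of the tritension field *)

Section RoughLaplacian.
Variables (A : comPzRingType) (e1 e2 e3 : A -> A) (f1 f2 k1 k2 : A).
Implicit Types (u v : A).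

(* A section [u eps1 + v eps2] of the pull-back bundle is given by its components
   [u] and [v]; [nij u v] is the [j]-th component of its covariant derivative
   along [e_i]. *)
Definition n11 u v := e1 u + f1 * v.
Definition n12 u v := e1 v - f1 * u.
Definition n21 u v := e2 u + f2 * v.
Definition n22 u v := e2 v - f2 * u.

(** The first-order part is the derivative along the sum of the fields nabla_{e_i} e_i, which is (f2
    + k1) e1 + (k2 - f1) e2 + 0 e3. Along the vertical field the pulled-back frame is parallel, so
    [e3] acts on components alone. *)
Definition lap1 u v :=
  n11 (n11 u v) (n12 u v) + n21 (n21 u v) (n22 u v) + e3 (e3 u)
  - (f2 + k1) * n11 u v - (k2 - f1) * n21 u v.
Definition lap2 u v :=
  n12 (n11 u v) (n12 u v) + n22 (n21 u v) (n22 u v) + e3 (e3 v)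
  - (f2 + k1) * n12 u v - (k2 - f1) * n22 u v.

(** On a surface R(X, Y)Z = K (<Y, Z> X - <X, Z> Y). Hence the sum of R(V, eps_i) eps_i is K V, and
    the sum of R(nabla_i tau, tau) eps_i is K times nabla_tau tau - (div tau) tau, where tau has
    components [u], [v] and is lifted horizontally for differentiation. *)
Definition tri1 (K u v : A) :=
  lap1 (lap1 u v) (lap2 u v) - K * lap1 u v
  - K * (u * n11 u v + v * n21 u v - (n11 u v + n22 u v) * u).
Definition tri2 (K u v : A) :=
  lap2 (lap1 u v) (lap2 u v) - K * lap2 u v
  - K * (u * n12 u v + v * n22 u v - (n11 u v + n22 u v) * v).
End RoughLaplacian.

(** * The triharmonic equation in an adapted frame, with integrability tensor [g] *)

Section Triharmonic.
Variables (A : comPzRingType) (e1 e2 e3 : A -> A) (f1 f2 k1 k2 g c : A).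
Hypothesis reduced : forall a : A, a * a = 0 -> a = 0.
Hypothesis torsion_free :
  forall (n : nat) (a : A), (0 < n)%N -> n%:R * a = 0 -> a = 0.
Hypotheses (d1 : derivation e1) (d2 : derivation e2) (d3 : derivation e3).
Hypotheses (c1 : e1 c = 0) (c2 : e2 c = 0) (c3 : e3 c = 0).
Hypothesis br13 : forall a, e1 (e3 a) = e3 (e1 a) + k1 * e3 a.
Hypothesis br23 : forall a, e2 (e3 a) = e3 (e2 a) + k2 * e3 a.
Hypotheses (basic1 : e3 f1 = 0) (basic2 : e3 f2 = 0).
Hypotheses (e1g : e1 g = 2 * k1 * g) (e2g : e2 g = 2 * k2 * g).
Hypothesis e1k1' : e1 k1 = k1 * k1 + c - g * g - f1 * k2.
Hypothesis e1k2' : e1 k2 = k1 * k2 + f1 * k1 + e3 g.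
Hypothesis e2k1' : e2 k1 = k1 * k2 - f2 * k2 - e3 g.
Hypothesis e2k2' : e2 k2 = k2 * k2 + c - g * g + f2 * k1.
Hypothesis gauss : e1 f2 - e2 f1 - f1 * f1 - f2 * f2 = c + 3 * g * g.
Let K := c + 3 * g * g.
Hypothesis tri_1 : tri1 e1 e2 e3 f1 f2 k1 k2 K (- k1) (- k2) = 0.
Hypothesis tri_2 : tri2 e1 e2 e3 f1 f2 k1 k2 K (- k1) (- k2) = 0.
Let p := k1 * k1 + k2 * k2.
Variable p' : A.
Hypothesis p_unit : p' * p = 1.

Let der1E := (derD d1, derN d1, derM d1, dern d1, c1).
Let der2E := (derD d2, derN d2, derM d2, dern d2, c2).
Let der3E := (derD d3, derN d3, derM d3, dern d3, c3).

(** The left side of [gauss] is built from the basic functions [f1] and [f2], and horizontal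
    derivatives of a basic function are basic by [br13] and [br23]. So [e3] kills
    [c + 3 * g * g]. *)
Let e3g : e3 g = 0.
Proof.
have h : g * e3 g = 0.
  apply: (@torsion_free 6) => //.
  have <- : e3 (c + 3 * g * g) = 6 * (g * e3 g) by rewrite !der3E; ring.
  rewrite -gauss !der3E basic1 basic2.
  have -> : e3 (e1 f2) = 0 by have := br13 f2; rewrite basic2 (der0 d1) mulr0 addr0.
  have -> : e3 (e2 f1) = 0 by have := br23 f1; rewrite basic1 (der0 d2) mulr0 addr0.
  by ring.
(* Only [g * e3 g = 0] is known so far. Differentiating it along [e3] shows that the fourth power of
   [e3 g] contains the factor [g * e3 g]. *)
have h2 : e3 g * e3 g = - (g * e3 (e3 g)).
  by apply/eqP; rewrite -addr_eq0 -(derM d3) h (der0 d3).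
apply: reduced; apply: reduced.
rewrite {1}h2 (_ : _ * _ = - (g * e3 g) * (e3 (e3 g) * e3 g)); last by ring.
by rewrite h oppr0 mul0r.
Qed.

Let e1k1 : e1 k1 = k1 * k1 + c - g * g - f1 * k2. Proof. exact: e1k1'. Qed.
Let e1k2 : e1 k2 = k1 * k2 + f1 * k1. Proof. by rewrite e1k2' e3g addr0. Qed.
Let e2k1 : e2 k1 = k1 * k2 - f2 * k2. Proof. by rewrite e2k1' e3g subr0. Qed.
Let e2k2 : e2 k2 = k2 * k2 + c - g * g + f2 * k1. Proof. exact: e2k2'. Qed.
Local Notation l1 := (e3 k1). Local Notation l2 := (e3 k2).
Local Notation m1 := (e3 l1). Local Notation m2 := (e3 l2).
Local Notation n1 := (e3 m1). Local Notation n2 := (e3 m2).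
Local Notation o1 := (e3 n1). Local Notation o2 := (e3 n2).

(* [e3^n k_b] has horizontal covariant derivative in the direction [e_a] equal
   to the sum over [j] of ['C(n.+1, j.+1) * e3^j k_a * e3^(n - j) k_b]. *)
Let e1l1 : e1 l1 = 2 * k1 * l1 + l1 * k1 - f1 * l2.
Proof. by rewrite br13 e1k1 !der3E basic1 ?e3g; ring. Qed.
Let e1l2 : e1 l2 = 2 * k1 * l2 + l1 * k2 + f1 * l1.
Proof. by rewrite br13 e1k2 !der3E basic1 ?e3g; ring. Qed.
Let e2l1 : e2 l1 = 2 * k2 * l1 + l2 * k1 - f2 * l2.
Proof. by rewrite br23 e2k1 !der3E basic2 ?e3g; ring. Qed.
Let e2l2 : e2 l2 = 2 * k2 * l2 + l2 * k2 + f2 * l1.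
Proof. by rewrite br23 e2k2 !der3E basic2 ?e3g; ring. Qed.
Let e1m1 : e1 m1 = 3 * k1 * m1 + 3 * l1 * l1 + m1 * k1 - f1 * m2.
Proof. by rewrite br13 e1l1 !der3E basic1; ring. Qed.
Let e1m2 : e1 m2 = 3 * k1 * m2 + 3 * l1 * l2 + m1 * k2 + f1 * m1.
Proof. by rewrite br13 e1l2 !der3E basic1; ring. Qed.
Let e2m1 : e2 m1 = 3 * k2 * m1 + 3 * l2 * l1 + m2 * k1 - f2 * m2.
Proof. by rewrite br23 e2l1 !der3E basic2; ring. Qed.
Let e2m2 : e2 m2 = 3 * k2 * m2 + 3 * l2 * l2 + m2 * k2 + f2 * m1.
Proof. by rewrite br23 e2l2 !der3E basic2; ring. Qed.
Let e1n1 : e1 n1 = 4 * k1 * n1 + 6 * l1 * m1 + 4 * m1 * l1 + n1 * k1 - f1 * n2.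
Proof. by rewrite br13 e1m1 !der3E basic1; ring. Qed.
Let e1n2 : e1 n2 = 4 * k1 * n2 + 6 * l1 * m2 + 4 * m1 * l2 + n1 * k2 + f1 * n1.
Proof. by rewrite br13 e1m2 !der3E basic1; ring. Qed.
Let e2n1 : e2 n1 = 4 * k2 * n1 + 6 * l2 * m1 + 4 * m2 * l1 + n2 * k1 - f2 * n2.
Proof. by rewrite br23 e2m1 !der3E basic2; ring. Qed.
Let e2n2 : e2 n2 = 4 * k2 * n2 + 6 * l2 * m2 + 4 * m2 * l2 + n2 * k2 + f2 * n1.
Proof. by rewrite br23 e2m2 !der3E basic2; ring. Qed.
Let e1o1 : e1 o1 =
  5 * k1 * o1 + 10 * l1 * n1 + 10 * m1 * m1 + 5 * n1 * l1 + o1 * k1 - f1 * o2.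
Proof. by rewrite br13 e1n1 !der3E basic1; ring. Qed.
Let e1o2 : e1 o2 =
  5 * k1 * o2 + 10 * l1 * n2 + 10 * m1 * m2 + 5 * n1 * l2 + o1 * k2 + f1 * o1.
Proof. by rewrite br13 e1n2 !der3E basic1; ring. Qed.
Let e2o1 : e2 o1 =
  5 * k2 * o1 + 10 * l2 * n1 + 10 * m2 * m1 + 5 * n2 * l1 + o2 * k1 - f2 * o2.
Proof. by rewrite br23 e2n1 !der3E basic2; ring. Qed.
Let e2o2 : e2 o2 =
  5 * k2 * o2 + 10 * l2 * n2 + 10 * m2 * m2 + 5 * n2 * l2 + o2 * k2 + f2 * o1.
Proof. by rewrite br23 e2n2 !der3E basic2; ring. Qed.

Let rules1 := (e1k1, e1k2, e1l1, e1l2, e1m1, e1m2, e1g).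
Let rules2 := (e2k1, e2k2, e2l1, e2l2, e2m1, e2m2, e2g).
Let s := g * g.
Let q1 := p + 2 * c - 6 * s.

Let n11k : n11 e1 f1 k1 k2 = k1 * k1 + c - s.
Proof. by rewrite /n11 e1k1 /s; ring. Qed.
Let n12k : n12 e1 f1 k1 k2 = k1 * k2.
Proof. by rewrite /n12 e1k2 /s; ring. Qed.
Let n21k : n21 e2 f2 k1 k2 = k1 * k2.
Proof. by rewrite /n21 e2k1 /s; ring. Qed.
Let n22k : n22 e2 f2 k1 k2 = k2 * k2 + c - s.
Proof. by rewrite /n22 e2k2 /s; ring. Qed.

Let lap1k : lap1 e1 e2 e3 f1 f2 k1 k2 k1 k2 = q1 * k1 + m1.
Proof.
rewrite /lap1 !n11k !n12k !n21k !n22k /n11 /n21 /s.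
by rewrite !der1E !der2E !rules1 !rules2 /q1 /p /s; ring.
Qed.
Let lap2k : lap2 e1 e2 e3 f1 f2 k1 k2 k1 k2 = q1 * k2 + m2.
Proof.
rewrite /lap2 !n11k !n12k !n21k !n22k /n12 /n22 /s.
by rewrite !der1E !der2E !rules1 !rules2 /q1 /p /s; ring.
Qed.

Let w1 := q1 * k1 + m1.
Let w2 := q1 * k2 + m2.
Let a := k1 * l1 + k2 * l2.
Let b := l1 * l1 + l2 * l2.
Let d := k1 * m1 + k2 * m2.
(** The horizontal gradient of [q1] is [dq1] times k, since e_a(p) = 2 (p + c - s) k_a and e_a(s) =
    4 s k_a. *)
Let dq1 := 2 * (p + c - 13 * s).

Let n11w : n11 e1 f1 w1 w2 =
  dq1 * k1 * k1 + q1 * (k1 * k1 + c - s) + m1 * k1 + 3 * l1 * l1 + 3 * k1 * m1.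
Proof. by rewrite /n11 /w1 /w2 /q1 /p /s !der1E !rules1 /dq1 /p /s; ring. Qed.
Let n12w : n12 e1 f1 w1 w2 =
  dq1 * k1 * k2 + q1 * k1 * k2 + m1 * k2 + 3 * l1 * l2 + 3 * k1 * m2.
Proof. by rewrite /n12 /w1 /w2 /q1 /p /s !der1E !rules1 /dq1 /p /s; ring. Qed.
Let n21w : n21 e2 f2 w1 w2 =
  dq1 * k1 * k2 + q1 * k1 * k2 + m2 * k1 + 3 * l1 * l2 + 3 * k2 * m1.
Proof. by rewrite /n21 /w1 /w2 /q1 /p /s !der2E !rules2 /dq1 /p /s; ring. Qed.
Let n22w : n22 e2 f2 w1 w2 =
  dq1 * k2 * k2 + q1 * (k2 * k2 + c - s) + m2 * k2 + 3 * l2 * l2 + 3 * k2 * m2.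
Proof. by rewrite /n22 /w1 /w2 /q1 /p /s !der2E !rules2 /dq1 /p /s; ring. Qed.

(** The coefficient of k in the triharmonic equation once all vertical derivatives of k are
    dropped. *)
Let P := 9 * p * p + 19 * p * c - 183 * p * s + 9 * c * c - 138 * c * s + 161 * s * s.

Let e3q1 : e3 q1 = 2 * a.
Proof. by rewrite /q1 /p /s !der3E e3g /a; ring. Qed.
Let e3a : e3 a = b + d.
Proof. by rewrite /a !der3E /b /d; ring. Qed.

Let e33w1 : e3 (e3 w1) = 2 * (b + d) * k1 + 4 * a * l1 + q1 * m1 + o1.
Proof.
by rewrite /w1 !(der3E, e3q1, e3a); ring.
Qed.
Let e33w2 : e3 (e3 w2) = 2 * (b + d) * k2 + 4 * a * l2 + q1 * m2 + o2.
Proof.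
by rewrite /w2 !(der3E, e3q1, e3a); ring.
Qed.

Let lap1N u v :
  lap1 e1 e2 e3 f1 f2 k1 k2 (- u) (- v) = - lap1 e1 e2 e3 f1 f2 k1 k2 u v.
Proof.
by rewrite /lap1 /n11 /n12 /n21 /n22
  !(derN d1, derN d2, derN d3, derD d1, derD d2, derM d1, derM d2); ring.
Qed.
Let lap2N u v :
  lap2 e1 e2 e3 f1 f2 k1 k2 (- u) (- v) = - lap2 e1 e2 e3 f1 f2 k1 k2 u v.
Proof.
by rewrite /lap2 /n11 /n12 /n21 /n22
  !(derN d1, derN d2, derN d3, derD d1, derD d2, derM d1, derM d2); ring.
Qed.

(** The tension field is -k, so the equation is taken with the opposite sign; the curvature term
    quadratic in the tension field keeps its sign under k to -k. The coefficients [f1] and [f2]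
    cancel because the equation does not depend on how the horizontal frame is rotated. *)
Let tri1_eq : (P + 8 * b + 9 * d) * k1 + 25 * a * l1
  + (10 * p + 8 * c - 16 * s) * m1 + o1 = 0.
Proof.
rewrite -[RHS]oppr0 -tri_1 /tri1.
rewrite !(lap1N, lap2N) lap1k lap2k /lap1 -/w1 -/w2.
rewrite !n11w !n12w !n21w !n22w e33w1 /n11 /n21 /n22 !(derN d1, derN d2).
rewrite /dq1 /q1 /p /s !(der1E, der2E) !(rules1, rules2).
by rewrite /K /P /w1 /w2 /q1 /dq1 /a /b /d /p /s; ring.
Qed.

Let tri2_eq : (P + 8 * b + 9 * d) * k2 + 25 * a * l2
  + (10 * p + 8 * c - 16 * s) * m2 + o2 = 0.
Proof.
rewrite -[RHS]oppr0 -tri_2 /tri2.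
rewrite !(lap1N, lap2N) lap1k lap2k /lap2 -/w1 -/w2.
rewrite !n11w !n12w !n21w !n22w e33w2 /n11 /n12 /n22 !(derN d1, derN d2).
rewrite /dq1 /q1 /p /s !(der1E, der2E) !(rules1, rules2).
by rewrite /K /P /w1 /w2 /q1 /dq1 /a /b /d /p /s; ring.
Qed.

Let D u := k1 * e1 u + k2 * e2 u.
Let q := p + c + s.

Let dD : derivation D.
Proof.
by split=> u v; rewrite /D ?(derD d1, derD d2, derM d1, derM d2); ring.
Qed.
Let Dc : D c = 0. Proof. by rewrite /D c1 c2; ring. Qed.
Let Dg : D g = 2 * p * g. Proof. by rewrite /D e1g e2g /p; ring. Qed.
Let Dp : D p = 2 * (p + c - s) * p.
Proof. by rewrite /D /p !(der1E, der2E) !(rules1, rules2) /s; ring. Qed.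
Let Ds : D s = 4 * p * s. Proof. by rewrite (derM dD) Dg /s; ring. Qed.
Let Dq : D q = 2 * p * q.
Proof. by rewrite /q (derD dD) (derD dD) Dp Dc Ds; ring. Qed.
Let DE := (Dc, Dg, Ds, Dq, dern dD, derN dD, derM dD, derD dD).

(** Multiplication by [g] annihilates every vertical derivative of k, so the triharmonic equation
    times [g] reduces to an algebraic relation that the weights of [D] can separate. *)
Let g_eq0 : g = 0.
Proof.
(* Apply [e1, e3] = k1 e3 to [g]: as [e3 g = 0], what remains is the [e3] derivative of
   [2 * k1 * g]. *)
have gl1 : g * l1 = 0.
  apply: (@torsion_free 2) => //; have := br13 g; rewrite e3g (der0 d1) e1g !der3E e3g.
  by move=> /esym h; rewrite -[RHS]h; ring.
have gl2 : g * l2 = 0.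
  apply: (@torsion_free 2) => //; have := br23 g; rewrite e3g (der0 d2) e2g !der3E e3g.
  by move=> /esym h; rewrite -[RHS]h; ring.
have e3gM u : g * u = 0 -> g * e3 u = 0.
  by move=> h; have := derM d3 g u; rewrite h e3g (der0 d3) mul0r add0r => <-.
have [gm1 gm2] := (e3gM _ gl1, e3gM _ gl2).
have [go1 go2] := (e3gM _ (e3gM _ gm1), e3gM _ (e3gM _ gm2)).
have gP1 : g * P * k1 = 0.
  have : g * 0 = 0 := mulr0 g; rewrite -{1}tri1_eq => h; rewrite -[RHS]h.
  rewrite /b /d [RHS](_ : _ = g * P * k1
    + 8 * (g * l1) * l1 * k1 + 8 * (g * l2) * l2 * k1
    + 9 * (k1 * (g * m1) + k2 * (g * m2)) * k1 + 25 * a * (g * l1)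
    + (10 * p + 8 * c - 16 * s) * (g * m1) + g * o1); last by ring.
  by rewrite gl1 gl2 gm1 gm2 go1; ring.
have gP2 : g * P * k2 = 0.
  have : g * 0 = 0 := mulr0 g; rewrite -{1}tri2_eq => h; rewrite -[RHS]h.
  rewrite /b /d [RHS](_ : _ = g * P * k2
    + 8 * (g * l1) * l1 * k2 + 8 * (g * l2) * l2 * k2
    + 9 * (k1 * (g * m1) + k2 * (g * m2)) * k2 + 25 * a * (g * l2)
    + (10 * p + 8 * c - 16 * s) * (g * m2) + g * o2); last by ring.
  by rewrite gl1 gl2 gm1 gm2 go2; ring.
(* Contracting with k turns k into the invertible [p]. In the variables [c], [q], [s] each monomial
   is an eigenvector, and the common factor [g], itself of weight 1, shifts the weights to 1, ...,
   5. *)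
have u0 : - g * c * c + g * c * q + g * (9 * q * q + 44 * c * s)
    + - 201 * (g * q * s) + 353 * (g * s * s) = 0.
  apply: (p_cancel p_unit); rewrite [LHS](_ : _ = g * P * k1 * k1 + g * P * k2 * k2).
    by rewrite gP1 gP2; ring.
  by rewrite /P /q /p; ring.
have u4 : 353 * (g * s * s) = 0.
  by apply: (proj2 (sum_eigen torsion_free dD p_unit (k := 1) _ _ _ _ _ u0));
    rewrite /eigen !DE; ring.
have gss : g * s * s = 0 by exact: (@torsion_free 353).
(* As [s] is [g * g], the fifth power of [g] is zero; two rounds of reducedness bring this down to
   [g]. *)
have gs : g * s = 0.
  by apply: reduced; rewrite [LHS](_ : _ = g * (g * s * s)); [rewrite gss mulr0|ring].
apply: reduced; apply: reduced.
by rewrite [LHS](_ : _ = g * (g * s)); [rewrite gs mulr0|rewrite /s; ring].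
Qed.

Let X1 := a.
Let X2 := d.
Let X3 := k1 * n1 + k2 * n2.
Let X4 := k1 * o1 + k2 * o2.
Let y := k1 * l2 - k2 * l1.
Let B := y * y.

Let s0 : s = 0. Proof. by rewrite /s g_eq0 mul0r. Qed.
Let gg0 : g * g = 0. Proof. exact: s0. Qed.
Let rD := (e1k1, e1k2, e2k1, e2k2, e1l1, e1l2, e2l1, e2l2, e1m1, e1m2, e2m1,
  e2m2, e1n1, e1n2, e2n1, e2n2, e1o1, e1o2, e2o1, e2o2, gg0).
Let Dp0 : D p = 2 * (p + c) * p. Proof. by rewrite Dp s0 subr0. Qed.
Let DX1 : D X1 = (4 * p + c) * X1.
Proof. by rewrite /D /X1 /a !(der1E, der2E) !rD /p; ring. Qed.
Let DX2 : D X2 = (5 * p + c) * X2 + 3 * X1 * X1.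
Proof. by rewrite /D /X2 /d !(der1E, der2E) !rD /X1 /a /p; ring. Qed.
Let DX3 : D X3 = (6 * p + c) * X3 + 10 * X1 * X2.
Proof. by rewrite /D /X3 !(der1E, der2E) !rD /X1 /X2 /a /d /p; ring. Qed.
Let DX4 : D X4 = (7 * p + c) * X4 + 15 * X1 * X3 + 10 * X2 * X2.
Proof. by rewrite /D /X4 !(der1E, der2E) !rD /X1 /X2 /X3 /a /d /p; ring. Qed.
Let DB : D B = (6 * p + 2 * c) * B.
Proof. by rewrite /D /B /y !(der1E, der2E) !rD /p; ring. Qed.

(** Lagrange's identity [b * p = X1 * X1 + B] removes [b]; thus 33 is 25 + 8, and 19 is 9 + 10. *)
Let F0 : (9 * p * p + 19 * p * c + 9 * c * c) * p + 33 * X1 * X1 + 8 * B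
  + (19 * p + 8 * c) * X2 + X4 = 0.
Proof.
have : k1 * 0 + k2 * 0 = 0 :> A by rewrite !mulr0 addr0.
rewrite -{1}tri1_eq -tri2_eq /P s0 => h; rewrite -[RHS]h.
by rewrite /X1 /X2 /X4 /B /y /a /b /d /p; ring.
Qed.

Lemma triharmonic_relation : 9 * p * p * p + 8 * (y * y) = 0.
Proof.
exact: (elimination reduced torsion_free dD p_unit Dc Dp0 DX1 DX2 DX3 DX4 DB F0).
Qed.
End Triharmonic.

(** * Connections on the vector fields of a differential ring *)

Section DerivationSum.
Variables (A : comPzRingType) (e : A -> A) (he : derivation e).
Lemma der_sum (I : Type) (r : seq I) (P : pred I) (F : I -> A) :
  e (\sum_(i <- r | P i) F i) = \sum_(i <- r | P i) e (F i).
Proof. exact: (big_morph e (derD he) (der0 he)). Qed.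
End DerivationSum.

Section RowEntries.
Variables (A : comPzRingType) (n : nat).
Implicit Types u v : 'rV[A]_n.
Lemma rvD u v k : (u + v) 0 k = u 0 k + v 0 k. Proof. by rewrite mxE. Qed.
Lemma rvN u k : (- u) 0 k = - u 0 k. Proof. by rewrite mxE. Qed.
Lemma rvZ a u k : (a *: u) 0 k = a * u 0 k. Proof. by rewrite mxE. Qed.
Lemma rv0 k : (0 : 'rV[A]_n) 0 k = 0. Proof. by rewrite mxE. Qed.
Definition rvE := (rvD, rvN, rvZ, rv0).
End RowEntries.

Section Connection.
Variables (A : comPzRingType) (n : nat) (d : 'I_n -> A -> A).
Variable (Ga : 'I_n -> 'I_n -> 'I_n -> A).
Hypothesis hd : forall i, derivation (d i).
Hypothesis dC : forall i j a, d i (d j a) = d j (d i a).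
Implicit Types (X Y Z : 'rV[A]_n) (a b : A).

Definition act X a : A := \sum_i X 0 i * d i a.

Definition lie X Y : 'rV[A]_n := \row_k (act X (Y 0 k) - act Y (X 0 k)).

Definition nab X Y : 'rV[A]_n :=
  \row_k (act X (Y 0 k) + \sum_i \sum_j X 0 i * Y 0 j * Ga i j k).

Definition curv X Y Z := nab X (nab Y Z) - nab Y (nab X Z) - nab (lie X Y) Z.

Lemma act_derivation X : derivation (act X).
Proof.
split=> a b; rewrite /act.
  by rewrite -big_split; apply: eq_bigr => i _; rewrite (derD (hd i)) mulrDr.
rewrite mulr_suml mulr_sumr -big_split; apply: eq_bigr => i _ /=.
by rewrite (derM (hd i)); ring.
Qed.
Let hact X := act_derivation X.

Lemma actDl X Y a : act (X + Y) a = act X a + act Y a.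
Proof. by rewrite /act -big_split; apply: eq_bigr => i _; rewrite rvD mulrDl. Qed.
Lemma actZl b X a : act (b *: X) a = b * act X a.
Proof. by rewrite /act mulr_sumr; apply: eq_bigr => i _; rewrite rvZ mulrA. Qed.
Lemma actNl X a : act (- X) a = - act X a.
Proof. by rewrite -scaleN1r actZl mulN1r. Qed.
Lemma act0l a : act 0 a = 0.
Proof. by rewrite -(scale0r (0 : 'rV[A]_n)) actZl mul0r. Qed.

(** The second-order terms of the two compositions agree because the derivations [d i] commute. *)
Lemma act_lie X Y a : act (lie X Y) a = act X (act Y a) - act Y (act X a).
Proof.
rewrite {3 5}/act !(der_sum (hact _)) -sumrB.
under [RHS]eq_bigr do rewrite !(derM (hact _)).
transitivity (act (lie X Y) a
    + ((\sum_i \sum_j X 0 j * Y 0 i * d j (d i a)) -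
       (\sum_i \sum_j Y 0 j * X 0 i * d j (d i a)))).
  rewrite [X in _ - X]exchange_big /= (_ : \sum_i \sum_j X 0 j * Y 0 i * d j (d i a)
      = \sum_j \sum_i Y 0 j * X 0 i * d i (d j a)).
    rewrite -sumrB big1 ?addr0// => i _; rewrite -sumrB big1// => j _.
    by rewrite dC; ring.
  by apply: eq_bigr => i _; apply: eq_bigr => j _; ring.
rewrite -sumrB /act -big_split; apply: eq_bigr => i _ /=.
rewrite mxE; set u := \sum_j X 0 j * Y 0 i * _; set v := \sum_j Y 0 j * X 0 i * _.
have -> : Y 0 i * act X (d i a) = u.
  by rewrite /u /act mulr_sumr; apply: eq_bigr => j _; ring.
have -> : X 0 i * act Y (d i a) = v.
  by rewrite /v /act mulr_sumr; apply: eq_bigr => j _; ring.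
by rewrite /act; ring.
Qed.

Lemma nabDl X Y Z : nab (X + Y) Z = nab X Z + nab Y Z.
Proof.
apply/rowP => k; rewrite !mxE actDl addrACA; congr (_ + _).
rewrite -big_split /=.
apply: eq_bigr => i _; rewrite -big_split; apply: eq_bigr => j _ /=.
by rewrite rvD; ring.
Qed.
Lemma nabZl a X Z : nab (a *: X) Z = a *: nab X Z.
Proof.
apply/rowP => k; rewrite !mxE actZl mulrDr; congr (_ + _).
rewrite mulr_sumr; apply: eq_bigr => i _; rewrite mulr_sumr; apply: eq_bigr => j _ /=.
by rewrite rvZ; ring.
Qed.
Lemma nabNl X Z : nab (- X) Z = - nab X Z.
Proof. by rewrite -scaleN1r nabZl scaleN1r. Qed.
Lemma nab0l Z : nab 0 Z = 0.
Proof. by rewrite -{1}(scale0r (0 : 'rV[A]_n)) nabZl scale0r. Qed.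
Lemma nabDr X Y Z : nab X (Y + Z) = nab X Y + nab X Z.
Proof.
apply/rowP => k; rewrite !mxE (derD (hact X)) addrACA; congr (_ + _).
rewrite -big_split /=.
apply: eq_bigr => i _; rewrite -big_split; apply: eq_bigr => j _ /=.
by rewrite rvD; ring.
Qed.
Lemma nabZr X a Y : nab X (a *: Y) = act X a *: Y + a *: nab X Y.
Proof.
apply/rowP => k; rewrite !mxE (derM (hact X)) -addrA mulrDr; congr (_ + (_ + _)).
rewrite mulr_sumr; apply: eq_bigr => i _; rewrite mulr_sumr; apply: eq_bigr => j _ /=.
by rewrite rvZ; ring.
Qed.
Lemma nabNr X Y : nab X (- Y) = - nab X Y.
Proof.
by rewrite -scaleN1r nabZr (derN (hact X)) (der1 (hact X)) oppr0 scale0r add0r scaleN1r.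
Qed.
Lemma lieC X Y : lie X Y = - lie Y X.
Proof. by apply/rowP => k; rewrite !mxE; ring. Qed.
Lemma lieDl X Y Z : lie (X + Y) Z = lie X Z + lie Y Z.
Proof. by apply/rowP => k; rewrite !mxE actDl (derD (hact Z)); ring. Qed.
Lemma lie0r X : lie X 0 = 0.
Proof. by apply/rowP => k; rewrite !mxE (der0 (hact X)) act0l subrr. Qed.
Lemma lieNl X Z : lie (- X) Z = - lie X Z.
Proof. by apply/rowP => k; rewrite !mxE actNl (derN (hact Z)); ring. Qed.
Lemma lieZl a X Z : lie (a *: X) Z = a *: lie X Z - act Z a *: X.
Proof. by apply/rowP => k; rewrite !mxE actZl (derM (hact Z)); ring. Qed.

Lemma curvC X Y Z : curv X Y Z = - curv Y X Z.
Proof.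
rewrite /curv (lieC X Y) nabNl; move: (nab _ _) (nab _ _) (nab _ _) => u v w.
by apply/rowP => k; rewrite !rvE; ring.
Qed.
Lemma curvDl X Y Z W : curv (X + Y) Z W = curv X Z W + curv Y Z W.
Proof.
rewrite /curv lieDl !nabDl !nabDr.
by apply/rowP => k; rewrite !rvE; ring.
Qed.
Lemma curvZl a X Y Z : curv (a *: X) Y Z = a *: curv X Y Z.
Proof.
rewrite /curv lieZl !nabDl nabNl !nabZl nabZr.
by apply/rowP => k; rewrite !rvE; ring.
Qed.
Lemma curvDm X Y Z W : curv X (Y + Z) W = curv X Y W + curv X Z W.
Proof. by rewrite curvC curvDl !(curvC _ X) opprD !opprK. Qed.
Lemma curvZm a X Y Z : curv X (a *: Y) Z = a *: curv X Y Z.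
Proof. by rewrite curvC curvZl (curvC _ X) scalerN opprK. Qed.
Lemma curvDr X Y Z W : curv X Y (Z + W) = curv X Y Z + curv X Y W.
Proof.
by rewrite /curv !nabDr; apply/rowP => k; rewrite !rvE; ring.
Qed.
Lemma curvZr a X Y Z : curv X Y (a *: Z) = a *: curv X Y Z.
Proof.
rewrite /curv !(nabZr, nabDr) act_lie.
by apply/rowP => k; rewrite !rvE; ring.
Qed.

(** Tensoriality in all three arguments. It links [curv], defined on fields, with [curvature_at],
    which extends vectors by constant fields. *)
Lemma curv_sum X Y Z : curv X Y Z = \sum_i \sum_j \sum_k
  (X 0 i * Y 0 j * Z 0 k) *: curv (delta_mx 0 i) (delta_mx 0 j) (delta_mx 0 k).
Proof.
have sl Y' Z' : curv X Y' Z' = \sum_i X 0 i *: curv (delta_mx 0 i) Y' Z'.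
  rewrite {1}(row_sum_delta X) (big_morph (fun U => curv U Y' Z') (id1 := 0) (op1 := +%R)).
  - by apply: eq_bigr => i _; rewrite curvZl.
  - by move=> ? ?; rewrite curvDl.
  - by rewrite -{1}(scale0r (0 : 'rV[A]_n)) curvZl scale0r.
have sm X' Z' : curv X' Y Z' = \sum_i Y 0 i *: curv X' (delta_mx 0 i) Z'.
  rewrite {1}(row_sum_delta Y) (big_morph (fun U => curv X' U Z') (id1 := 0) (op1 := +%R)).
  - by apply: eq_bigr => i _; rewrite curvZm.
  - by move=> ? ?; rewrite curvDm.
  - by rewrite -{1}(scale0r (0 : 'rV[A]_n)) curvZm scale0r.
have sr X' Y' : curv X' Y' Z = \sum_i Z 0 i *: curv X' Y' (delta_mx 0 i).
  rewrite {1}(row_sum_delta Z) (big_morph (fun U => curv X' Y' U) (id1 := 0) (op1 := +%R)).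
  - by apply: eq_bigr => i _; rewrite curvZr.
  - by move=> ? ?; rewrite curvDr.
  - by rewrite -{1}(scale0r (0 : 'rV[A]_n)) curvZr scale0r.
rewrite sl; apply: eq_bigr => i _; rewrite sm scaler_sumr; apply: eq_bigr => j _.
rewrite sr !scaler_sumr; apply: eq_bigr => k _.
by rewrite !scalerA.
Qed.
End Connection.

Section Jacobi.
Variables (A : comPzRingType) (n : nat) (d : 'I_n -> A -> A).
Hypothesis hd : forall i, derivation (d i).
Hypothesis dC : forall i j a, d i (d j a) = d j (d i a).
Lemma lie_jacobi (X Y Z : 'rV[A]_n) :
  lie d (lie d X Y) Z + lie d (lie d Y Z) X + lie d (lie d Z X) Y = 0.
Proof.
have hact := act_derivation hd.
have lieE (V W : 'rV[A]_n) k : lie d V W 0 k = act d V (W 0 k) - act d W (V 0 k).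
  by rewrite mxE.
apply/rowP => k; rewrite !rvE !lieE !(act_lie hd dC).
by rewrite !(derD (hact _), derN (hact _)); ring.
Qed.

Lemma lie_self (X : 'rV[A]_n) : lie d X X = 0.
Proof. by apply/rowP => k; rewrite !mxE subrr. Qed.

Lemma curv_self Ga (X Z : 'rV[A]_n) : curv d Ga X X Z = 0.
Proof. by rewrite /curv lie_self nab0l !subrr. Qed.
End Jacobi.

(** * Structure equations of orthonormal frames *)

Section OrthonormalFrame.
Variables (A : comPzRingType) (n : nat) (d : 'I_n -> A -> A).
Variable (Ga : 'I_n -> 'I_n -> 'I_n -> A).
Hypothesis hd : forall i, derivation (d i).
Hypothesis dC : forall i j a, d i (d j a) = d j (d i a).
Hypothesis torsion2 : forall a : A, 2 * a = 0 -> a = 0.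
Variable ip : 'rV[A]_n -> 'rV[A]_n -> A.
Hypothesis ip_sym : forall X Y, ip X Y = ip Y X.
Hypothesis ipDl : forall X Y Z, ip (X + Y) Z = ip X Z + ip Y Z.
Hypothesis ipZl : forall a X Z, ip (a *: X) Z = a * ip X Z.
Local Notation act := (act d).
Local Notation nab := (nab d Ga).
Local Notation lie := (lie d).
Local Notation curv := (curv d Ga).
Hypothesis nab_metric :
  forall X Y Z, act X (ip Y Z) = ip (nab X Y) Z + ip Y (nab X Z).
Hypothesis nab_torsion : forall X Y, nab X Y - nab Y X = lie X Y.
Let hact X := act_derivation hd X.

Lemma ipNl X Z : ip (- X) Z = - ip X Z.
Proof. by rewrite -scaleN1r ipZl mulN1r. Qed.
Lemma ip0l Z : ip 0 Z = 0.
Proof. by rewrite -(scale0r (0 : 'rV[A]_n)) ipZl mul0r. Qed.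

(** A product of frame vectors is 0 or 1; writing it as [k%:R] treats both cases, as derivations
    kill integers. *)
Lemma nab_skew X Y Z k : ip Y Z = k%:R -> ip (nab X Y) Z = - ip (nab X Z) Y.
Proof.
move=> h; apply/eqP; rewrite -addr_eq0 [ip (nab X Z) Y]ip_sym -nab_metric h.
by rewrite (dern (hact _)).
Qed.

Lemma nab_unit X Y k : ip Y Y = k%:R -> ip (nab X Y) Y = 0.
Proof.
move=> h; apply: torsion2.
by rewrite mulr_natl mulr2n {1}(nab_skew _ h) addNr.
Qed.

Lemma nab_swap X Y Z : ip (nab X Y) Z = ip (nab Y X) Z + ip (lie X Y) Z.
Proof. by rewrite -nab_torsion ipDl ipNl addrC subrK. Qed.

Section Surface.
Variables (e1 e2 : 'rV[A]_n).
Hypotheses (e11 : ip e1 e1 = 1) (e22 : ip e2 e2 = 1) (e12 : ip e1 e2 = 0).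
Hypothesis expand : forall V, V = ip V e1 *: e1 + ip V e2 *: e2.

(** [rot1] and [rot2] determine the connection of the surface, and they are also the components of
    the bracket of the frame. In this second role they are lifted to the total space. *)
Definition rot1 := ip (nab e1 e2) e1.
Definition rot2 := ip (nab e2 e2) e1.

Let nu1 X : ip (nab X e1) e1 = 0. Proof. exact: (nab_unit _ (k := 1)). Qed.
Let nu2 X : ip (nab X e2) e2 = 0. Proof. exact: (nab_unit _ (k := 1)). Qed.

Let surf11 : nab e1 e1 = - rot1 *: e2.
Proof.
by rewrite [LHS]expand nu1 (nab_skew _ (k := 0) e12) -/rot1 scale0r add0r.
Qed.
Let surf12 : nab e1 e2 = rot1 *: e1.
Proof. by rewrite [LHS]expand nu2 -/rot1 scale0r addr0. Qed.
Let surf21 : nab e2 e1 = - rot2 *: e2.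
Proof.
by rewrite [LHS]expand nu1 (nab_skew _ (k := 0) e12) -/rot2 scale0r add0r.
Qed.
Let surf22 : nab e2 e2 = rot2 *: e1.
Proof. by rewrite [LHS]expand nu2 -/rot2 scale0r addr0. Qed.

Let surf_lie : lie e1 e2 = rot1 *: e1 + rot2 *: e2.
Proof. by rewrite -nab_torsion surf12 surf21 scaleNr opprK. Qed.

(** This is <R(e1, e2) e2, e1> expanded in the connection coefficients; the sign is the one for
    which the unit sphere has curvature 1. *)
Definition gauss_curvature := act e1 rot2 - act e2 rot1 - rot1 * rot1 - rot2 * rot2.

Let surf_curv122 : curv e1 e2 e2 = gauss_curvature *: e1.
Proof.
rewrite /curv surf22 surf12 surf_lie nabDl // !nabZl !(nabZr _ hd).
rewrite surf11 surf21 surf12 surf22 /gauss_curvature; move: rot1 rot2 => a b.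
by apply/rowP => k; rewrite !rvE; ring.
Qed.
Let surf_curv121 : curv e1 e2 e1 = - gauss_curvature *: e2.
Proof.
rewrite /curv surf11 surf21 surf_lie nabDl // !nabZl !(nabZr _ hd).
rewrite surf11 surf21 surf12 surf22 /gauss_curvature !(derN (hact _)).
by move: rot1 rot2 => a b; apply/rowP => k; rewrite !rvE; ring.
Qed.
Lemma surface_equations :
  [/\ nab e1 e1 = - rot1 *: e2, nab e1 e2 = rot1 *: e1,
      nab e2 e1 = - rot2 *: e2, nab e2 e2 = rot2 *: e1
    & [/\ lie e1 e2 = rot1 *: e1 + rot2 *: e2,
          curv e1 e2 e2 = gauss_curvature *: e1
        & curv e1 e2 e1 = - gauss_curvature *: e2]].
Proof.
split; [exact: surf11|exact: surf12|exact: surf21|exact: surf22|split].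
- exact: surf_lie.
- exact: surf_curv122.
- exact: surf_curv121.
Qed.
End Surface.

(** * A three-dimensional frame adapted to a submersion onto a surface *)

Section Submersion.
Variables (e1 e2 e3 : 'rV[A]_n) (f1 f2 c : A).
Hypotheses (e11 : ip e1 e1 = 1) (e22 : ip e2 e2 = 1) (e33 : ip e3 e3 = 1).
Hypotheses (e12 : ip e1 e2 = 0) (e13 : ip e1 e3 = 0) (e23 : ip e2 e3 = 0).
Hypothesis expand :
  forall V, V = ip V e1 *: e1 + ip V e2 *: e2 + ip V e3 *: e3.
Hypotheses (l121 : ip (lie e1 e2) e1 = f1) (l122 : ip (lie e1 e2) e2 = f2).
Hypotheses (l131 : ip (lie e1 e3) e1 = 0) (l132 : ip (lie e1 e3) e2 = 0).
Hypotheses (l231 : ip (lie e2 e3) e1 = 0) (l232 : ip (lie e2 e3) e2 = 0).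

(* The fibres are the integral curves of [e3]; [mcurv1] and [mcurv2] are the
   components of their mean curvature and [twist] is the integrability tensor
   of the horizontal distribution. *)
Definition mcurv1 := ip (nab e3 e3) e1.
Definition mcurv2 := ip (nab e3 e3) e2.
Definition twist := ip (nab e1 e3) e2.

Let nu1 X : ip (nab X e1) e1 = 0. Proof. exact: (nab_unit _ (k := 1)). Qed.
Let nu2 X : ip (nab X e2) e2 = 0. Proof. exact: (nab_unit _ (k := 1)). Qed.
Let nu3 X : ip (nab X e3) e3 = 0. Proof. exact: (nab_unit _ (k := 1)). Qed.
Let sk12 X : ip (nab X e1) e2 = - ip (nab X e2) e1.
Proof. exact: (nab_skew _ (k := 0)). Qed.
Let sk13 X : ip (nab X e1) e3 = - ip (nab X e3) e1.
Proof. exact: (nab_skew _ (k := 0)). Qed.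
Let sk23 X : ip (nab X e2) e3 = - ip (nab X e3) e2.
Proof. exact: (nab_skew _ (k := 0)). Qed.

(** Metric compatibility and absence of torsion express the connection through the brackets, as in
    Koszul's formula; beyond [f1] and [f2] only the mean curvature and the twist remain. *)
Let w121 : ip (nab e1 e2) e1 = f1. Proof. by rewrite nab_swap l121 nu1 add0r. Qed.
Let w131 : ip (nab e1 e3) e1 = 0. Proof. by rewrite nab_swap l131 nu1 addr0. Qed.
Let w232 : ip (nab e2 e3) e2 = 0. Proof. by rewrite nab_swap l232 nu2 addr0. Qed.
Let w221 : ip (nab e2 e2) e1 = f2.
Proof.
have := nab_swap e1 e2 e2; rewrite nu2 l122 sk12 => /esym/eqP.
by rewrite addrC subr_eq0 => /eqP.
Qed.
Let w312 : ip (nab e3 e1) e2 = twist.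
Proof. by have := nab_swap e1 e3 e2; rewrite l132 addr0. Qed.
Let w321 : ip (nab e3 e2) e1 = - twist. Proof. by rewrite -w312 sk12 opprK. Qed.
Let w231 : ip (nab e2 e3) e1 = - twist. Proof. by rewrite nab_swap l231 addr0. Qed.

Let conn11 : nab e1 e1 = - f1 *: e2.
Proof.
by rewrite [LHS]expand nu1 sk12 sk13 w121 w131 oppr0 !scale0r add0r addr0.
Qed.
Let conn12 : nab e1 e2 = f1 *: e1 - twist *: e3.
Proof. by rewrite [LHS]expand nu2 sk23 w121 -/twist scale0r addr0 scaleNr. Qed.
Let conn13 : nab e1 e3 = twist *: e2.
Proof. by rewrite [LHS]expand nu3 w131 -/twist !scale0r add0r addr0. Qed.
Let conn21 : nab e2 e1 = - f2 *: e2 + twist *: e3.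
Proof.
by rewrite [LHS]expand nu1 sk12 sk13 w221 w231 opprK !scale0r add0r.
Qed.
Let conn22 : nab e2 e2 = f2 *: e1.
Proof. by rewrite [LHS]expand nu2 sk23 w221 w232 oppr0 !scale0r !addr0. Qed.
Let conn23 : nab e2 e3 = - twist *: e1.
Proof. by rewrite [LHS]expand nu3 w231 w232 !scale0r !addr0. Qed.
Let conn31 : nab e3 e1 = twist *: e2 - mcurv1 *: e3.
Proof. by rewrite [LHS]expand nu1 w312 sk13 -/mcurv1 !scale0r add0r scaleNr. Qed.
Let conn32 : nab e3 e2 = - twist *: e1 - mcurv2 *: e3.
Proof. by rewrite [LHS]expand nu2 w321 sk23 -/mcurv2 !scale0r addr0 !scaleNr. Qed.
Let conn33 : nab e3 e3 = mcurv1 *: e1 + mcurv2 *: e2.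
Proof. by rewrite [LHS]expand nu3 -/mcurv1 -/mcurv2 !scale0r addr0. Qed.
Let conn := (conn11, conn12, conn13, conn21, conn22, conn23, conn31, conn32,
  conn33).

Let lie12 : lie e1 e2 = f1 *: e1 + f2 *: e2 - (2 * twist) *: e3.
Proof.
rewrite -nab_torsion conn12 conn21.
by apply/rowP => k; rewrite !rvE; ring.
Qed.
Let lie13 : lie e1 e3 = mcurv1 *: e3.
Proof.
by rewrite -nab_torsion conn13 conn31; apply/rowP => k; rewrite !rvE; ring.
Qed.
Let lie23 : lie e2 e3 = mcurv2 *: e3.
Proof.
by rewrite -nab_torsion conn23 conn32; apply/rowP => k; rewrite !rvE; ring.
Qed.

Hypothesis basic1 : act e3 f1 = 0.
Hypothesis basic2 : act e3 f2 = 0.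

Let nabE := (fun X => nabDr Ga hd X, fun X => nabNr Ga hd X, fun X => nabZr Ga hd X,
  nabDl d Ga, nabNl d Ga, nabZl d Ga).
Let e21 : ip e2 e1 = 0. Proof. by rewrite ip_sym. Qed.
Let e31 : ip e3 e1 = 0. Proof. by rewrite ip_sym. Qed.
Let e32 : ip e3 e2 = 0. Proof. by rewrite ip_sym. Qed.
Let ipE := (ipDl, ipNl, ipZl, e11, e22, e33, e12, e13, e23, e21, e31, e32).
Let actE X := (dern (hact X), derN (hact X), derD (hact X), derM (hact X)).

Hypothesis s12 : ip (curv e1 e2 e2) e1 = c.
Hypothesis s13 : ip (curv e1 e3 e3) e1 = c.
Hypothesis s23 : ip (curv e2 e3 e3) e2 = c.
Hypothesis s123 : ip (curv (e1 + e2) e3 e3) (e1 + e2) = 2 * c.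
Hypothesis s213 : ip (curv e1 (e2 + e3) (e2 + e3)) e1 = 2 * c.
Hypothesis s132 : ip (curv e2 (e1 + e3) (e1 + e3)) e2 = 2 * c.

(** O'Neill's formula: the left side is the Gauss curvature of the base in terms of the lifted
    coefficients, and [c] is the curvature of the horizontal plane. *)
Let gauss_eq : act e1 f2 - act e2 f1 - f1 * f1 - f2 * f2 = c + 3 * twist * twist.
Proof.
by rewrite -s12 /curv lie12 !(conn, nabE) ?actE ?basic1 ?basic2 !ipE; ring.
Qed.

Let act1k1 : act e1 mcurv1 = mcurv1 * mcurv1 + c - twist * twist - f1 * mcurv2.
Proof. by rewrite -s13 /curv lie13 !(conn, nabE) !ipE; ring. Qed.
Let act2k2 : act e2 mcurv2 = mcurv2 * mcurv2 + c - twist * twist + f2 * mcurv1.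
Proof. by rewrite -s23 /curv lie23 !(conn, nabE) ?actE !ipE; ring. Qed.

Let ipDr X Y Z : ip X (Y + Z) = ip X Y + ip X Z.
Proof. by rewrite ip_sym ipDl !(ip_sym X). Qed.

Let ipD4 a b a' b' X : ip (a + b + (a' + b')) X =
  ip a X + ip b X + (ip a' X + ip b' X).
Proof. by rewrite !ipDl. Qed.

(** Polarising the sectional curvature over the planes spanned by [e3] and [e1], [e2], [e1 + e2]
    yields the sum of two mixed components, hence only this symmetric combination. The value [2 * c]
    in [s123] comes from the squared area 2. *)
Let sym12 : act e1 mcurv2 + act e2 mcurv1 = 2 * mcurv1 * mcurv2 + f1 * mcurv1 - f2 * mcurv2.
Proof.
have : ip (curv e1 e3 e3) e2 + ip (curv e2 e3 e3) e1 = 0.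
  apply: (addIr (2 * c)); rewrite add0r -[RHS]s123 (curvDl _ hd) ipDl !ipDr.
  by rewrite s13 s23; ring.
rewrite /curv lie13 lie23 !(conn, nabE) ?actE !ipE => h.
by apply/eqP; rewrite -subr_eq0 -[X in _ == X]h; apply/eqP; ring.
Qed.

(** The missing antisymmetric combination is the [e3] component of the Jacobi identity. *)
Let skew12 : act e1 mcurv2 - act e2 mcurv1 = f1 * mcurv1 + f2 * mcurv2 + 2 * act e3 twist.
Proof.
have := congr1 (fun V => ip V e3) (lie_jacobi hd dC e1 e2 e3).
rewrite lie12 lie23 (lieC d e3 e1) lie13 ip0l !(lieDl hd, lieNl hd, lieZl hd).
rewrite (lieC d e3 e2) (lieC d e3 e1) lie13 lie23 lie_self ?actE !ipE ip0l.
rewrite basic1 basic2 => h.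
by apply/eqP; rewrite eq_sym -subr_eq0 -[X in _ == X]h; apply/eqP; ring.
Qed.

Let act1k2 : act e1 mcurv2 = mcurv1 * mcurv2 + f1 * mcurv1 + act e3 twist.
Proof.
apply/eqP; rewrite -subr_eq0; apply/eqP/torsion2.
rewrite [LHS](_ : _ = (act e1 mcurv2 + act e2 mcurv1) + (act e1 mcurv2 - act e2 mcurv1)
  - 2 * (mcurv1 * mcurv2 + f1 * mcurv1 + act e3 twist)); last by ring.
by rewrite sym12 skew12; ring.
Qed.
Let act2k1 : act e2 mcurv1 = mcurv1 * mcurv2 - f2 * mcurv2 - act e3 twist.
Proof.
apply/eqP; rewrite -subr_eq0; apply/eqP/torsion2.
rewrite [LHS](_ : _ = (act e1 mcurv2 + act e2 mcurv1) - (act e1 mcurv2 - act e2 mcurv1)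
  - 2 * (mcurv1 * mcurv2 - f2 * mcurv2 - act e3 twist)); last by ring.
by rewrite sym12 skew12; ring.
Qed.

(** Polarisation over the planes spanned by [e1] and [e2], [e3], [e2 + e3]. Both mixed components
    contribute the same expression, hence the division by two. *)
Let act1sg : act e1 twist = 2 * mcurv1 * twist.
Proof.
have : ip (curv e1 e2 e3) e1 + ip (curv e1 e3 e2) e1 = 0.
  apply: (addIr (2 * c)).
  rewrite add0r -[RHS]s213 (curvDm _ hd) !(curvDr _ hd) ipD4.
  by rewrite s12 s13; ring.
rewrite /curv lie12 lie13 !(conn, nabE) ?actE !ipE ?basic1 => h.
apply/eqP; rewrite -subr_eq0; apply/eqP/torsion2.
by rewrite -[RHS]oppr0 -h; ring.
Qed.
Let act2sg : act e2 twist = 2 * mcurv2 * twist.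
Proof.
(* The symmetry of the sectional curvature under exchange of the two vectors, obtained by expanding
   both sides in the connection coefficients. *)
have s21 : ip (curv e2 e1 e1) e2 = c.
  rewrite -s12 (curvC _ _ e2) /curv lie12 !(conn, nabE) ?actE ?basic1 ?basic2.
  by rewrite !ipE; ring.
have : ip (curv e2 e1 e3) e2 + ip (curv e2 e3 e1) e2 = 0.
  apply: (addIr (2 * c)).
  rewrite add0r -[RHS]s132 (curvDm _ hd) !(curvDr _ hd) ipD4.
  by rewrite s21 s23; ring.
rewrite (curvC _ _ e2 e1) /curv lie12 lie23 !(conn, nabE) ?actE !ipE ?basic2 => h.
apply/eqP; rewrite -subr_eq0; apply/eqP/torsion2.
by rewrite -[RHS]h; ring.
Qed.

Let act13 a : act e1 (act e3 a) = act e3 (act e1 a) + mcurv1 * act e3 a.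
Proof. by rewrite -actZl -lie13 (act_lie hd dC) addrC subrK. Qed.
Let act23 a : act e2 (act e3 a) = act e3 (act e2 a) + mcurv2 * act e3 a.
Proof. by rewrite -actZl -lie23 (act_lie hd dC) addrC subrK. Qed.

Lemma structure_equations :
  [/\ [/\ nab e1 e1 = - f1 *: e2, nab e2 e2 = f2 *: e1
        & nab e3 e3 = mcurv1 *: e1 + mcurv2 *: e2],
      act e1 f2 - act e2 f1 - f1 * f1 - f2 * f2 = c + 3 * twist * twist,
      [/\ act e1 mcurv1 = mcurv1 * mcurv1 + c - twist * twist - f1 * mcurv2,
          act e1 mcurv2 = mcurv1 * mcurv2 + f1 * mcurv1 + act e3 twist,
          act e2 mcurv1 = mcurv1 * mcurv2 - f2 * mcurv2 - act e3 twist
        & act e2 mcurv2 = mcurv2 * mcurv2 + c - twist * twist + f2 * mcurv1],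
      act e1 twist = 2 * mcurv1 * twist /\ act e2 twist = 2 * mcurv2 * twist
    & forall a, act e1 (act e3 a) = act e3 (act e1 a) + mcurv1 * act e3 a /\
                act e2 (act e3 a) = act e3 (act e2 a) + mcurv2 * act e3 a].
Proof.
split; first by split; [exact: conn11|exact: conn22|exact: conn33].
- exact: gauss_eq.
- by split; [exact: act1k1|exact: act1k2|exact: act2k1|exact: act2k2].
- by split; [exact: act1sg|exact: act2sg].
- by move=> a; split; [exact: act13|exact: act23].
Qed.
End Submersion.
End OrthonormalFrame.

(** * From maps to rows of smooth functions *)

Section Evaluation.
Variables (R : realType) (n : nat) (U : openset R n).
Let oU := @oset_open R n U.
Local Notation pdU := (@pd R n U).

Lemma pd_derivation i : derivation (pdU i).
Proof. by split=> a b; [exact: pdD|exact: pdM]. Qed.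

Definition ev m x (v : 'rV[Cinf U]_m) : 'rV[R]_m := \row_j v 0 j x.

(* [rep V v]: on [U], the vector-valued function [V] is the row [v] of smooth
   functions. *)
Definition rep m (V : 'rV[R]_n -> 'rV[R]_m) (v : 'rV[Cinf U]_m) : Prop :=
  forall x, oset U x -> V x = ev x v.

Lemma evD m x (u v : 'rV[Cinf U]_m) : ev x (u + v) = ev x u + ev x v.
Proof. by apply/rowP => j; rewrite !mxE CinfDE. Qed.
Lemma evN m x (u : 'rV[Cinf U]_m) : ev x (- u) = - ev x u.
Proof. by apply/rowP => j; rewrite !mxE CinfNE. Qed.
Lemma evZ m x a (u : 'rV[Cinf U]_m) : ev x (a *: u) = a x *: ev x u.
Proof. by apply/rowP => j; rewrite !mxE CinfME. Qed.
Lemma ev0 m x : ev x (0 : 'rV[Cinf U]_m) = 0.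
Proof. by apply/rowP => j; rewrite !mxE Cinf0E. Qed.
Lemma ev_sum m x (I : Type) (r : seq I) (P : pred I) (F : I -> 'rV[Cinf U]_m) :
  ev x (\sum_(i <- r | P i) F i) = \sum_(i <- r | P i) ev x (F i).
Proof. exact: (big_morph (ev x) (@evD m x) (ev0 m x)). Qed.

Lemma rep_eq m (V : 'rV[R]_n -> 'rV[R]_m) u v : rep V u -> rep V v -> u = v.
Proof.
move=> Vu Vv; apply/rowP => j; apply: CinfP => x Ux.
by have /rowP/(_ j) := etrans (esym (Vu x Ux)) (Vv x Ux); rewrite !mxE.
Qed.
Lemma ev_inj m (u v : 'rV[Cinf U]_m) :
  (forall x, oset U x -> ev x u = ev x v) -> u = v.
Proof. by move=> uv; apply: (@rep_eq _ (fun x => ev x u)). Qed.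

Lemma rep_ev m (v : 'rV[Cinf U]_m) : rep (fun x => ev x v) v. Proof. by []. Qed.

Lemma repD m (V V' : 'rV[R]_n -> 'rV[R]_m) v v' : rep V v -> rep V' v' ->
  rep (fun x => V x + V' x) (v + v').
Proof. by move=> h h' x Ux; rewrite h// h'// evD. Qed.
Lemma repB m (V V' : 'rV[R]_n -> 'rV[R]_m) v v' : rep V v -> rep V' v' ->
  rep (fun x => V x - V' x) (v - v').
Proof. by move=> h h' x Ux; rewrite h// h'// evD evN. Qed.
Lemma rep_sum m k (V : 'I_k -> 'rV[R]_n -> 'rV[R]_m) v :
  (forall i, rep (V i) (v i)) -> rep (fun x => \sum_i V i x) (\sum_i v i).
Proof. by move=> h x Ux; rewrite ev_sum; apply: eq_bigr => i _; exact: h. Qed.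

Definition mk_vec m (V : 'rV[R]_n -> 'rV[R]_m) (sV : smooth_on U V) : 'rV[Cinf U]_m :=
  \row_j mk_Cinf ((smooth_on_rVP oU V).1 sV j).
Lemma mk_vec_rep m V sV : rep V (@mk_vec m V sV).
Proof. by move=> x Ux; apply/rowP => j; rewrite !mxE mk_CinfE. Qed.

Lemma rep_smooth m V (v : 'rV[Cinf U]_m) : rep V v -> smooth_on U V.
Proof.
move=> h; apply: (@smooth_on_eq _ _ _ _ oU (fun x => ev x v)).
  by move=> x Ux; rewrite h.
apply/smooth_on_rVP => // j.
by apply: (smooth_on_eq oU _ (Cinf_smooth (v 0 j))) => x _; rewrite mxE.
Qed.

(** The constant extension of a vector, as used by [curvature_at]. *)
Definition cvec m (u : 'rV[R]_m) : 'rV[Cinf U]_m := \row_j cCinf U (u 0 j).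
Lemma cvec_rep m (u : 'rV[R]_m) : rep (fun=> u) (cvec u).
Proof. by move=> x Ux; apply/rowP => j; rewrite !mxE cCinfE. Qed.

Lemma derive_partial (W : normedModType R) (f : 'rV[R]_n -> W) x u :
  differentiable f x -> 'D_u f x = \sum_i u 0 i *: partial i f x.
Proof.
move=> df; rewrite deriveE// {1}(row_sum_delta u) linear_sum.
by apply: eq_bigr => i _; rewrite linearZ -deriveE.
Qed.

Lemma act_derive (X : 'rV[Cinf U]_n) (f : Cinf U) x : oset U x ->
  act pdU X f x = 'D_(ev x X) f x.
Proof.
move=> Ux; rewrite derive_partial; last exact: Cinf_diff.
rewrite /act Cinf_sumE; apply: eq_bigr => i _.
by rewrite CinfME pdE// mxE.
Qed.

Lemma rep_derive m X (X' : 'rV[Cinf U]_n) V (v : 'rV[Cinf U]_m) : rep X X' -> rep V v ->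
  rep (fun x => 'D_(X x) V x) (\row_k act pdU X' (v 0 k)).
Proof.
move=> hX hV x Ux; apply/rowP => k.
rewrite derive_rV; last exact: smooth_on_diff (rep_smooth hV) Ux.
rewrite !mxE act_derive// -hX//; apply: near_eq_derive; apply: (near_open oU Ux) => y Uy.
by rewrite hV// mxE.
Qed.

Lemma rep_push m (f : 'rV[R]_n -> 'rV[R]_m) phi X X' : rep f phi -> rep X X' ->
  rep (push f X) (\row_k act pdU X' (phi 0 k)).
Proof. by move=> hf hX; exact: rep_derive. Qed.

Section Metric.
Variable G : 'rV[R]_n -> 'M[R]_n.
Hypothesis symG : forall x, oset U x -> (G x)^T = G x.
Hypothesis posG : forall x, oset U x -> forall u, u != 0 -> 0 < inner G x u u.
Hypothesis smoothG : forall i j, smooth_on U (entry G i j).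

Definition chr i j k : Cinf U :=
  mk_Cinf (smooth_on_christoffel oU posG smoothG i j k).
Definition gmat : 'M[Cinf U]_n := \matrix_(i, j) mk_Cinf (smoothG i j).
Definition ip (X Y : 'rV[Cinf U]_n) : Cinf U := (X *m gmat *m Y^T) 0 0.
Local Notation nabU := (nab pdU chr).
Local Notation LC := (levi_civita G).

Lemma ipE x X Y : oset U x -> ip X Y x = inner G x (ev x X) (ev x Y).
Proof.
move=> Ux; rewrite innerE /ip mxE Cinf_sumE; apply: eq_bigr => j _.
rewrite CinfME !mxE Cinf_sumE mulr_suml; apply: eq_bigr => i _.
by rewrite CinfME !mxE mk_CinfE.
Qed.

Lemma ip_sym X Y : ip X Y = ip Y X.
Proof. by apply: CinfP => x Ux; rewrite !ipE// (inner_sym symG). Qed.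
Lemma ipDl X Y Z : ip (X + Y) Z = ip X Z + ip Y Z.
Proof. by rewrite /ip !mulmxDl mxE. Qed.
Lemma ipZl a X Z : ip (a *: X) Z = a * ip X Z.
Proof. by rewrite /ip -!scalemxAl mxE. Qed.

Lemma rep_LC X X' Y Y' : rep X X' -> rep Y Y' ->
  rep (fun x => LC x (X x) (Y x))
      (\row_k \sum_i \sum_j X' 0 i * Y' 0 j * chr i j k).
Proof.
move=> hX hY x Ux; apply/rowP => k; rewrite !mxE Cinf_sumE; apply: eq_bigr => i _.
rewrite Cinf_sumE; apply: eq_bigr => j _.
by rewrite !CinfME hX// hY// mk_CinfE// !mxE.
Qed.

Lemma rep_nabla X X' Y Y' : rep X X' -> rep Y Y' -> rep (nabla LC X Y) (nabU X' Y').
Proof.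
move=> hX hY x Ux; have := repD (rep_derive hX hY) (rep_LC hX hY) Ux.
by rewrite /nabla => ->; congr (ev x _); apply/rowP => k; rewrite !mxE.
Qed.

Lemma rep_bracket X X' Y Y' : rep X X' -> rep Y Y' -> rep (bracket X Y) (lie pdU X' Y').
Proof.
move=> hX hY x Ux; have := repB (rep_derive hX hY) (rep_derive hY hX) Ux.
by rewrite /bracket => ->; congr (ev x _); apply/rowP => k; rewrite !mxE.
Qed.

Lemma rep_curvature X X' Y Y' Z Z' : rep X X' -> rep Y Y' -> rep Z Z' ->
  rep (curvature LC X Y Z) (curv pdU chr X' Y' Z').
Proof.
move=> hX hY hZ; apply: repB; first apply: repB.
- by apply: rep_nabla => //; exact: rep_nabla.
- by apply: rep_nabla => //; exact: rep_nabla.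
- by apply: rep_nabla => //; exact: rep_bracket.
Qed.

Lemma curvature_atE x (X Y Z : 'rV[Cinf U]_n) : oset U x ->
  curvature_at LC x (ev x X) (ev x Y) (ev x Z) = ev x (curv pdU chr X Y Z).
Proof.
move=> Ux; rewrite /curvature_at.
rewrite (rep_curvature (cvec_rep (ev x X)) (cvec_rep (ev x Y)) (cvec_rep (ev x Z)) Ux).
rewrite [in LHS](curv_sum _ pd_derivation (@pdC _ _ _)).
rewrite [in RHS](curv_sum _ pd_derivation (@pdC _ _ _)).
rewrite !ev_sum; apply: eq_bigr => i _; rewrite !ev_sum; apply: eq_bigr => j _.
rewrite !ev_sum; apply: eq_bigr => k _; rewrite !evZ; congr (_ *: _).
by rewrite !CinfME !mxE !cCinfE.
Qed.

Lemma nab_torsion_free X Y : nabU X Y - nabU Y X = lie pdU X Y.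
Proof.
apply: ev_inj => x Ux; rewrite evD evN.
rewrite -(rep_nabla (rep_ev X) (rep_ev Y) Ux) -(rep_nabla (rep_ev Y) (rep_ev X) Ux).
by rewrite (levi_civita_torsion_free oU symG)// (rep_bracket (rep_ev X) (rep_ev Y) Ux).
Qed.

Lemma nab_metric X Y Z : act pdU X (ip Y Z) = ip (nabU X Y) Z + ip Y (nabU X Z).
Proof.
apply: CinfP => x Ux; rewrite CinfDE act_derive// !ipE//.
rewrite -(rep_nabla (rep_ev X) (rep_ev Y) Ux) -(rep_nabla (rep_ev X) (rep_ev Z) Ux).
have dv (V : 'rV[Cinf U]_n) : derivable (fun y => ev y V) x (ev x X).
  exact: diff_derivable (smooth_on_diff (rep_smooth (rep_ev V)) Ux).
rewrite -(levi_civita_metric oU symG posG smoothG (X := fun y => ev y X) Ux (dv Y) (dv Z)).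
by apply: near_eq_derive; apply: (near_open oU Ux) => y Uy; rewrite ipE.
Qed.
End Metric.
End Evaluation.

(** * The pull-back bundle *)

Section Pullback.
Variables (R : realType) (m n : nat) (U : openset R m) (O : openset R n).
Let oU := @oset_open R m U.
Variable f : 'rV[R]_m -> 'rV[R]_n.
Hypotheses (sf : smooth_on U f) (fO : forall x, oset U x -> oset O (f x)).
Local Notation pdU := (@pd R m U).
Local Notation pdO := (@pd R n O).

Definition pull (b : Cinf O) : Cinf U :=
  mk_Cinf (smooth_on_comp oU sf fO (Cinf_smooth b)).
Definition pullv k (v : 'rV[Cinf O]_k) : 'rV[Cinf U]_k := \row_j pull (v 0 j).
Definition fcoord : 'rV[Cinf U]_n := mk_vec sf.

Lemma pullE b x : oset U x -> pull b x = b (f x).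
Proof. exact: on_domE. Qed.
Lemma pullD a b : pull (a + b) = pull a + pull b.
Proof. by apply: CinfP => x Ux; rewrite CinfDE !pullE// CinfDE. Qed.
Lemma pullM a b : pull (a * b) = pull a * pull b.
Proof. by apply: CinfP => x Ux; rewrite CinfME !pullE// CinfME. Qed.
Lemma pullN a : pull (- a) = - pull a.
Proof. by apply: CinfP => x Ux; rewrite CinfNE !pullE// CinfNE. Qed.
Lemma pull0 : pull 0 = 0.
Proof. by apply: CinfP => x Ux; rewrite pullE// !Cinf0E. Qed.
Lemma pull_sum (I : Type) (r : seq I) (P : pred I) (F : I -> Cinf O) :
  pull (\sum_(i <- r | P i) F i) = \sum_(i <- r | P i) pull (F i).
Proof. exact: (big_morph pull pullD pull0). Qed.

Lemma pullvD k (u v : 'rV[Cinf O]_k) : pullv (u + v) = pullv u + pullv v.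
Proof. by apply/rowP => j; rewrite !mxE pullD. Qed.
Lemma pullvN k (u : 'rV[Cinf O]_k) : pullv (- u) = - pullv u.
Proof. by apply/rowP => j; rewrite !mxE pullN. Qed.
Lemma pullvZ k a (u : 'rV[Cinf O]_k) : pullv (a *: u) = pull a *: pullv u.
Proof. by apply/rowP => j; rewrite !mxE pullM. Qed.

Lemma ev_pullv k (v : 'rV[Cinf O]_k) x : oset U x -> ev x (pullv v) = ev (f x) v.
Proof. by move=> Ux; apply/rowP => j; rewrite !mxE pullE. Qed.

Lemma act_pull X b :
  act pdU X (pull b) = \sum_j act pdU X (fcoord 0 j) * pull (pdO j b).
Proof.
have chain i : pdU i (pull b) = \sum_j pdU i (fcoord 0 j) * pull (pdO j b).
  apply: CinfP => x Ux; have Ofx := fO Ux.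
  rewrite (pdE i _ Ux) Cinf_sumE.
  rewrite (partial_eq_on oU (fun y Uy => pullE b Uy) i Ux).
  rewrite [LHS](derive_comp_sum _ (smooth_on_diff sf Ux) (Cinf_diff b Ofx)).
  apply: eq_bigr => j _; rewrite CinfME mulrC; congr (_ * _).
    rewrite (pdE _ _ Ux) mxE.
    by apply/esym; apply: (partial_eq_on oU _ i Ux) => y Uy; rewrite mk_CinfE.
  by rewrite (pullE _ Ux) (pdE _ _ Ofx).
rewrite /act; under eq_bigr do rewrite chain mulr_sumr.
rewrite exchange_big; apply: eq_bigr => j _; rewrite mulr_suml.
by apply: eq_bigr => i _; rewrite mulrA.
Qed.

Definition pushA X : 'rV[Cinf U]_n := \row_j act pdU X (fcoord 0 j).

(** The hypothesis says that [X] and [Y] are [f]-related. *)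
Lemma act_pull_push X Y b : pushA X = pullv Y -> act pdU X (pull b) = pull (act pdO Y b).
Proof.
move=> hX; rewrite act_pull [act pdO _ _]/act pull_sum; apply: eq_bigr => j _.
by have /rowP/(_ j) := hX; rewrite [pushA X 0 j]mxE [pullv Y 0 j]mxE pullM => ->.
Qed.

Section PullbackMetric.
Variable H : 'rV[R]_n -> 'M[R]_n.
Hypothesis symH : forall x, oset O x -> (H x)^T = H x.
Hypothesis posH : forall x, oset O x -> forall u, u != 0 -> 0 < inner H x u u.
Hypothesis smoothH : forall i j, smooth_on O (entry H i j).
Local Notation chrO := (chr posH smoothH).

(** Sections along [f] need not be pulled back from the target, so connection, curvature and metric
    are given here by pulled-back coefficients. On pulled-back sections [along_pull], [curvA_pull]
    and [ipA_pull] return the objects of the target. *)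
Definition alongA X (V : 'rV[Cinf U]_n) : 'rV[Cinf U]_n :=
  \row_k (act pdU X (V 0 k) +
    \sum_i \sum_j pushA X 0 i * V 0 j * pull (chrO i j k)).

Definition curvA (X Y Z : 'rV[Cinf U]_n) : 'rV[Cinf U]_n :=
  \sum_i \sum_j \sum_k (X 0 i * Y 0 j * Z 0 k) *:
     pullv (curv pdO chrO (delta_mx 0 i) (delta_mx 0 j) (delta_mx 0 k)).

Definition ipA (X Y : 'rV[Cinf U]_n) : Cinf U :=
  \sum_j \sum_i X 0 i * pull (gmat smoothH i j) * Y 0 j.

Lemma alongD X V W : alongA X (V + W) = alongA X V + alongA X W.
Proof.
apply/rowP => k; rewrite !mxE (derD (act_derivation (@pd_derivation _ _ _) X)).
rewrite addrACA; congr (_ + _).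
rewrite -big_split; apply: eq_bigr => i _; rewrite -big_split; apply: eq_bigr => j _ /=.
by rewrite rvD; ring.
Qed.
Lemma alongZ X a V : alongA X (a *: V) = act pdU X a *: V + a *: alongA X V.
Proof.
apply/rowP => k; rewrite !mxE (derM (act_derivation (@pd_derivation _ _ _) X)).
rewrite -addrA mulrDr; congr (_ + (_ + _)).
rewrite mulr_sumr; apply: eq_bigr => i _; rewrite mulr_sumr; apply: eq_bigr => j _ /=.
by rewrite rvZ; ring.
Qed.
Lemma pushD X Y : pushA (X + Y) = pushA X + pushA Y.
Proof. by apply/rowP => k; rewrite !mxE actDl. Qed.
Lemma pushZ a X : pushA (a *: X) = a *: pushA X.
Proof. by apply/rowP => k; rewrite !mxE actZl. Qed.
Lemma alongDl X Y V : alongA (X + Y) V = alongA X V + alongA Y V.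
Proof.
apply/rowP => k; rewrite !mxE actDl addrACA; congr (_ + _).
rewrite -big_split; apply: eq_bigr => i _; rewrite -big_split; apply: eq_bigr => j _ /=.
by rewrite !mxE actDl; ring.
Qed.
Lemma alongZl a X V : alongA (a *: X) V = a *: alongA X V.
Proof.
apply/rowP => k; rewrite !mxE actZl mulrDr; congr (_ + _).
rewrite mulr_sumr; apply: eq_bigr => i _; rewrite mulr_sumr; apply: eq_bigr => j _ /=.
by rewrite !mxE actZl; ring.
Qed.

Lemma along_pull X Y V : pushA X = pullv Y ->
  alongA X (pullv V) = pullv (nab pdO chrO Y V).
Proof.
move=> hX; apply/rowP => k; rewrite !mxE pullD (act_pull_push _ hX) hX; congr (_ + _).
rewrite pull_sum; apply: eq_bigr => i _ /=; rewrite pull_sum; apply: eq_bigr => j _.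
by rewrite !mxE !pullM.
Qed.

Lemma curvA_pull X Y Z :
  curvA (pullv X) (pullv Y) (pullv Z) = pullv (curv pdO chrO X Y Z).
Proof.
rewrite (curv_sum _ (@pd_derivation _ _ _) (@pdC _ _ _)).
rewrite /curvA (big_morph (@pullv n) (@pullvD n) (_ : pullv 0 = 0)); last first.
  by apply/rowP => j; rewrite !mxE pull0.
apply: eq_bigr => i _.
rewrite (big_morph (@pullv n) (@pullvD n) (_ : pullv 0 = 0)); last first.
  by apply/rowP => j; rewrite !mxE pull0.
apply: eq_bigr => j _.
rewrite (big_morph (@pullv n) (@pullvD n) (_ : pullv 0 = 0)); last first.
  by apply/rowP => j'; rewrite !mxE pull0.
by apply: eq_bigr => k _; rewrite pullvZ !pullM !mxE.
Qed.

Lemma ipA_pull X Y : ipA (pullv X) (pullv Y) = pull (ip smoothH X Y).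
Proof.
rewrite /ip mxE pull_sum; apply: eq_bigr => j _.
rewrite pullM [(_ *m _) 0 j]mxE pull_sum mulr_suml; apply: eq_bigr => i _.
by rewrite pullM !mxE.
Qed.

Lemma rep_f : rep f fcoord. Proof. exact: mk_vec_rep. Qed.

Lemma rep_pushA X X' : rep X X' -> rep (push f X) (pushA X').
Proof. by move=> hX; apply: rep_push => //; exact: rep_f. Qed.

Lemma rep_along X X' V V' : rep X X' -> rep V V' ->
  rep (nabla_along H f X V) (alongA X' V').
Proof.
move=> hX hV x Ux; have hP := rep_pushA hX Ux.
rewrite /nabla_along (rep_derive hX hV Ux) (hP) (hV _ Ux).
apply/rowP => k; rewrite !mxE CinfDE; congr (_ + _).
rewrite Cinf_sumE; apply: eq_bigr => i _; rewrite Cinf_sumE; apply: eq_bigr => j _.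
by rewrite !CinfME pullE// mk_CinfE ?mxE//; exact: fO.
Qed.

Lemma curvA_at x (X Y Z : 'rV[Cinf U]_n) : oset U x ->
  curvature_at (levi_civita H) (f x) (ev x X) (ev x Y) (ev x Z) = ev x (curvA X Y Z).
Proof.
move=> Ux; have Ofx := fO Ux.
have cE (V : 'rV[Cinf U]_n) : ev x V = ev (f x) (cvec O (ev x V)) by exact: cvec_rep.
rewrite (cE X) (cE Y) (cE Z) curvature_atE//.
rewrite (curv_sum _ (@pd_derivation _ _ _) (@pdC _ _ _)) /curvA.
rewrite !ev_sum; apply: eq_bigr => i _; rewrite !ev_sum; apply: eq_bigr => j _.
rewrite !ev_sum; apply: eq_bigr => k _; rewrite !evZ ev_pullv//; congr (_ *: _).
by rewrite !CinfME !mxE !cCinfE.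
Qed.

Variable G : 'rV[R]_m -> 'M[R]_m.
Hypothesis posG : forall x, oset U x -> forall u, u != 0 -> 0 < inner G x u u.
Hypothesis smoothG : forall i j, smooth_on U (entry G i j).
Local Notation nabU := (nab pdU (chr posG smoothG)).

Variables (e : 'I_m -> 'rV[R]_m -> 'rV[R]_m) (e' : 'I_m -> 'rV[Cinf U]_m).
Hypothesis he : forall i, rep (e i) (e' i).

Definition tensionA : 'rV[Cinf U]_n :=
  \sum_i (alongA (e' i) (pushA (e' i)) - pushA (nabU (e' i) (e' i))).

Definition laplacianA V : 'rV[Cinf U]_n :=
  \sum_i (alongA (e' i) (alongA (e' i) V) - alongA (nabU (e' i) (e' i)) V).

Definition tritensionA : 'rV[Cinf U]_n :=
  laplacianA (laplacianA tensionA)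
  - \sum_i curvA (laplacianA tensionA) (pushA (e' i)) (pushA (e' i))
  - \sum_i curvA (alongA (e' i) tensionA) tensionA (pushA (e' i)).

Lemma rep_tension : rep (tension G H f e) tensionA.
Proof.
apply: rep_sum => i; apply: repB.
  by apply: rep_along => //; exact: rep_pushA.
by apply: rep_pushA; exact: rep_nabla.
Qed.

Lemma rep_laplacian V V' : rep V V' -> rep (rough_laplacian G H f e V) (laplacianA V').
Proof.
move=> hV; apply: rep_sum => i; apply: repB.
  by apply: rep_along => //; exact: rep_along.
by apply: rep_along => //; exact: rep_nabla.
Qed.

Lemma rep_curvA X X' Y Y' Z Z' : rep X X' -> rep Y Y' -> rep Z Z' ->
  rep (fun x => curvature_at (levi_civita H) (f x) (X x) (Y x) (Z x)) (curvA X' Y' Z').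
Proof. by move=> hX hY hZ x Ux; rewrite (hX _ Ux) (hY _ Ux) (hZ _ Ux) curvA_at. Qed.

Lemma rep_tritension : rep (tritension G H f e) tritensionA.
Proof.
have hL := rep_laplacian rep_tension.
apply: repB; first apply: repB; first exact: rep_laplacian.
  by apply: rep_sum => i; apply: rep_curvA => //; exact: rep_pushA.
apply: rep_sum => i; apply: rep_curvA; [|exact: rep_tension|exact: rep_pushA].
by apply: rep_along => //; exact: rep_tension.
Qed.

End PullbackMetric.
End Pullback.

(** * Nowhere vanishing tension is impossible *)

(** Orthonormality says E g E^T = 1 for the matrix E of the frame; for square matrices the factors
    may be rotated, which gives the inverse of [g] as E^T E. *)
Lemma frame_matrix (A : comPzRingType) n (g : 'M[A]_n) (e : 'I_n -> 'rV[A]_n) :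
  (forall i j, (e i *m g *m (e j)^T) 0 0 = (i == j)%:R) ->
  g *m (\matrix_i e i)^T *m (\matrix_i e i) = 1%:M.
Proof.
move=> on; apply: mulmx1C; apply/matrixP => i j; rewrite mulmxA !mxE -on !mxE.
apply: eq_bigr => k _; rewrite !mxE; congr (_ * _).
by apply: eq_bigr => l _; rewrite !mxE.
Qed.

Lemma frame_expand (A : comPzRingType) n (g : 'M[A]_n) (e : 'I_n -> 'rV[A]_n) :
  (forall i j, (e i *m g *m (e j)^T) 0 0 = (i == j)%:R) ->
  forall V, V = \sum_i (V *m g *m (e i)^T) 0 0 *: e i.
Proof.
move=> /frame_matrix on V; rewrite -[LHS]mulmx1 -on !mulmxA mulmx_sum_row.
apply: eq_bigr => i _; rewrite rowK; congr (_ *: _); rewrite !mxE.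
by apply: eq_bigr => j _; rewrite !mxE.
Qed.

Section CinfProperties.
Variables (R : realType) (n : nat) (U : openset R n).

Lemma Cinf_reduced (a : Cinf U) : a * a = 0 -> a = 0.
Proof.
move=> h; apply: CinfP => x Ux; have := congr1 (fun b : Cinf U => b x) h.
by rewrite CinfME Cinf0E => /eqP; rewrite mulf_eq0 orbb => /eqP.
Qed.

Lemma Cinf_torsion_free k (a : Cinf U) : (0 < k)%N -> k%:R * a = 0 -> a = 0.
Proof.
move=> k0 h; apply: CinfP => x Ux; have := congr1 (fun b : Cinf U => b x) h.
rewrite CinfME Cinf0E Cinf_natE// => /eqP; rewrite mulf_eq0 pnatr_eq0.
by rewrite eqn0Ngt k0 => /eqP.
Qed.
End CinfProperties.

Section Gram.
Variables (R : realType) (n : nat) (G : 'rV[R]_n -> 'M[R]_n) (x : 'rV[R]_n).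
Lemma innerDl u v w : inner G x (u + v) w = inner G x u w + inner G x v w.
Proof. by rewrite /inner !mulmxDl mxE. Qed.
Lemma innerZl a u w : inner G x (a *: u) w = a * inner G x u w.
Proof. by rewrite /inner -!scalemxAl mxE. Qed.
Lemma inner0l w : inner G x 0 w = 0.
Proof. by rewrite /inner !mul0mx mxE. Qed.

(** Constancy of curvature is stated for linearly independent vectors, whereas frames provide a
    nonzero Gram determinant. *)
Lemma gram_row_free u v :
  inner G x u u * inner G x v v - inner G x u v * inner G x v u != 0 ->
  row_free (col_mx u v).
Proof.
move=> g0; rewrite -kermx_eq0; apply/negPn/negP => /rowV0Pn[z] /sub_kermxP.
rewrite -{1}(hsubmxK z) mul_row_col.
rewrite [lsubmx z]mx11_scalar [rsubmx z]mx11_scalar !mul_scalar_mx.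
set a := _ 0 0; set b := _ 0 0 => h z0.
have hu : a * inner G x u u + b * inner G x v u = 0.
  by rewrite -!innerZl -innerDl h inner0l.
have hv : a * inner G x u v + b * inner G x v v = 0.
  by rewrite -!innerZl -innerDl h inner0l.
have ha : a = 0.
  apply: (mulIf g0); rewrite mul0r.
  rewrite [LHS](_ : _ = (a * inner G x u u + b * inner G x v u) * inner G x v v
    - (a * inner G x u v + b * inner G x v v) * inner G x v u); last by ring.
  by rewrite hu hv; ring.
have hb : b = 0.
  apply: (mulIf g0); rewrite mul0r.
  rewrite [LHS](_ : _ = (a * inner G x u v + b * inner G x v v) * inner G x u u
    - (a * inner G x u u + b * inner G x v u) * inner G x u v); last by ring.
  by rewrite hu hv; ring.
move/eqP: z0; apply; rewrite -(hsubmxK z) [lsubmx z]mx11_scalar [rsubmx z]mx11_scalar.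
by rewrite -/a -/b ha hb !raddf0 row_mx0.
Qed.
End Gram.

Section Combinations.
Variables (A : comPzRingType) (n : nat) (E1 E2 : 'rV[A]_n).

(** Here and below, the bookkeeping of components is done for arbitrary rows [E1], [E2] and scalars,
    so that [ring] does not meet the geometric expressions. *)
Lemma comb_along a b u v g :
  a *: E1 + u *: (- g *: E2) + (b *: E2 + v *: (g *: E1)) =
  (a + g * v) *: E1 + (b - g * u) *: E2.
Proof. by apply/rowP => k; rewrite !rvE; ring. Qed.

Lemma comb_laplacian x1 x2 y1 y2 z1 z2 u1 u2 v1 v2 f1 f2 k1 k2 :
  x1 *: E1 + x2 *: E2 - - f1 *: (v1 *: E1 + v2 *: E2)
  + (y1 *: E1 + y2 *: E2 - f2 *: (u1 *: E1 + u2 *: E2)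
  + (z1 *: E1 + z2 *: E2
     - (k1 *: (u1 *: E1 + u2 *: E2) + k2 *: (v1 *: E1 + v2 *: E2)))) =
  (x1 + y1 + z1 - (f2 + k1) * u1 - (k2 - f1) * v1) *: E1
  + (x2 + y2 + z2 - (f2 + k1) * u2 - (k2 - f1) * v2) *: E2.
Proof. by apply/rowP => k; rewrite !rvE; ring. Qed.

Lemma comb_tritension L1 L2 l1 l2 a b c d u v K :
  L1 *: E1 + L2 *: E2 - (l2 *: (K *: E2) + l1 *: (K *: E1))
  - ((a * v - b * u) *: (- K *: E2) + (c * v - d * u) *: (K *: E1)) =
  (L1 - K * l1 - K * (u * a + v * c - (a + d) * u)) *: E1
  + (L2 - K * l2 - K * (u * b + v * d - (a + d) * v)) *: E2.
Proof. by apply/rowP => k; rewrite !rvE; ring. Qed.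

Lemma comb_curv a b u v (Z : 'rV[A]_n) :
  a *: (u *: 0 + v *: Z) + b *: (u *: (- Z) + v *: 0) = (a * v - b * u) *: Z.
Proof. by apply/rowP => k; rewrite !rvE; ring. Qed.
End Combinations.

Lemma big_ord3 (V : nmodType) (F : 'I_3 -> V) :
  \sum_i F i = F ord0 + (F (lift ord0 ord0) + F (lift ord0 (lift ord0 ord0))).
Proof. by rewrite !big_ord_recl big_ord0 addr0. Qed.

(** * The contradiction on an open set where the tension field has no zero *)

Section Core.
Variables (R : realType) (c : R) (U : openset R 3) (O : openset R 2).
Variable f : 'rV[R]_3 -> 'rV[R]_2.
Hypotheses (sf : smooth_on U f) (fO : forall x, oset U x -> oset O (f x)).
Variables (G : 'rV[R]_3 -> 'M[R]_3) (H : 'rV[R]_2 -> 'M[R]_2).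
Hypothesis symG : forall x, oset U x -> (G x)^T = G x.
Hypothesis posG : forall x, oset U x -> forall u, u != 0 -> 0 < inner G x u u.
Hypothesis smoothG : forall i j, smooth_on U (entry G i j).
Hypothesis symH : forall x, oset O x -> (H x)^T = H x.
Hypothesis posH : forall x, oset O x -> forall u, u != 0 -> 0 < inner H x u u.
Hypothesis smoothH : forall i j, smooth_on O (entry H i j).
Variables (e : 'I_3 -> 'rV[R]_3 -> 'rV[R]_3) (eps : 'I_2 -> 'rV[R]_2 -> 'rV[R]_2).
Hypotheses (one : orthonormal_frame G U e) (oneps : orthonormal_frame H O eps).
Let i0 : 'I_3 := ord0.
Let i1 : 'I_3 := lift ord0 ord0.
Let i2 : 'I_3 := lift ord0 (lift ord0 ord0).
Let j0 : 'I_2 := ord0.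
Let j1 : 'I_2 := lift ord0 ord0.
Hypothesis de0 : forall x, oset U x -> 'D_(e i0 x) f x = eps j0 (f x).
Hypothesis de1 : forall x, oset U x -> 'D_(e i1 x) f x = eps j1 (f x).
Hypothesis de2 : forall x, oset U x -> 'D_(e i2 x) f x = 0.
Hypothesis hc : forall x, oset U x -> forall u v : 'rV[R]_3,
  row_free (col_mx u v) -> sectional_curvature G x u v = c.

Local Notation A := (Cinf U).
Local Notation B := (Cinf O).
Local Notation pdU := (@pd R 3 U).
Local Notation pdO := (@pd R 2 O).
Local Notation chrU := (chr posG smoothG).
Local Notation chrO := (chr posH smoothH).
Local Notation ipU := (ip smoothG).
Local Notation ipO := (ip smoothH).
Local Notation nabU := (nab pdU chrU).
Local Notation nabO := (nab pdO chrO).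
Local Notation pull := (pull sf fO).
Local Notation pullv := (@pullv _ _ _ _ _ _ sf fO 2).
Local Notation push := (pushA sf).
Local Notation along := (alongA sf fO posH smoothH).
Local Notation ipf := (ipA sf fO smoothH).
Local Notation curvf := (curvA sf fO posH smoothH).

Let e' i : 'rV[A]_3 := mk_vec (one.1 i).
Let eps' i : 'rV[B]_2 := mk_vec (oneps.1 i).
Let re i : rep (e i) (e' i) := mk_vec_rep (one.1 i).
Let reps i : rep (eps i) (eps' i) := mk_vec_rep (oneps.1 i).

Lemma ip_e i j : ipU (e' i) (e' j) = (i == j)%:R.
Proof. by apply: CinfP => x Ux; rewrite ipE// -!re// one.2// Cinf_natE. Qed.
Lemma ip_eps i j : ipO (eps' i) (eps' j) = (i == j)%:R.
Proof. by apply: CinfP => x Ux; rewrite ipE// -!reps// oneps.2// Cinf_natE. Qed.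

Let e1 := e' i0. Let e2 := e' i1. Let e3 := e' i2.
Let E1 := pullv (eps' j0). Let E2 := pullv (eps' j1).

Lemma expandU V : V = ipU V e1 *: e1 + ipU V e2 *: e2 + ipU V e3 *: e3.
Proof.
by rewrite [LHS](frame_expand ip_e) !big_ord_recl big_ord0 addr0 addrA.
Qed.
Lemma expandO V : V = ipO V (eps' j0) *: eps' j0 + ipO V (eps' j1) *: eps' j1.
Proof. by rewrite [LHS](frame_expand ip_eps) !big_ord_recl big_ord0 addr0. Qed.

Lemma push_eps i j : (forall x, oset U x -> 'D_(e i x) f x = eps j (f x)) ->
  push (e' i) = pullv (eps' j).
Proof.
move=> h; apply: (rep_eq (rep_pushA sf (re i))) => x Ux.
rewrite /Defs.push h// ev_pullv// -reps//; exact: fO.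
Qed.
Lemma push1 : push e1 = E1. Proof. exact: push_eps. Qed.
Lemma push2 : push e2 = E2. Proof. exact: push_eps. Qed.
Lemma push3 : push e3 = 0.
Proof.
by apply: (rep_eq (rep_pushA sf (re i2))) => x Ux; rewrite /Defs.push de2// ev0.
Qed.
(** The vertical field is [f]-related to the zero field; in this form the lemmas on [f]-related
    fields cover [e3] too. *)
Lemma push3' : push e3 = pullv 0.
Proof. by rewrite push3; apply/rowP => j; rewrite !mxE pull0. Qed.

Lemma ipfDl X Y Z : ipf (X + Y) Z = ipf X Z + ipf Y Z.
Proof.
rewrite -big_split; apply: eq_bigr => j _; rewrite -big_split; apply: eq_bigr => i _ /=.
by rewrite rvD; ring.
Qed.
Lemma ipfZl a X Z : ipf (a *: X) Z = a * ipf X Z.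
Proof.
rewrite mulr_sumr; apply: eq_bigr => j _; rewrite mulr_sumr; apply: eq_bigr => i _ /=.
by rewrite rvZ; ring.
Qed.
Lemma pull_nat k : pull k%:R = k%:R.
Proof. by apply: CinfP => x Ux; rewrite pullE// !Cinf_natE//; exact: fO. Qed.
Lemma ipf11 : ipf E1 E1 = 1. Proof. by rewrite ipA_pull ip_eps pull_nat. Qed.
Lemma ipf22 : ipf E2 E2 = 1. Proof. by rewrite ipA_pull ip_eps pull_nat. Qed.
Lemma ipf12 : ipf E1 E2 = 0. Proof. by rewrite ipA_pull ip_eps pull_nat. Qed.
Lemma ipf21 : ipf E2 E1 = 0. Proof. by rewrite ipA_pull ip_eps pull_nat. Qed.
Let ipfE := (ipfDl, ipfZl, ipf11, ipf22, ipf12, ipf21).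

Lemma pushE V : push V = ipU V e1 *: E1 + ipU V e2 *: E2.
Proof.
by rewrite {1}(expandU V) !pushD !pushZ push1 push2 push3 scaler0 addr0.
Qed.
(** Horizontal components can be read off after pushing forward, since [e1] and [e2] lift an
    orthonormal frame. Brackets on the total space are thereby computed on the base. *)
Lemma ip1E V : ipU V e1 = ipf (push V) E1.
Proof. by rewrite pushE !ipfE; ring. Qed.
Lemma ip2E V : ipU V e2 = ipf (push V) E2.
Proof. by rewrite pushE !ipfE; ring. Qed.

Lemma push_lie X Y X' Y' : push X = pullv X' -> push Y = pullv Y' ->
  push (lie pdU X Y) = pullv (lie pdO X' Y').
Proof.
move=> hX hY; apply/rowP => k.
have hE V : act pdU V (fcoord sf 0 k) = push V 0 k by rewrite [RHS]mxE.
rewrite [LHS]mxE (act_lie (@pd_derivation _ _ _) (@pdC _ _ _)) !hE hX hY.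
rewrite [RHS]mxE [lie _ _ _ _ _]mxE pullD pullN.
rewrite -(act_pull_push _ hX) -(act_pull_push _ hY).
by rewrite [pullv X' 0 k]mxE [pullv Y' 0 k]mxE.
Qed.

Let hdU := @pd_derivation R 3 U.
Let hdO := @pd_derivation R 2 O.
Let dCU := @pdC R 3 U.
Let tor2U (a : A) : 2 * a = 0 -> a = 0. Proof. exact: Cinf_torsion_free. Qed.
Let tor2O (a : B) : 2 * a = 0 -> a = 0. Proof. exact: Cinf_torsion_free. Qed.
Let symipU := ip_sym symG smoothG.
Let symipO := ip_sym symH smoothH.
Let DlU := ipDl smoothG.
Let ZlU := ipZl smoothG.
Let metU := nab_metric symG posG smoothG.
Let metO := nab_metric symH posH smoothH.
Let torU := nab_torsion_free symG posG smoothG.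
Let torO := nab_torsion_free symH posH smoothH.
Let o00 : ipO (eps' j0) (eps' j0) = 1 := ip_eps j0 j0.
Let o11 : ipO (eps' j1) (eps' j1) = 1 := ip_eps j1 j1.
Let o01 : ipO (eps' j0) (eps' j1) = 0 := ip_eps j0 j1.

Let F1 := rot1 pdO chrO ipO (eps' j0) (eps' j1).
Let F2 := rot2 pdO chrO ipO (eps' j0) (eps' j1).
Let K0 := gauss_curvature pdO chrO ipO (eps' j0) (eps' j1).

Let strO := surface_equations hdO tor2O symipO metO torO
  o00 o11 o01 expandO.

Let g1 := pull F1.
Let g2 := pull F2.
Let cA : A := cCinf U c.

Lemma push_lie12 : push (lie pdU e1 e2) = g1 *: E1 + g2 *: E2.
Proof.
have [_ _ _ _ [lieO _ _]] := strO.
by rewrite (push_lie push1 push2) lieO pullvD !pullvZ.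
Qed.
Lemma push_lie_vertical X Y : push X = pullv Y -> push (lie pdU X e3) = 0.
Proof.
move=> hX; rewrite (push_lie hX push3') (lie0r hdO).
by rewrite -push3' push3.
Qed.

(** Clearing the Gram determinant turns the quotient defining the sectional curvature into an
    identity in the ring. *)
Lemma sect_eq (X Y : 'rV[A]_3) :
  (forall x, oset U x -> (ipU X X * ipU Y Y - ipU X Y * ipU X Y) x != 0) ->
  ipU (curv pdU chrU X Y Y) X = cA * (ipU X X * ipU Y Y - ipU X Y * ipU X Y).
Proof.
move=> h; apply: CinfP => x Ux; have := h x Ux.
rewrite CinfME cCinfE// !(CinfDE, CinfNE, CinfME) !ipE// => g0.
have rf : row_free (col_mx (ev x X) (ev x Y)).
  apply: (gram_row_free (G := G) (x := x)).
  by rewrite [inner G x (ev x Y) (ev x X)](inner_sym symG).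
have := hc Ux rf; rewrite /sectional_curvature curvature_atE// => <-.
by rewrite expr2 divfK.
Qed.

Let k1A := mcurv1 pdU chrU ipU e1 e3.
Let k2A := mcurv2 pdU chrU ipU e2 e3.
Let twA := twist pdU chrU ipU e1 e2 e3.

Let u11 : ipU e1 e1 = 1 := ip_e i0 i0.
Let u22 : ipU e2 e2 = 1 := ip_e i1 i1.
Let u33 : ipU e3 e3 = 1 := ip_e i2 i2.
Let u12 : ipU e1 e2 = 0 := ip_e i0 i1.
Let u13 : ipU e1 e3 = 0 := ip_e i0 i2.
Let u23 : ipU e2 e3 = 0 := ip_e i1 i2.
Let u21 : ipU e2 e1 = 0 := ip_e i1 i0.
Let u31 : ipU e3 e1 = 0 := ip_e i2 i0.
Let u32 : ipU e3 e2 = 0 := ip_e i2 i1.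
Let l121 : ipU (lie pdU e1 e2) e1 = g1.
Proof. by rewrite ip1E push_lie12 !ipfE; ring. Qed.
Let l122 : ipU (lie pdU e1 e2) e2 = g2.
Proof. by rewrite ip2E push_lie12 !ipfE; ring. Qed.
Let ipf0 X : ipf 0 X = 0.
Proof. by rewrite -(scale0r (0 : 'rV[A]_2)) ipfZl mul0r. Qed.
Let l131 : ipU (lie pdU e1 e3) e1 = 0.
Proof. by rewrite ip1E (push_lie_vertical push1) ipf0. Qed.
Let l132 : ipU (lie pdU e1 e3) e2 = 0.
Proof. by rewrite ip2E (push_lie_vertical push1) ipf0. Qed.
Let l231 : ipU (lie pdU e2 e3) e1 = 0.
Proof. by rewrite ip1E (push_lie_vertical push2) ipf0. Qed.
Let l232 : ipU (lie pdU e2 e3) e2 = 0.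
Proof. by rewrite ip2E (push_lie_vertical push2) ipf0. Qed.
Let expU := expandU.

Let basic F : act pdU e3 (pull F) = 0.
Proof. by rewrite (act_pull_push _ push3') act0l pull0. Qed.
Let basic1 : act pdU e3 g1 = 0 := basic F1.
Let basic2 : act pdU e3 g2 = 0 := basic F2.

Let ipUDr X Y Z : ipU X (Y + Z) = ipU X Y + ipU X Z.
Proof. by rewrite symipU DlU !(symipU _ X). Qed.
Let ipE := (DlU, ipUDr, u11, u22, u33, u12, u13, u23, u21, u31, u32).

Let sectN X Y k : ipU X X * ipU Y Y - ipU X Y * ipU X Y = k.+1%:R ->
  ipU (curv pdU chrU X Y Y) X = k.+1%:R * cA.
Proof.
move=> h; rewrite sect_eq h; first exact: mulrC.
by move=> x Ux; rewrite Cinf_natE// pnatr_eq0.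
Qed.
Let s12 : ipU (curv pdU chrU e1 e2 e2) e1 = cA.
Proof. by rewrite (@sectN _ _ 0%N) ?mul1r// !ipE; ring. Qed.
Let s13 : ipU (curv pdU chrU e1 e3 e3) e1 = cA.
Proof. by rewrite (@sectN _ _ 0%N) ?mul1r// !ipE; ring. Qed.
Let s23 : ipU (curv pdU chrU e2 e3 e3) e2 = cA.
Proof. by rewrite (@sectN _ _ 0%N) ?mul1r// !ipE; ring. Qed.
Let s123 : ipU (curv pdU chrU (e1 + e2) e3 e3) (e1 + e2) = 2 * cA.
Proof. by apply: (@sectN _ _ 1%N); rewrite !ipE; ring. Qed.
Let s213 : ipU (curv pdU chrU e1 (e2 + e3) (e2 + e3)) e1 = 2 * cA.
Proof. by apply: (@sectN _ _ 1%N); rewrite !ipE; ring. Qed.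
Let s132 : ipU (curv pdU chrU e2 (e1 + e3) (e1 + e3)) e2 = 2 * cA.
Proof. by apply: (@sectN _ _ 1%N); rewrite !ipE; ring. Qed.


Let str := structure_equations hdU dCU tor2U symipU DlU ZlU metU torU
  u11 u22 u33 u12 u13 u23 expU l121 l122 l131 l132 l231 l232 basic1 basic2
  s12 s13 s23 s123 s213 s132.

Let D1 := act pdU e1. Let D2 := act pdU e2. Let D3 := act pdU e3.
Let S u v : 'rV[A]_2 := u *: E1 + v *: E2.

Let pullv0 : pullv 0 = 0.
Proof. by apply/rowP => j; rewrite !mxE pull0. Qed.
Lemma along11 : along e1 E1 = - g1 *: E2.
Proof.
have [h _ _ _ _] := strO.
by rewrite (along_pull _ _ _ push1) h pullvZ pullN.
Qed.
Lemma along12 : along e1 E2 = g1 *: E1.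
Proof.
have [_ h _ _ _] := strO.
by rewrite (along_pull _ _ _ push1) h pullvZ.
Qed.
Lemma along21 : along e2 E1 = - g2 *: E2.
Proof.
have [_ _ h _ _] := strO.
by rewrite (along_pull _ _ _ push2) h pullvZ pullN.
Qed.
Lemma along22 : along e2 E2 = g2 *: E1.
Proof.
have [_ _ _ h _] := strO.
by rewrite (along_pull _ _ _ push2) h pullvZ.
Qed.
Lemma along3 V : along e3 (pullv V) = 0.
Proof. by rewrite (along_pull _ _ _ push3') nab0l pullv0. Qed.

Lemma alongS1 u v : along e1 (S u v) = S (n11 D1 g1 u v) (n12 D1 g1 u v).
Proof. by rewrite /S alongD !alongZ along11 along12; exact: comb_along. Qed.
Lemma alongS2 u v : along e2 (S u v) = S (n21 D2 g2 u v) (n22 D2 g2 u v).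
Proof. by rewrite /S alongD !alongZ along21 along22; exact: comb_along. Qed.
Lemma alongS3 u v : along e3 (S u v) = S (D3 u) (D3 v).
Proof. by rewrite /S alongD !alongZ !along3 !scaler0 !addr0. Qed.

Local Notation tension' := (tensionA sf fO posH smoothH posG smoothG e').
Local Notation lap := (laplacianA sf fO posH smoothH posG smoothG e').

(** For the two horizontal fields, the connection of the base and the pushed connection of the total
    space cancel; only the mean curvature of the fibres survives, with a minus sign. *)
Lemma tensionS : tension' = S (- k1A) (- k2A).
Proof.
have [[c11 c22 c33] _ _ _ _] := str.
transitivity (along e1 (push e1) - push (nabU e1 e1)
  + (along e2 (push e2) - push (nabU e2 e2)
  + (along e3 (push e3) - push (nabU e3 e3)))); first exact: big_ord3.
rewrite push1 push2 push3 c11 c22 c33 pushD !pushZ push1 push2 along11 along22.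
rewrite !subrr !add0r -pullv0 along3 sub0r /S.
by rewrite opprD !scaleNr.
Qed.

Lemma lapS u v : lap (S u v) =
  S (lap1 D1 D2 D3 g1 g2 k1A k2A u v) (lap2 D1 D2 D3 g1 g2 k1A k2A u v).
Proof.
have [[c11 c22 c33] _ _ _ _] := str.
transitivity (along e1 (along e1 (S u v)) - along (nabU e1 e1) (S u v)
  + (along e2 (along e2 (S u v)) - along (nabU e2 e2) (S u v)
  + (along e3 (along e3 (S u v)) - along (nabU e3 e3) (S u v))));
  first exact: big_ord3.
rewrite c11 c22 c33 !alongDl !alongZl !(alongS1, alongS2, alongS3).
exact: comb_laplacian.
Qed.

Let K := pull K0.
Lemma curvfDl X Y Z W : curvf (X + Y) Z W = curvf X Z W + curvf Y Z W.
Proof.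
do 3 (rewrite -big_split; apply: eq_bigr => ? _ /=).
by rewrite -scalerDl rvD; congr (_ *: _); ring.
Qed.
Lemma curvfZl a X Y Z : curvf (a *: X) Y Z = a *: curvf X Y Z.
Proof.
do 3 (rewrite scaler_sumr; apply: eq_bigr => ? _ /=).
by rewrite scalerA rvZ; congr (_ *: _); ring.
Qed.
Lemma curvfDm X Y Z W : curvf X (Y + Z) W = curvf X Y W + curvf X Z W.
Proof.
do 3 (rewrite -big_split; apply: eq_bigr => ? _ /=).
by rewrite -scalerDl rvD; congr (_ *: _); ring.
Qed.
Lemma curvfZm a X Y Z : curvf X (a *: Y) Z = a *: curvf X Y Z.
Proof.
do 3 (rewrite scaler_sumr; apply: eq_bigr => ? _ /=).
by rewrite scalerA rvZ; congr (_ *: _); ring.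
Qed.
Lemma curvf122 : curvf E1 E2 E2 = K *: E1.
Proof.
have [_ _ _ _ [_ h _]] := strO.
by rewrite curvA_pull h pullvZ.
Qed.
Lemma curvf121 : curvf E1 E2 E1 = - K *: E2.
Proof.
have [_ _ _ _ [_ _ h]] := strO.
by rewrite curvA_pull h pullvZ pullN.
Qed.
Lemma curvf211 : curvf E2 E1 E1 = K *: E2.
Proof.
have [_ _ _ _ [_ _ h]] := strO.
by rewrite curvA_pull curvC// h pullvN pullvZ pullN scaleNr opprK.
Qed.
Lemma curvf212 : curvf E2 E1 E2 = - K *: E1.
Proof.
have [_ _ _ _ [_ h _]] := strO.
by rewrite curvA_pull curvC// h pullvN pullvZ scaleNr.
Qed.
Lemma curvfxx X Z : curvf (pullv X) (pullv X) (pullv Z) = 0.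
Proof. by rewrite curvA_pull curv_self pullv0. Qed.

Lemma curvfS11 u v : curvf (S u v) E1 E1 = v *: (K *: E2).
Proof. by rewrite curvfDl !curvfZl curvfxx curvf211 scaler0 add0r. Qed.
Lemma curvfS22 u v : curvf (S u v) E2 E2 = u *: (K *: E1).
Proof. by rewrite curvfDl !curvfZl curvfxx curvf122 scaler0 addr0. Qed.
Lemma curvfSS1 a b u v : curvf (S a b) (S u v) E1 = (a * v - b * u) *: (- K *: E2).
Proof.
rewrite curvfDl !curvfZl !curvfDm !curvfZm !curvfxx curvf121 curvf211.
by rewrite -comb_curv scaleNr opprK.
Qed.
Lemma curvfSS2 a b u v : curvf (S a b) (S u v) E2 = (a * v - b * u) *: (K *: E1).
Proof.
rewrite curvfDl !curvfZl !curvfDm !curvfZm !curvfxx curvf122 curvf212.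
by rewrite -comb_curv scaleNr.
Qed.

Lemma KE : K = cA + 3 * twA * twA.
Proof.
have [_ ga _ _ _] := str; apply: etrans _ ga.
have h1 : pull (act pdO (eps' j0) F2) = act pdU e1 g2.
  by apply/esym; exact: act_pull_push push1.
have h2 : pull (act pdO (eps' j1) F1) = act pdU e2 g1.
  by apply/esym; exact: act_pull_push push2.
have pullE4 a b u v : pull (a - b - u * u - v * v) =
    pull a - pull b - pull u * pull u - pull v * pull v.
  by rewrite !(pullD, pullN, pullM).
exact: etrans (pullE4 _ _ _ _)
  (congr2 (fun u v => u - v - g1 * g1 - g2 * g2) h1 h2).
Qed.

Lemma tritensionS : tritensionA sf fO posH smoothH posG smoothG e' =
  S (tri1 D1 D2 D3 g1 g2 k1A k2A K (- k1A) (- k2A))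
    (tri2 D1 D2 D3 g1 g2 k1A k2A K (- k1A) (- k2A)).
Proof.
transitivity (lap (lap tension')
  - (curvf (lap tension') (push e1) (push e1)
    + (curvf (lap tension') (push e2) (push e2)
    + curvf (lap tension') (push e3) (push e3)))
  - (curvf (along e1 tension') tension' (push e1)
    + (curvf (along e2 tension') tension' (push e2)
    + curvf (along e3 tension') tension' (push e3)))).
  by congr (_ - _ - _); exact: big_ord3.
rewrite tensionS !lapS push1 push2 push3' alongS1 alongS2.
have cf0 X Y : curvf X (pullv 0) Y = 0.
  by rewrite pullv0 -{1}(scale0r (0 : 'rV[A]_2)) curvfZm scale0r.
have cf0r X Y : curvf X Y (pullv 0) = 0.
  rewrite pullv0 /curvA big1// => i _; rewrite big1// => j _; rewrite big1// => k _.
  by rewrite rv0 mulr0 scale0r.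
rewrite [X in _ - (_ + (_ + X)) - _]cf0 [X in _ - _ - (_ + (_ + X))]cf0r !addr0.
rewrite [X in _ - (X + _) - _]curvfS11.
rewrite [X in _ - (_ + X) - _]curvfS22.
rewrite [X in _ - _ - (X + _)]curvfSS1.
rewrite [X in _ - _ - (_ + X)]curvfSS2.
exact: comb_tritension.
Qed.

Hypothesis htri : forall x, oset U x -> tritension G H f e x = 0.
Hypothesis hnz : forall x, oset U x -> tension G H f e x != 0.

Lemma S_eq0 u v : S u v = 0 -> u = 0 /\ v = 0.
Proof.
move=> h; split.
  by transitivity (ipf (S u v) E1); [rewrite /S !ipfE; ring|rewrite h ipf0].
by transitivity (ipf (S u v) E2); [rewrite /S !ipfE; ring|rewrite h ipf0].
Qed.

Let p := k1A * k1A + k2A * k2A.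

Lemma p_neq0 x : oset U x -> p x != 0.
Proof.
move=> Ux; have := hnz Ux.
rewrite (rep_tension sf fO posH smoothH posG smoothG re Ux) tensionS.
apply: contra_neq => h; have : k1A x * k1A x + k2A x * k2A x = 0.
  by rewrite -h /p CinfDE !CinfME.
move/eqP; rewrite paddr_eq0 -?expr2 ?sqr_ge0// !sqrf_eq0 => /andP[/eqP h1 /eqP h2].
by rewrite /S evD !evZ !CinfNE h1 h2 oppr0 !scale0r addr0.
Qed.

Lemma no_nowhere_zero_tension x : ~ oset U x.
Proof.
move=> Ux.
(* Here the absence of zeros of the tension field enters: it makes [p] invertible in the ring. *)
pose p' := mk_Cinf (smooth_onV (oset_open (o:=U)) p_neq0 (Cinf_smooth p)).
have pp' : p' * p = 1.
  apply: CinfP => y Uy; rewrite CinfME mk_CinfE// Cinf1E// mulVf//; exact: p_neq0.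
have [tr1 tr2] : tri1 D1 D2 D3 g1 g2 k1A k2A K (- k1A) (- k2A) = 0 /\
    tri2 D1 D2 D3 g1 g2 k1A k2A K (- k1A) (- k2A) = 0.
  apply: S_eq0; rewrite -tritensionS; apply: ev_inj => y Uy.
  by rewrite ev0 -(rep_tritension sf fO posH smoothH posG smoothG re Uy) htri.
rewrite KE in tr1 tr2.
have [_ ga [h11 h12 h21 h22] [hs1 hs2] hb] := str.
have actc X : act pdU X cA = 0.
  by rewrite /act big1// => i _; rewrite pd_cst mulr0.
have := triharmonic_relation (@Cinf_reduced _ _ U) (@Cinf_torsion_free _ _ U)
  (act_derivation hdU e1) (act_derivation hdU e2) (act_derivation hdU e3)
  (actc e1) (actc e2) (actc e3) (fun a => (hb a).1) (fun a => (hb a).2)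
  basic1 basic2 hs1 hs2 h11 h12 h21 h22 ga tr1 tr2 pp'.
move=> /(congr1 (fun a : A => a x)); rewrite -/p CinfDE !CinfME !Cinf_natE// Cinf0E.
set y := (_ - _ : A).
(* Evaluated at the point, the relation equates to zero a positive multiple of the cube of [p x]
   plus a multiple of a real square. *)
move=> /eqP; apply/negP; rewrite gt_eqF//.
have p0 : 0 < p x.
  have pE : p x = k1A x * k1A x + k2A x * k2A x by rewrite /p CinfDE !CinfME.
  by rewrite lt0r p_neq0// pE addr_ge0// -expr2 sqr_ge0.
by rewrite ltr_wpDr ?mulr_gt0// mulr_ge0// -expr2 sqr_ge0.
Qed.
End Core.

(** * Independence of the frame *)

Section TraceFrame.
Variables (A : comPzRingType) (n : nat) (V : lmodType A).
Variable (B : 'rV[A]_n -> 'rV[A]_n -> V).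
Hypotheses (BDl : forall X Y Z, B (X + Y) Z = B X Z + B Y Z)
  (BZl : forall a X Z, B (a *: X) Z = a *: B X Z)
  (BDr : forall X Y Z, B X (Y + Z) = B X Y + B X Z)
  (BZr : forall a X Z, B X (a *: Z) = a *: B X Z).

Lemma bilin_sum X Y :
  B X Y = \sum_k \sum_l (X 0 k * Y 0 l) *: B (delta_mx 0 k) (delta_mx 0 l).
Proof.
have B0l Z : B 0 Z = 0 by rewrite -{1}(scale0r (0 : 'rV[A]_n)) BZl scale0r.
have B0r Z : B Z 0 = 0 by rewrite -{1}(scale0r (0 : 'rV[A]_n)) BZr scale0r.
rewrite {1}(row_sum_delta X) (big_morph (B^~ Y) (fun X1 X2 => BDl X1 X2 Y) (B0l Y)).
apply: eq_bigr => k _; rewrite BZl {1}(row_sum_delta Y).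
rewrite (big_morph (B _) (BDr _) (B0r _)) scaler_sumr.
by apply: eq_bigr => l _; rewrite BZr scalerA.
Qed.

(** By [frame_matrix] both frames give the same matrix E^T E, the inverse of [g], and the trace
    depends on the frame only through it. *)
Lemma trace_frame (g : 'M[A]_n) (e e' : 'I_n -> 'rV[A]_n) :
  (forall i j, (e i *m g *m (e j)^T) 0 0 = (i == j)%:R) ->
  (forall i j, (e' i *m g *m (e' j)^T) 0 0 = (i == j)%:R) ->
  \sum_i B (e i) (e i) = \sum_i B (e' i) (e' i).
Proof.
move=> /frame_matrix on /frame_matrix on'.
have tr (h : 'I_n -> 'rV[A]_n) : \sum_i B (h i) (h i) =
    \sum_k \sum_l (((\matrix_i h i)^T *m \matrix_i h i) k l)
      *: B (delta_mx 0 k) (delta_mx 0 l).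
  under eq_bigr do rewrite bilin_sum.
  rewrite exchange_big; apply: eq_bigr => k _; rewrite exchange_big.
  apply: eq_bigr => l _ /=; rewrite -scaler_suml mxE; congr (_ *: _).
  by apply: eq_bigr => i _; rewrite !mxE.
rewrite !tr; suff -> : (\matrix_i e i)^T *m (\matrix_i e i) =
  (\matrix_i e' i)^T *m (\matrix_i e' i) by [].
rewrite -mulmxA in on; rewrite -mulmxA in on'; have on1 := mulmx1C on'.
by rewrite -[LHS]mul1mx -on1 -mulmxA on mulmx1.
Qed.
End TraceFrame.

Section TensionFrame.
Variables (R : realType) (m n : nat) (U : openset R m) (O : openset R n).
Variable f : 'rV[R]_m -> 'rV[R]_n.
Hypotheses (sf : smooth_on U f) (fO : forall x, oset U x -> oset O (f x)).
Variables (G : 'rV[R]_m -> 'M[R]_m) (H : 'rV[R]_n -> 'M[R]_n).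
Hypothesis posG : forall x, oset U x -> forall u, u != 0 -> 0 < inner G x u u.
Hypothesis smoothG : forall i j, smooth_on U (entry G i j).
Hypothesis posH : forall x, oset O x -> forall u, u != 0 -> 0 < inner H x u u.
Hypothesis smoothH : forall i j, smooth_on O (entry H i j).

Lemma tension_frame e e' : orthonormal_frame G U e -> orthonormal_frame G U e' ->
  forall x, oset U x -> tension G H f e x = tension G H f e' x.
Proof.
move=> one one' x Ux.
have r (e0 : 'I_m -> 'rV[R]_m -> 'rV[R]_m) (h : orthonormal_frame G U e0) i :
    rep (e0 i) (mk_vec (h.1 i)) by exact: mk_vec_rep.
have t e0 h := rep_tension sf fO posH smoothH posG smoothG (r e0 h) Ux.
apply: etrans (t _ one) (etrans (congr1 (ev x) _) (esym (t _ one'))).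
have on (e0 : 'I_m -> 'rV[R]_m -> 'rV[R]_m) (h : orthonormal_frame G U e0) i j :
    (mk_vec (h.1 i) *m gmat smoothG *m (mk_vec (h.1 j))^T) 0 0 = (i == j)%:R.
  apply: CinfP => y Uy; rewrite [LHS](ipE smoothG _ _ Uy) -!r// h.2//.
  by rewrite Cinf_natE.
(* The second fundamental form of [f], whose trace is the tension field. *)
pose B X Y := alongA sf fO posH smoothH X (pushA sf Y)
  - pushA sf (nab (@pd R m U) (chr posG smoothG) X Y).
apply: (@trace_frame _ _ _ B _ _ _ _ (gmat smoothG)); [| | | |exact: on..].
- by move=> X Y Z; rewrite /B alongDl nabDl pushD opprD addrACA.
- by move=> a X Z; rewrite /B alongZl nabZl pushZ scalerBr.
- move=> X Y Z; rewrite /B pushD alongD (nabDr _ (@pd_derivation _ _ _)) pushD.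
  by rewrite opprD addrACA.
(* Linearity over functions in the second argument: the two Leibniz terms, both equal to X(a) df(Z),
   cancel. *)
- move=> a X Z; rewrite /B pushZ alongZ (nabZr _ (@pd_derivation _ _ _)) pushD !pushZ.
  by rewrite opprD addrACA subrr add0r scalerBr.
Qed.
End TensionFrame.

(** * Smooth Gram-Schmidt process *)

Section SmoothFields.
Variables (R : realType) (n k : nat) (U : set 'rV[R]_n).
Hypothesis openU : open U.
Implicit Types X Y : 'rV[R]_n -> 'rV[R]_k.

Lemma smooth_onZv (a : 'rV[R]_n -> R) X : smooth_on U a -> smooth_on U X ->
  smooth_on U (fun x => a x *: X x).
Proof.
move=> sa sX; apply/smooth_on_rVP => // j; have sXj := (smooth_on_rVP openU X).1 sX j.
by apply: (smooth_on_eq openU _ (smooth_onM openU sa sXj)) => x _; rewrite mxE.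
Qed.
Lemma smooth_onBv X Y : smooth_on U X -> smooth_on U Y ->
  smooth_on U (fun x => X x - Y x).
Proof.
move=> sX sY; apply/smooth_on_rVP => // j.
have [sXj sYj] := ((smooth_on_rVP openU X).1 sX j, (smooth_on_rVP openU Y).1 sY j).
by apply: (smooth_on_eq openU _ (smooth_onB openU sXj sYj)) => x _; rewrite !mxE.
Qed.
End SmoothFields.

Section GramSchmidt.
Variables (R : realType) (n : nat) (U : set 'rV[R]_n) (G : 'rV[R]_n -> 'M[R]_n).
Hypothesis openU : open U.
Hypothesis symG : forall x, U x -> (G x)^T = G x.
Hypothesis posG : forall x, U x -> forall u, u != 0 -> 0 < inner G x u u.
Hypothesis smoothG : forall i j, smooth_on U (entry G i j).
Implicit Types X Y : 'rV[R]_n -> 'rV[R]_n.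

Lemma smooth_on_inner X Y : smooth_on U X -> smooth_on U Y ->
  smooth_on U (fun x => inner G x (X x) (Y x)).
Proof.
move=> /(smooth_on_rVP openU) sX /(smooth_on_rVP openU) sY.
apply: (smooth_on_eq openU (fun x _ => esym (innerE G x (X x) (Y x)))).
apply: smooth_on_sum => // j _; apply: smooth_on_sum => // i _.
by apply: smooth_onM => //; apply: smooth_onM => //; exact: smoothG.
Qed.

Definition normalize X x := (Num.sqrt (inner G x (X x) (X x)))^-1 *: X x.

Lemma normalize_unit X x : U x -> X x != 0 ->
  inner G x (normalize X x) (normalize X x) = 1.
Proof.
move=> Ux X0; rewrite /normalize innerZl (inner_sym symG)// innerZl mulrA -expr2 exprVn.
by rewrite sqr_sqrtr ?ltW ?posG// mulVf// gt_eqF// posG.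
Qed.

Lemma smooth_on_normalize X : smooth_on U X -> (forall x, U x -> X x != 0) ->
  smooth_on U (normalize X).
Proof.
move=> sX X0; apply: smooth_onZv => //; apply: smooth_onV => //.
  by move=> x Ux; rewrite gt_eqF// sqrtr_gt0 posG// X0.
apply: smooth_on_sqrt => //; last exact: smooth_on_inner.
by move=> x Ux; rewrite posG// X0.
Qed.

Definition reject X Y x := Y x - inner G x (Y x) (X x) *: X x.

Lemma innerBl x (u v w : 'rV[R]_n) : inner G x (u - v) w = inner G x u w - inner G x v w.
Proof. by rewrite innerDl -scaleN1r innerZl mulN1r. Qed.

Lemma reject_orth X Y x : inner G x (X x) (X x) = 1 -> inner G x (reject X Y x) (X x) = 0.
Proof. by move=> h; rewrite /reject innerBl innerZl h mulr1 subrr. Qed.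

Lemma smooth_on_reject X Y : smooth_on U X -> smooth_on U Y -> smooth_on U (reject X Y).
Proof.
move=> sX sY; apply: smooth_onBv => //; apply: smooth_onZv => //.
exact: smooth_on_inner.
Qed.
End GramSchmidt.

Section SurfaceFrame.
Variables (R : realType) (O : set 'rV[R]_2) (H : 'rV[R]_2 -> 'M[R]_2).
Hypothesis openO : open O.
Hypothesis symH : forall x, O x -> (H x)^T = H x.
Hypothesis posH : forall x, O x -> forall u, u != 0 -> 0 < inner H x u u.
Hypothesis smoothH : forall i j, smooth_on O (entry H i j).

Let b (j : 'I_2) (x : 'rV[R]_2) : 'rV[R]_2 := delta_mx 0 j.
Let eps0 := normalize H (b 0).
Let eps1 := normalize H (reject H eps0 (b 1)).

Lemma surface_frame : exists eps, orthonormal_frame H O eps.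
Proof.
have sb j : smooth_on O (b j) by exact: smooth_on_cst.
have b0 x : b 0 x != 0.
  by apply/eqP => /rowP/(_ 0); rewrite !mxE eqxx => /eqP; rewrite oner_eq0.
have n0 x : O x -> inner H x (eps0 x) (eps0 x) = 1.
  by move=> Ox; exact: (normalize_unit symH posH Ox (b0 x)).
have s0 : smooth_on O eps0 by exact: smooth_on_normalize.
(* The second coordinate of this field is 1, since [eps0] is a multiple of the first coordinate
   field. *)
have r0 x : reject H eps0 (b 1) x != 0.
  apply/eqP => /rowP/(_ 1); rewrite /reject /eps0 /normalize !mxE /= !mulr0 subr0.
  by move/eqP; rewrite oner_eq0.
have sr : smooth_on O (reject H eps0 (b 1)) by exact: smooth_on_reject.
have s1 : smooth_on O eps1 by exact: smooth_on_normalize.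
have n1 x : O x -> inner H x (eps1 x) (eps1 x) = 1.
  by move=> Ox; exact: (normalize_unit symH posH Ox (r0 x)).
have o10 x : O x -> inner H x (eps1 x) (eps0 x) = 0.
  by move=> Ox; rewrite /eps1 {1}/normalize innerZl reject_orth ?mulr0// n0.
exists (fun j => if j == 0 then eps0 else eps1); split.
  by move=> j; case: (j == 0).
move=> x Ox i j.
case: i => [[|[|//]] hi]; case: j => [[|[|//]] hj] /=; rewrite ?n0 ?n1 ?o10//.
by rewrite (inner_sym symH)// o10.
Qed.
End SurfaceFrame.

(** * Adapted frames *)

Section CrossProduct.
Variable R : comPzRingType.
Implicit Types p q w : 'rV[R]_3.
Let i0 : 'I_3 := ord0.
Let i1 : 'I_3 := lift ord0 ord0.
Let i2 : 'I_3 := lift ord0 (lift ord0 ord0).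

Definition dot p q := \sum_i p 0 i * q 0 i.
Definition cross p q : 'rV[R]_3 := \row_i
  [:: p 0 i1 * q 0 i2 - p 0 i2 * q 0 i1;
      p 0 i2 * q 0 i0 - p 0 i0 * q 0 i2;
      p 0 i0 * q 0 i1 - p 0 i1 * q 0 i0]`_i.

Lemma dotE p q : dot p q = p 0 i0 * q 0 i0 + (p 0 i1 * q 0 i1 + p 0 i2 * q 0 i2).
Proof. exact: big_ord3. Qed.
Lemma cross0 p q : cross p q 0 i0 = p 0 i1 * q 0 i2 - p 0 i2 * q 0 i1.
Proof. by rewrite mxE. Qed.
Lemma cross1 p q : cross p q 0 i1 = p 0 i2 * q 0 i0 - p 0 i0 * q 0 i2.
Proof. by rewrite mxE. Qed.
Lemma cross2 p q : cross p q 0 i2 = p 0 i0 * q 0 i1 - p 0 i1 * q 0 i0.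
Proof. by rewrite mxE. Qed.
Let crossE := (cross0, cross1, cross2).

Lemma row3P p q : p 0 i0 = q 0 i0 -> p 0 i1 = q 0 i1 -> p 0 i2 = q 0 i2 -> p = q.
Proof.
move=> h0 h1 h2; apply/rowP => -[[|[|[|//]]] hi].
- by rewrite (_ : Ordinal hi = i0) //; exact: val_inj.
- by rewrite (_ : Ordinal hi = i1) //; exact: val_inj.
- by rewrite (_ : Ordinal hi = i2) //; exact: val_inj.
Qed.

Lemma dot_crossl p q : dot (cross p q) p = 0.
Proof. by rewrite dotE !crossE; ring. Qed.
Lemma dot_crossr p q : dot (cross p q) q = 0.
Proof. by rewrite dotE !crossE; ring. Qed.
Lemma dot_cross_rot p q w : dot (cross p q) w = dot (cross q w) p.
Proof. by rewrite !dotE !crossE; ring. Qed.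
Lemma cross_binet_cauchy p q u v :
  dot (cross p q) (cross u v) = dot u p * dot v q - dot v p * dot u q.
Proof. by rewrite !dotE !crossE; ring. Qed.

(** From the expansion of the triple cross product; keeping the squared length on the left avoids
    division. *)
Lemma cross_orth p q w : dot w p = 0 -> dot w q = 0 ->
  dot (cross p q) (cross p q) *: w = dot w (cross p q) *: cross p q.
Proof.
move=> hp hq.
have : dot (cross p q) (cross p q) *: w - dot w (cross p q) *: cross p q =
    dot w q *: cross (cross p q) p - dot w p *: cross (cross p q) q.
  by apply: row3P; rewrite !rvE !dotE !crossE; ring.
by rewrite hp hq !scale0r subrr => /eqP; rewrite subr_eq0 => /eqP.
Qed.
End CrossProduct.

Section AdaptedFrame.
Variables (R : realType) (U : set 'rV[R]_3) (O : set 'rV[R]_2).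
Hypotheses (openU : open U) (openO : open O).
Variable f : 'rV[R]_3 -> 'rV[R]_2.
Hypotheses (sf : smooth_on U f) (fO : forall x, U x -> O (f x)).
Variables (G : 'rV[R]_3 -> 'M[R]_3) (H : 'rV[R]_2 -> 'M[R]_2).
Hypothesis symG : forall x, U x -> (G x)^T = G x.
Hypothesis posG : forall x, U x -> forall u, u != 0 -> 0 < inner G x u u.
Hypothesis smoothG : forall i j, smooth_on U (entry G i j).
Variable eps : 'I_2 -> 'rV[R]_2 -> 'rV[R]_2.
Hypothesis oneps : orthonormal_frame H O eps.
Hypothesis surj : forall x, U x -> forall v, exists u, 'D_u f x = v.
Hypothesis iso : forall x, U x -> forall u w, horizontal G f x u -> horizontal G f x w ->
  inner H (f x) ('D_u f x) ('D_w f x) = inner G x u w.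

(** The gradients are Euclidean, in coordinates; their cross product [v] spans the kernel of the
    differential, and the metric [G] enters only through [normalize] and [reject]. *)
Let grad j x : 'rV[R]_3 := \row_i partial i (fun y => f y 0 j) x.
Let v x := cross (grad ord0 x) (grad (lift ord0 ord0) x).
Let N x := (dot (v x) (v x))^-1.
(** [a0] and [a1] are dual to the two gradients, that is, smooth lifts of the coordinate vectors of
    the target. Subtracting their vertical part later makes the lifts of [eps] horizontal. *)
Let a0 x := N x *: cross (grad (lift ord0 ord0) x) (v x).
Let a1 x := N x *: cross (v x) (grad ord0 x).
Let e2 := normalize G v.
Let w j x := eps j (f x) 0 ord0 *: a0 x + eps j (f x) 0 (lift ord0 ord0) *: a1 x.
Let e j := reject G e2 (w j).

Let dfE x u j : U x -> ('D_u f x) 0 j = dot u (grad j x).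
Proof.
move=> Ux; have df := smooth_on_diff sf Ux; rewrite derive_rV//.
rewrite derive_partial; last by move/differentiable_rVP : df; exact.
by apply: eq_bigr => i _; rewrite mxE.
Qed.

Let row2P (p q : 'rV[R]_2) :
  p 0 ord0 = q 0 ord0 -> p 0 (lift ord0 ord0) = q 0 (lift ord0 ord0) -> p = q.
Proof.
move=> h0 h1; apply/rowP => -[[|[|//]] hi].
- by rewrite (_ : Ordinal hi = ord0) //; exact: val_inj.
- by rewrite (_ : Ordinal hi = lift ord0 ord0) //; exact: val_inj.
Qed.

Let smooth_row3 (X : 'rV[R]_3 -> 'rV[R]_3) :
  smooth_on U (fun x => X x 0 ord0) -> smooth_on U (fun x => X x 0 (lift ord0 ord0)) ->
  smooth_on U (fun x => X x 0 (lift ord0 (lift ord0 ord0))) -> smooth_on U X.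
Proof.
move=> h0 h1 h2; apply/smooth_on_rVP => // -[[|[|[|//]]] hi].
- by rewrite (_ : Ordinal hi = ord0) //; exact: val_inj.
- by rewrite (_ : Ordinal hi = lift ord0 ord0) //; exact: val_inj.
- by rewrite (_ : Ordinal hi = lift ord0 (lift ord0 ord0)) //; exact: val_inj.
Qed.

Let smooth_cross (X Y : 'rV[R]_3 -> 'rV[R]_3) : smooth_on U X -> smooth_on U Y ->
  smooth_on U (fun x => cross (X x) (Y x)).
Proof.
move=> /(smooth_on_rVP openU) sX /(smooth_on_rVP openU) sY.
have sM i j : smooth_on U (fun x => X x 0 i * Y x 0 j) by exact: smooth_onM.
apply: smooth_row3.
- exact: (smooth_on_eq openU (fun x _ => esym (cross0 (X x) (Y x)))
    (smooth_onB openU (sM _ _) (sM _ _))).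
- exact: (smooth_on_eq openU (fun x _ => esym (cross1 (X x) (Y x)))
    (smooth_onB openU (sM _ _) (sM _ _))).
- exact: (smooth_on_eq openU (fun x _ => esym (cross2 (X x) (Y x)))
    (smooth_onB openU (sM _ _) (sM _ _))).
Qed.

Let smooth_dot (X Y : 'rV[R]_3 -> 'rV[R]_3) : smooth_on U X -> smooth_on U Y ->
  smooth_on U (fun x => dot (X x) (Y x)).
Proof.
move=> /(smooth_on_rVP openU) sX /(smooth_on_rVP openU) sY.
by apply: smooth_on_sum => // i _; exact: smooth_onM.
Qed.

Let s_grad j : smooth_on U (grad j).
Proof.
apply/smooth_on_rVP => // i.
have sfj : smooth_on U (partial i (fun y => f y 0 j)).
  by apply: smooth_on_partial => //; move/(smooth_on_rVP openU) : sf; exact.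
by apply: (smooth_on_eq openU _ sfj) => x _; rewrite mxE.
Qed.
Let s_v : smooth_on U v. Proof. exact: smooth_cross. Qed.

(** If [u0] and [u1] lift the coordinate vectors, the Binet-Cauchy identity gives [v] the product 1
    with their cross product. *)
Let v_neq0 x : U x -> v x != 0.
Proof.
move=> Ux; have [u0 h0] := surj Ux (delta_mx 0 ord0).
have [u1 h1] := surj Ux (delta_mx 0 (lift ord0 ord0)).
apply/eqP => vx0; have := cross_binet_cauchy (grad ord0 x) (grad (lift ord0 ord0) x) u0 u1.
rewrite -/(v x) vx0 -!dfE// h0 h1 !mxE /= => /eqP.
rewrite /dot big1; first by rewrite mul1r mul0r subr0 eq_sym oner_eq0.
by move=> i _; rewrite mxE mul0r.
Qed.

Let dot_v x : U x -> dot (v x) (v x) != 0.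
Proof.
move=> Ux; have := v_neq0 Ux; apply: contraNneq => h.
have vi i : v x 0 i = 0.
  apply/eqP; rewrite -sqrf_eq0 expr2.
  have := psumr_eq0P (I := 'I_3) (P := xpredT) (F := fun i => v x 0 i * v x 0 i).
  by move=> /(_ _ h i isT) ->// j _; rewrite -expr2 sqr_ge0.
by apply/eqP/rowP => i; rewrite vi mxE.
Qed.

Let s_N : smooth_on U N.
Proof. by apply: smooth_onV => //; exact: smooth_dot. Qed.
Let s_a0 : smooth_on U a0.
Proof. by apply: smooth_onZv => //; exact: smooth_cross. Qed.
Let s_a1 : smooth_on U a1.
Proof. by apply: smooth_onZv => //; exact: smooth_cross. Qed.
Let s_e2 : smooth_on U e2. Proof. exact: smooth_on_normalize. Qed.
Let s_eps j k : smooth_on U (fun x => eps j (f x) 0 k).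
Proof.
exact: (smooth_on_comp openU sf fO ((smooth_on_rVP openO _).1 (oneps.1 j) k)).
Qed.
Let s_w j : smooth_on U (w j).
Proof. by apply: smooth_onD => //; exact: smooth_onZv. Qed.
Let s_e j : smooth_on U (e j). Proof. exact: smooth_on_reject. Qed.

Let dotZl a p q : dot (a *: p) q = a * dot p q :> R.
Proof. by rewrite mulr_sumr; apply: eq_bigr => i _; rewrite rvZ mulrA. Qed.
Let dotDl p q r : dot (p + q) r = dot p r + dot q r :> R.
Proof. by rewrite -big_split; apply: eq_bigr => i _; rewrite /= rvD mulrDl. Qed.

Let df_e2 x : U x -> 'D_(e2 x) f x = 0.
Proof.
move=> Ux; apply: row2P; rewrite dfE// /e2 /normalize dotZl [RHS]mxE.
  by rewrite /v dot_crossl mulr0.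
by rewrite /v dot_crossr mulr0.
Qed.

Let df_w j x : U x -> 'D_(w j x) f x = eps j (f x).
Proof.
move=> Ux; have v0 := dot_v Ux; apply: row2P; rewrite dfE// /w dotDl !dotZl.
  rewrite dot_crossr -dot_cross_rot -/(v x).
  by rewrite /N mulVf// mulr1 !mulr0 addr0.
rewrite dot_crossl dot_cross_rot -/(v x).
by rewrite /N mulVf// mulr1 !mulr0 add0r.
Qed.

Let df_e j x : U x -> 'D_(e j x) f x = eps j (f x).
Proof.
move=> Ux; apply: etrans (df_w j Ux).
have h2 k : dot (e2 x) (grad k x) = 0 by rewrite -(dfE _ _ Ux) df_e2// mxE.
rewrite /e /reject -scaleNr; move: (- _) => r.
have dr k : dot (w j x + r *: e2 x) (grad k x) = dot (w j x) (grad k x).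
  apply: etrans (dotDl _ _ _) (etrans _ (addr0 _)); congr (_ + _).
  by apply: etrans (dotZl _ _ _) _; rewrite h2 mulr0.
by apply: row2P; rewrite [LHS](dfE _ _ Ux) [RHS](dfE _ _ Ux).
Qed.

Let n2 x : U x -> inner G x (e2 x) (e2 x) = 1.
Proof. by move=> Ux; exact: (normalize_unit symG posG Ux (v_neq0 Ux)). Qed.

Let o_e2 j x : U x -> inner G x (e j x) (e2 x) = 0.
Proof. by move=> Ux; rewrite /e reject_orth// n2. Qed.

(** Every vector killed by the differential is a multiple of [v], hence of [e2], to which [e j] was
    made orthogonal. *)
Let hor j x : U x -> horizontal G f x (e j x).
Proof.
move=> Ux u du.
have du0 k : dot u (grad k x) = 0 by rewrite -dfE// du mxE.
have h := cross_orth (du0 ord0) (du0 (lift ord0 ord0)).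
have ev0 : inner G x (v x) (e j x) = 0.
  have s0 : Num.sqrt (inner G x (v x) (v x)) != 0.
    by rewrite gt_eqF// sqrtr_gt0 posG// v_neq0.
  apply: (mulfI (invr_neq0 s0)); rewrite mulr0 -innerZl -/(normalize G v x) -/(e2 x).
  by rewrite (inner_sym symG)// o_e2.
rewrite (inner_sym symG)//; apply: (mulfI (dot_v Ux)).
by rewrite -innerZl h innerZl ev0 !mulr0.
Qed.

Lemma adapted_frame : exists e : 'I_3 -> 'rV[R]_3 -> 'rV[R]_3,
  [/\ orthonormal_frame G U e,
      forall x, U x -> 'D_(e ord0 x) f x = eps ord0 (f x),
      forall x, U x -> 'D_(e (lift ord0 ord0) x) f x = eps (lift ord0 ord0) (f x)
    & forall x, U x -> 'D_(e (lift ord0 (lift ord0 ord0)) x) f x = 0].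
Proof.
have on j k x : U x -> inner G x (e j x) (e k x) = (j == k)%:R.
  (* The lifts are horizontal, so their products are those of the frame [eps] on the target. *)
  by move=> Ux; rewrite -iso ?df_e//; [exact: oneps.2 (fO Ux) j k|exact: hor..].
exists (fun i => nth e2 [:: e ord0; e (lift ord0 ord0)] i); split.
- split.
    by move=> [[|[|[|//]]] hi] /=; [exact: s_e|exact: s_e|exact: s_e2].
  move=> x Ux [[|[|[|//]]] hi] [[|[|[|//]]] hj] /=;
    rewrite ?on ?n2 ?o_e2//.
  + by rewrite (inner_sym symG)// o_e2.
  + by rewrite (inner_sym symG)// o_e2.
- by move=> x Ux; exact: df_e.
- by move=> x Ux; exact: df_e.
- by move=> x Ux; exact: df_e2.
Qed.
End AdaptedFrame.

Lemma smooth_on_subset (R : realType) (n : nat) (W : normedModType R)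
    (U V : set 'rV[R]_n) (F : 'rV[R]_n -> W) :
  U `<=` V -> smooth_on V F -> smooth_on U F.
Proof. by move=> UV sF s x /UV; exact: sF. Qed.

Theorem theorem1p3 (R : realType) (c : R)
    (M : manifold R 3) (g : riemannian_metric M)
    (N : manifold R 2) (h : riemannian_metric N)
    (phi : M -> N)
    (hc : constant_sectional_curvature g c)
    (hphi : riemannian_submersion g h phi)
    (htri : triharmonic_map g h phi) :
  harmonic_map g h phi.
Proof.
move=> a b W e oW Wdom one x Wx; have [[_ sphi] hsub] := hphi.
set f := local_expr phi a b; pose O := chart_img b.
have oO : open O := @chart_img_open _ _ N b.
have sfW : smooth_on W f := smooth_on_subset Wdom (sphi a b).
have WO y : W y -> O (f y).
  move=> /Wdom [q [aq bq] <-]; exists (phi q) => //.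
  by rewrite /f /local_expr /= chart_mapK.
have Wimg y : W y -> chart_img a y by move=> /Wdom [q [aq _] <-]; exists q.
have symG y (Wy : W y) := @Defs.metric_sym _ _ _ g a _ (Wimg y Wy).
have posG y (Wy : W y) := @Defs.metric_pos _ _ _ g a _ (Wimg y Wy).
have smG i j : smooth_on W (entry (g a) i j).
  by apply: smooth_on_subset (@Defs.metric_smooth _ _ _ g a i j).
have symH := @Defs.metric_sym _ _ _ h b; have posH := @Defs.metric_pos _ _ _ h b.
have smH := @Defs.metric_smooth _ _ _ h b.
have [eps oneps] := surface_frame oO symH posH smH.
have surj y : W y -> forall v, exists u, 'D_u f y = v.
  by move=> /Wdom /hsub[].
have iso y : W y -> forall u w, horizontal (g a) f y u -> horizontal (g a) f y w ->
    inner (h b) (f y) ('D_u f y) ('D_w f y) = inner (g a) y u w.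
  by move=> /Wdom /hsub[].
have [e' [one' de0 de1 de2]] := adapted_frame oW oO sfW WO symG posG smG oneps surj iso.
pose WS := OpenSet oW; pose OS := OpenSet oO.
(* The frame of the statement is arbitrary; from here on the adapted frame is used. *)
rewrite (tension_frame (U := WS) (O := OS) sfW WO posG smG posH smH one one' Wx).
apply/eqP/negPn/negP => tx0.
pose T := tension (g a) (h b) f e'.
have sT : smooth_on W T.
  apply: (rep_smooth (U := WS)).
  exact: (rep_tension (U := WS) (O := OS) sfW WO posH smH posG smG
    (fun i => mk_vec_rep (U := WS) (one'.1 i))).
(* If the tension field were nonzero at [x], it would have no zero on this set, open by continuity
   and containing [x]. *)
pose U := W `&` [set y | T y != 0].
have oU : open U.
  rewrite openE => y [Wy Ty0]; rewrite /interior.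
  apply: filterI; first exact: open_nbhs_nbhs.
  have cT : {for y, continuous T}.
    exact: differentiable_continuous (smooth_on_diff sT Wy).
  exact: cvgr_neq0 cT Ty0.
have UW : U `<=` W by move=> y [].
pose US := OpenSet oU.
apply: (@no_nowhere_zero_tension R c US OS f (smooth_on_subset UW sfW)
  (fun y Uy => WO y Uy.1) (g a) (h b) (fun y Uy => symG y Uy.1) (fun y Uy => posG y Uy.1)
  (fun i j => smooth_on_subset UW (smG i j)) symH posH smH e' eps _ oneps
  (fun y Uy => de0 y Uy.1) (fun y Uy => de1 y Uy.1) (fun y Uy => de2 y Uy.1)
  _ _ (fun y Uy => Uy.2) x).
- split=> [i|y Uy]; first exact: smooth_on_subset UW (one'.1 i).
  exact: one'.2 y Uy.1.
- by move=> y Uy u w; exact: hc (Wimg y Uy.1) u w.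
(* Triharmonicity is assumed for all orthonormal frames, so it applies directly to the adapted
   one. *)
- move=> y Uy; apply: (htri a b W e' oW Wdom one').
  exact: Uy.1.
- by [].
Qed.
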